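(* Let $K$ be a field of characteristic $p>2$. Then there exists an $\mathbb{N}$-graded ring $R$ of dimension three, finitely generated over the field $R_0=K$, with homogeneous maximal ideal $\mathfrak{m}=\bigoplus_{i>0}R_i$, such that $R$ is not F-pure, but $R/tR$ is F-regular for some homogeneous nonzerodivisor $t\in\mathfrak{m}$. Specifically, let $m$ and $n$ be positive integers satisfying $m-\frac{m}{n}>2$, and let $R=K[A,B,C,D,T]/I$, where $I$ is the ideal generated by the size two minors of the matrix $$\begin{pmatrix} A^2+T^m & B & D\\ C & A^2 & B^n-D\end{pmatrix}.$$ Let $t$ denote the image of $T$ in $R$. Then the ring $R/tR$ is F-regular, whereas $R$ is not F-regular. If moreover $p$ and $m$ are relatively prime, then $R$ is not F-pure.
   Context: All rings are commutative, Noetherian, with identity. An $\mathbb{N}$-graded ring is a ring $R=\bigoplus_{i\ge 0}R_i$ finitely generated over a field $R_0=K$. The ring $K[A,B,C,D,T]/I$ of the claim is $\mathbb{N}$-graded by giving $A,B,C,D,T$ the weights $m,2m,2m,2mn,2$ respectively. Let $R$ be a ring of prime characteristic $p>0$; $q=p^e$ denotes a power of $p$ with $e\ge 0$. For an ideal $I=(x_1,\dots,x_r)$ put $I^{[q]}=(x_1^q,\dots,x_r^q)$. Let $R^\circ$ be the complement of the union of the minimal primes of $R$. The tight closure $I^*$ of $I$ is the set of $x\in R$ for which there exists $c\in R^\circ$ with $cx^q\in I^{[q]}$ for all $q=p^e\gg 0$; $I$ is tightly closed if $I=I^*$. $R$ is weakly F-regular if every ideal of $R$ is tightly closed, and F-regular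 if every localization of $R$ is weakly F-regular. $R$ is F-pure if the Frobenius homomorphism $F:R\to R$, $x\mapsto x^p$, is pure, i.e., it remains injective after tensoring (over the source copy of $R$) with every $R$-module $M$. *)

(* Defs.v *)
From HB Require Import structures.
From mathcomp Require Import all_boot all_order all_algebra.
From mathcomp Require Import generic_quotient ring_quotient.
From mathcomp Require Import boolp classical_sets.
From mathcomp Require Import freeg mpoly.

Set Implicit Arguments.
Unset Strict Implicit.
Unset Printing Implicit Defensive.

Import GRing.Theory.
Local Open Scope classical_set_scope.
Local Open Scope quotient_scope.
Local Open Scope ring_scope.

Section Subgroups.
Variable V : zmodType.

Definition is_subgroup (G : set V) : Prop :=
  G 0 /\ forall x y, G x -> G y -> G (x - y).

Definition subgroup_gen (X : set V) : set V := smallest is_subgroup X.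

Lemma subgroup_gen_subgroup (X : set V) : is_subgroup (subgroup_gen X).
Proof.
split=> [G [[]]//|x y Gx Gy G GX].
by case: (GX) => -[_ GB] _; apply: GB; [apply: Gx | apply: Gy].
Qed.

Definition in_subgroup_gen (X : set V) (x : V) : bool := `[< subgroup_gen X x >].

Lemma in_subgroup_gen_closed (X : set V) : zmod_closed (in_subgroup_gen X).
Proof.
have [G0 GB] := subgroup_gen_subgroup X.
by split=> [|x y /asboolP Gx /asboolP Gy]; apply/asboolP => //; apply: GB.
Qed.

HB.instance Definition _ (X : set V) :=
  GRing.isZmodClosed.Build V (in_subgroup_gen X) (in_subgroup_gen_closed X).

Definition subgroup_closed (X : set V) : zmodClosed V :=
  GRing.ZmodClosed.clone V (in_subgroup_gen X) _.

End Subgroups.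

Section Ideals.
Variable R : comPzRingType.
Implicit Types (I P Q : set R) (X : set R).

Definition is_ideal I : Prop :=
  [/\ I 0, forall x y, I x -> I y -> I (x + y) & forall a x, I x -> I (a * x)].

Definition ideal_gen X : set R := smallest is_ideal X.

Definition is_prime P : Prop :=
  [/\ is_ideal P, ~ P 1 & forall x y, P (x * y) -> P x \/ P y].

Definition is_minimal_prime P : Prop :=
  is_prime P /\ forall Q, is_prime Q -> Q `<=` P -> Q = P.

Definition nonzerodivisor (t : R) : Prop := forall x, t * x = 0 -> x = 0.

Definition prime_chain (k : nat) (P : nat -> set R) : Prop :=
  (forall i, (i <= k)%N -> is_prime (P i)) /\
  (forall i, (i < k)%N -> P i `<` P i.+1).

Definition has_krull_dim (d : nat) : Prop :=
  (exists P : nat -> set R, prime_chain d P) /\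
  (forall k (P : nat -> set R), prime_chain k P -> (k <= d)%N).

Definition is_subring X : Prop :=
  [/\ X 1, forall x y, X x -> X y -> X (x - y)
    & forall x y, X x -> X y -> X (x * y)].

Definition subring_gen X : set R := smallest is_subring X.

Lemma ideal_gen_ideal X : is_ideal (ideal_gen X).
Proof.
split=> [I [[]]//|x y Ix Iy I IX|a x Ix I IX].
  by case: (IX) => -[_ ID _] _; apply: ID; [apply: Ix | apply: Iy].
by case: (IX) => -[_ _ IM] _; apply: IM; apply: Ix.
Qed.

Definition in_ideal_gen X (x : R) : bool := `[< ideal_gen X x >].

Lemma in_ideal_genP X x : reflect (ideal_gen X x) (x \in in_ideal_gen X).
Proof. exact: asboolP. Qed.

Lemma in_ideal_gen_closed X : zmod_closed (in_ideal_gen X).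
Proof.
have [I0 ID IM] := ideal_gen_ideal X.
split=> [|x y /in_ideal_genP Ix /in_ideal_genP Iy]; apply/in_ideal_genP => //.
by apply: ID => //; rewrite -mulN1r; apply: IM.
Qed.

HB.instance Definition _ X :=
  GRing.isZmodClosed.Build R (in_ideal_gen X) (in_ideal_gen_closed X).

Definition ideal_closed X : zmodClosed R :=
  GRing.ZmodClosed.clone R (in_ideal_gen X) _.

End Ideals.

(* The library's ring structure on [Quotient.quot] requires a proper ideal;
   [ring_quot X] is R/(X) without that restriction. *)
Definition ring_quot (R : comPzRingType) (X : set R) : Type :=
  Quotient.quot (ideal_closed X).

Section RingQuot.
Variables (R : comPzRingType) (X : set R).
Local Notation Q := (ring_quot X).

HB.instance Definition _ := GRing.Zmodule.on Q.

Definition quot_map (x : R) : Q := \pi_(Quotient.quot (ideal_closed X)) x.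

Lemma quot_map_eq x y : quot_map x = quot_map y <-> ideal_gen X (x - y).
Proof.
split=> [/eqP|Ixy]; first by rewrite -Quotient.idealrBE => /in_ideal_genP.
by apply/eqP; rewrite -Quotient.idealrBE; apply/in_ideal_genP.
Qed.

Lemma quot_map_surj (u : Q) : exists x, quot_map x = u.
Proof. by exists (repr u); rewrite /quot_map reprK. Qed.

Fact quot_map_zmod_morphism : zmod_morphism quot_map.
Proof. exact: pi_is_zmod_morphism. Qed.

HB.instance Definition _ :=
  GRing.isZmodMorphism.Build R Q quot_map quot_map_zmod_morphism.

Definition quot_one : Q := quot_map 1.
Definition quot_mul (u v : Q) : Q :=
  quot_map (repr (u : Quotient.quot (ideal_closed X)) *
            repr (v : Quotient.quot (ideal_closed X))).

Lemma quot_map_mul x y : quot_map (x * y) = quot_mul (quot_map x) (quot_map y).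
Proof.
have rep z : ideal_gen X (z - repr (quot_map z)).
  by apply/quot_map_eq; rewrite /quot_map reprK.
have [_ ID IM] := ideal_gen_ideal X.
apply/quot_map_eq; set x' := repr _; set y' := repr _.
have -> : x * y - x' * y' = y * (x - x') + x' * (y - y').
  by rewrite !mulrBr [y * x]mulrC [y * x']mulrC addrA subrK.
by apply: ID; apply: IM; apply: rep.
Qed.

Fact quot_mulA : associative quot_mul.
Proof.
move=> u v w; have [[x <-] [y <-] [z <-]] :=
  And3 (quot_map_surj u) (quot_map_surj v) (quot_map_surj w).
by rewrite -!quot_map_mul mulrA.
Qed.

Fact quot_mulC : commutative quot_mul.
Proof.
move=> u v; have [[x <-] [y <-]] := conj (quot_map_surj u) (quot_map_surj v).
by rewrite -!quot_map_mul mulrC.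
Qed.

Fact quot_mul1 : left_id quot_one quot_mul.
Proof.
by move=> u; have [x <-] := quot_map_surj u; rewrite -quot_map_mul mul1r.
Qed.

Fact quot_mulDl : left_distributive quot_mul +%R.
Proof.
move=> u v w; have [[x <-] [y <-] [z <-]] :=
  And3 (quot_map_surj u) (quot_map_surj v) (quot_map_surj w).
by rewrite -raddfD -!quot_map_mul mulrDl raddfD.
Qed.

HB.instance Definition _ := GRing.Zmodule_isComPzRing.Build Q
  quot_mulA quot_mulC quot_mul1 quot_mulDl.

Fact quot_map_monoid_morphism : monoid_morphism quot_map.
Proof. by split=> // x y; rewrite quot_map_mul. Qed.

HB.instance Definition _ :=
  GRing.isMonoidMorphism.Build R Q quot_map quot_map_monoid_morphism.

End RingQuot.

Section TightClosure.
Variables (p : nat) (R : comPzRingType).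
Implicit Types (I : set R).

(* R° *)
Definition off_minimal_primes : set R :=
  ~` \bigcup_(P in [set P | is_minimal_prime P]) P.

(* I^[q] is independent, in characteristic p and for q a power of p, of the
   generators chosen for I. *)
Definition frobenius_power I (q : nat) : set R :=
  [set y | exists2 xs : seq R, I = ideal_gen [set` xs]
                             & ideal_gen [set` [seq x ^+ q | x <- xs]] y].

Definition tight_closure I : set R :=
  [set x | exists2 c, off_minimal_primes c &
    exists e0, forall e, (e0 <= e)%N ->
      frobenius_power I (p ^ e) (c * x ^+ (p ^ e))].

Definition tightly_closed I : Prop := I = tight_closure I.

Definition weakly_F_regular : Prop :=
  forall I, is_ideal I -> tightly_closed I.

End TightClosure.

Definition multiplicative_set (R : comPzRingType) (W : set R) : Prop :=
  W 1 /\ forall x y, W x -> W y -> W (x * y).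

(* f exhibits S as the localization W^-1 R. *)
Definition is_localization (R S : comPzRingType) (W : set R)
    (f : {rmorphism R -> S}) : Prop :=
  [/\ forall w, W w -> exists v, f w * v = 1,
      forall s, exists r w, W w /\ s * f w = f r
    & forall r, f r = 0 -> exists2 w, W w & w * r = 0].

Definition F_regular (p : nat) (R : comPzRingType) : Prop :=
  forall (W : set R) (S : comPzRingType) (f : {rmorphism R -> S}),
    multiplicative_set W -> is_localization W f -> weakly_F_regular p S.

Section Tensor.
Variable R : comPzRingType.

Section TensorProduct.
Variables N M : lmodType R.

Definition pure_sym (x : N) (y : M) : {freeg (N * M)%type / int} := << (x, y) >>.

Definition tensor_relations : set {freeg (N * M)%type / int} :=
  [set u | [\/ exists x x' y,
                 u = pure_sym (x + x') y - pure_sym x y - pure_sym x' y,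
               exists x y y',
                 u = pure_sym x (y + y') - pure_sym x y - pure_sym x y'
             | exists a x y, u = pure_sym (a *: x) y - pure_sym x (a *: y)]].

Definition tensor : Type := Quotient.quot (subgroup_closed tensor_relations).

HB.instance Definition _ := GRing.Zmodule.on tensor.

Definition tensor_class (u : {freeg (N * M)%type / int}) : tensor :=
  \pi_(Quotient.quot (subgroup_closed tensor_relations)) u.

Definition tens (x : N) (y : M) : tensor := tensor_class (pure_sym x y).

End TensorProduct.

Section TensorTheory.
Variables N M : lmodType R.

Lemma tensor_class_zmod_morphism : zmod_morphism (@tensor_class N M).
Proof. exact: pi_is_zmod_morphism. Qed.

HB.instance Definition _ := GRing.isZmodMorphism.Build
  {freeg (N * M)%type / int} (tensor N M) (@tensor_class N M)
  tensor_class_zmod_morphism.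

Lemma tensor_class_repr (u : Quotient.quot (subgroup_closed (@tensor_relations N M))) :
  tensor_class (repr u) = u.
Proof. by rewrite /tensor_class reprK. Qed.

Lemma tensor_class_eq0 (u : {freeg (N * M)%type / int}) :
  tensor_class u = 0 <-> subgroup_gen (@tensor_relations N M) u.
Proof.
rewrite -(raddf0 (@tensor_class N M)) -[u in subgroup_gen _ u]subr0.
split=> [/eqP|ru]; first by rewrite -Quotient.idealrBE => /asboolP.
by apply/eqP; rewrite -Quotient.idealrBE; apply/asboolP.
Qed.

Let tensB (u v w : {freeg (N * M)%type / int}) :
  tensor_relations (u - v - w) ->
  tensor_class u = tensor_class v + tensor_class w.
Proof.
move=> rel; apply/eqP; rewrite -subr_eq0 opprD addrA -!raddfB; apply/eqP.
by apply/tensor_class_eq0 => G [_]; apply.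
Qed.

Lemma tensDl (x x' : N) (y : M) : tens (x + x') y = tens x y + tens x' y.
Proof. by apply: tensB; apply: Or31; exists x, x', y. Qed.

Lemma tensDr (x : N) (y y' : M) : tens x (y + y') = tens x y + tens x y'.
Proof. by apply: tensB; apply: Or32; exists x, y, y'. Qed.

Lemma tensZ (a : R) (x : N) (y : M) : tens (a *: x) y = tens x (a *: y).
Proof.
apply/eqP; rewrite -subr_eq0 -raddfB; apply/eqP/tensor_class_eq0 => G [_]; apply.
by apply: Or33; exists a, x, y.
Qed.

End TensorTheory.

Section TensorMap.
Variables (N N' M : lmodType R) (phi : {linear N -> N'}).

Definition free_tensorl (u : {freeg (N * M)%type / int}) : tensor N' M :=
  fglift (fun xy : N * M => tens (phi xy.1) xy.2 : zmodule (tensor N' M)) u.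

(* phi (x) id_M : N (x) M -> N' (x) M *)
Definition tensorl (u : tensor N M) : tensor N' M :=
  free_tensorl (repr (u : Quotient.quot (subgroup_closed (@tensor_relations N M)))).

Lemma free_tensorl_zmod_morphism : zmod_morphism free_tensorl.
Proof.
exact: (@lift_is_additive int _ (zmodule (tensor N' M))
          (fun xy : N * M => tens (phi xy.1) xy.2)).
Qed.

HB.instance Definition _ := GRing.isZmodMorphism.Build
  {freeg (N * M)%type / int} (tensor N' M) free_tensorl
  free_tensorl_zmod_morphism.

Lemma free_tensorl_pure x y : free_tensorl (pure_sym x y) = tens (phi x) y.
Proof. by rewrite /free_tensorl liftU scale1r. Qed.

Lemma tensorl_class u : tensorl (tensor_class u) = free_tensorl u.
Proof.
apply/eqP; rewrite -subr_eq0 -raddfB; apply/eqP.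
set v := _ - _; have: subgroup_gen (@tensor_relations N M) v.
  by apply/tensor_class_eq0; rewrite raddfB /= tensor_class_repr subrr.
move=> rel_v; apply: (rel_v [set w | free_tensorl w = 0]); split.
  by split=> [|w w' /= w0 w'0]; rewrite /= ?raddf0 // raddfB /= w0 w'0 subr0.
move=> w [] => [[x [x' [y ->]]]|[x [y [y' ->]]]|[a [x [y ->]]]] /=.
- by rewrite !raddfB /= !free_tensorl_pure raddfD tensDl -addrA -opprD subrr.
- by rewrite !raddfB /= !free_tensorl_pure tensDr -addrA -opprD subrr.
- by rewrite raddfB /= !free_tensorl_pure linearZ tensZ subrr.
Qed.

Lemma tensorl_tens x y : tensorl (tens x y) = tens (phi x) y.
Proof. by rewrite tensorl_class free_tensorl_pure. Qed.

Lemma tensorl_zmod_morphism : zmod_morphism tensorl.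
Proof.
move=> u v; rewrite -[u]tensor_class_repr -[v]tensor_class_repr.
by rewrite -raddfB /= !tensorl_class raddfB.
Qed.

End TensorMap.
End Tensor.

Definition restrict_scalars (R S : comPzRingType) (f : {rmorphism R -> S}) : Type :=
  S.

Section RestrictScalars.
Variables (R S : comPzRingType) (f : {rmorphism R -> S}).

Local Notation fS := (restrict_scalars f).

HB.instance Definition _ := GRing.Zmodule.on fS.

Definition restrict_scale (a : R) (s : fS) : fS :=
  f a * (s : S).

Fact restrict_scaleA a b s :
  restrict_scale a (restrict_scale b s) = restrict_scale (a * b) s.
Proof. by rewrite /restrict_scale rmorphM mulrA. Qed.
Fact restrict_scale1 : left_id 1 restrict_scale.
Proof. by move=> s; rewrite /restrict_scale rmorph1 mul1r. Qed.
Fact restrict_scaleDr : right_distributive restrict_scale +%R.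
Proof. by move=> a s t; apply: mulrDr. Qed.
Fact restrict_scaleDl s : {morph restrict_scale^~ s : a b / a + b}.
Proof. by move=> a b; rewrite /restrict_scale rmorphD mulrDl. Qed.

HB.instance Definition _ := GRing.Zmodule_isLmodule.Build R fS
  restrict_scaleA restrict_scale1 restrict_scaleDr restrict_scaleDl.

Definition restrict_hom (r : R^o) : fS := f r.

Fact restrict_hom_zmod_morphism : zmod_morphism restrict_hom.
Proof. exact: rmorphB. Qed.
Fact restrict_hom_scalable : scalable restrict_hom.
Proof. by move=> a r; apply: rmorphM. Qed.

HB.instance Definition _ := GRing.isZmodMorphism.Build R^o fS
  restrict_hom restrict_hom_zmod_morphism.
HB.instance Definition _ := GRing.isScalable.Build R R^o fS *:%R
  restrict_hom restrict_hom_scalable.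

Definition pure_hom : Prop :=
  forall M : lmodType R, injective (@tensorl R _ _ M restrict_hom).

End RestrictScalars.

(* The library's [pchar R] and [pFrobenius_aut] are restricted to nontrivial
   rings. *)
Definition has_pchar (p : nat) (R : comPzRingType) : Prop :=
  prime p /\ p%:R = 0 :> R.

Section Frobenius.
Variables (p : nat) (R : comPzRingType) (charRp : has_pchar p R).

Definition frobenius of has_pchar p R := fun x : R => x ^+ p.
Local Notation F := (frobenius charRp).

Lemma frobeniusD x y : F (x + y) = F x + F y.
Proof.
have [p_pr p0] := charRp.
have binp0 i : (0 < i < p)%N -> 'C(p, i)%:R = 0 :> R.
  by move/(prime_dvd_bin p_pr)/dvdnP => [k ->]; rewrite natrM p0 mulr0.
have defp := prednK (prime_gt0 p_pr).
rewrite /frobenius exprDn big_ord_recr subnn -defp big_ord_recl /= defp.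
rewrite subn0 mulr1 mul1r bin0 binn big1 ?addr0 // => i _.
by rewrite -mulr_natl binp0 ?mul0r //= -{2}defp ltnS (valP i).
Qed.

Fact frobenius_zmod_morphism : zmod_morphism F.
Proof.
move=> x y; apply/eqP; rewrite eq_sym subr_eq -frobeniusD subrK.
exact: eqxx.
Qed.
Fact frobenius_monoid_morphism : monoid_morphism F.
Proof. by split=> [|x y]; rewrite /frobenius ?expr1n // exprMn. Qed.

HB.instance Definition _ :=
  GRing.isZmodMorphism.Build R R F frobenius_zmod_morphism.
HB.instance Definition _ :=
  GRing.isMonoidMorphism.Build R R F frobenius_monoid_morphism.

End Frobenius.

Definition F_pure (p : nat) (R : comPzRingType) : Prop :=
  forall charRp : has_pchar p R, pure_hom (frobenius charRp).

Section Grading.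
Variables (K : fieldType) (R : comPzRingType) (iota : {rmorphism K -> R}).
Variable gr : nat -> set R.

Definition homogeneous (x : R) : Prop := exists i, gr i x.

(* R = (+)_i R_i, where R_0 is the image of K and R is finitely generated as a
   K-algebra. *)
Definition N_graded : Prop :=
  [/\ forall i, is_subgroup (gr i),
      forall i j x y, gr i x -> gr j y -> gr (i + j)%N (x * y),
      (forall x, exists n (y : nat -> R),
         (forall i, gr i (y i)) /\ x = \sum_(i < n) y i) /\
      (forall n (y : nat -> R), (forall i, gr i (y i)) ->
         \sum_(i < n) y i = 0 -> forall i, (i < n)%N -> y i = 0),
      injective iota /\ gr 0 = range iota
    & exists xs : seq R, subring_gen (range iota `|` [set` xs]) = setT].

Definition irrelevant_ideal : set R :=
  [set x | exists n (y : nat -> R),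
     (forall i, gr i.+1 (y i)) /\ x = \sum_(i < n) y i].

End Grading.

Section Minors.
Variables (R : comPzRingType) (a b : nat) (M : 'M[R]_(a, b)).

Definition minors (k : nat) : set R :=
  [set x | exists (f : 'I_k -> 'I_a) (g : 'I_k -> 'I_b),
     [/\ {homo f : i j / (i < j)%N}, {homo g : i j / (i < j)%N}
       & x = \det (mxsub f g M)]].

End Minors.

Section WeightedGrading.
Variables (K : fieldType) (n : nat) (w : 'I_n -> nat).

Definition weighted_homog (d : nat) : set {mpoly K[n]} :=
  [set f | forall m, m \in msupp f -> (\sum_(i < n) m i * w i)%N = d].

Variable X : set {mpoly K[n]}.

Definition quot_grading (d : nat) : set (ring_quot X) :=
  @quot_map _ X @` weighted_homog d.

Definition quot_scalar (c : K) : ring_quot X := quot_map X c%:MP.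

Fact quot_scalar_zmod_morphism : zmod_morphism quot_scalar.
Proof. by move=> c d; rewrite /quot_scalar !raddfB. Qed.
Fact quot_scalar_monoid_morphism : monoid_morphism quot_scalar.
Proof.
by split=> [|c d]; rewrite /quot_scalar ?mpolyC1 ?rmorph1 // mpolyCM rmorphM.
Qed.

HB.instance Definition _ := GRing.isZmodMorphism.Build K (ring_quot X)
  quot_scalar quot_scalar_zmod_morphism.
HB.instance Definition _ := GRing.isMonoidMorphism.Build K (ring_quot X)
  quot_scalar quot_scalar_monoid_morphism.

End WeightedGrading.

Section DeformationRing.
Variables (K : fieldType) (m n : nat).

Local Notation A := ('X_(inord 0) : {mpoly K[5]}).
Local Notation B := ('X_(inord 1) : {mpoly K[5]}).
Local Notation C := ('X_(inord 2) : {mpoly K[5]}).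
Local Notation D := ('X_(inord 3) : {mpoly K[5]}).
Local Notation T := ('X_(inord 4) : {mpoly K[5]}).

Definition deformation_matrix : 'M[{mpoly K[5]}]_(2, 3) :=
  \matrix_(i < 2, j < 3)
    nth 0 (nth [::] [:: [:: A ^+ 2 + T ^+ m; B;      D         ];
                        [:: C;               A ^+ 2; B ^+ n - D]] i) j.

Definition deformation_ring : comPzRingType :=
  ring_quot (minors deformation_matrix 2).

Definition deformation_t : deformation_ring :=
  quot_map (minors deformation_matrix 2) T.

Definition deformation_weight (i : 'I_5) : nat :=
  nth 0%N [:: m; 2 * m; 2 * m; 2 * m * n; 2]%N i.

Definition deformation_grading : nat -> set deformation_ring :=
  @quot_grading K 5 deformation_weight (minors deformation_matrix 2).

Definition deformation_scalar : {rmorphism K -> deformation_ring} :=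
  @quot_scalar K 5 (minors deformation_matrix 2).

End DeformationRing.

(* Main.v *)
Require Import Defs.
From HB Require Import structures.
From mathcomp Require Import all_boot all_order all_algebra.
From mathcomp Require Import ring zify.
From mathcomp Require Import boolp classical_sets.
From mathcomp Require Import freeg mpoly.
Set Implicit Arguments.
Unset Strict Implicit.
Unset Printing Implicit Defensive.
Import GRing.Theory.
Local Open Scope classical_set_scope.
Local Open Scope ring_scope.

(** Write [al = a^2], [ta = t^m] and [g = b^n - d]; the relations of the ring
    [R] are [(al + ta) * al = b * c], [(al + ta) * g = d * c] and
    [b * g = al * d].

    R is graded and [t] is a nonzerodivisor.  Modulo [a] and [t] every monomial
    in [b], [c], [d] is zero or a power of one of them ([gr_reduce]), so [R] is
    spanned over [K[a,t]] by the powers of [b], [c] and [d].  An explicit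
    parametrization [affine_param] by polynomials in [u] and [t1] is injective
    on each homogeneous component: the powers of [b], [c] and [d] are separated
    by the places where [a] vanishes ([affine_param0_independent]), and if an
    element vanishes at [t1 = 0] then it is divisible by [t]
    ([affine_param0_ker]), so that one can induct on the degree
    ([affine_param_inj]).  The target being a domain, [t] is a nonzerodivisor.
    The spanning set bounds the Krull dimension by 3, because in a chain of
    primes elements [x i] of [P i.+1] outside [P i] have linearly independent
    monomials ([krull_dim_le]); specializing the parametrization one variable
    at a time gives a chain of length 3.

    R/tR is F-regular.  In terms of [x = b/a^2] it is the ring of sections of
    the multiples of the rational divisor [1/2 (0) + 1/2 (oo) + 1/(2n) (-1)] on
    the projective line.  The double cover [x = -w^2] makes the divisor integral
    at 0 and oo, so the covering ring is the semigroup ring of a plane cone, and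
    this is the weight zero part of a grading on a polynomial ring [K[u,v]].
    Hence [R/tR] is identified with the elements of [K[u,v]] supported on a
    lattice and fixed by a twisted exchange of [u] and [v] ([fibre_param],
    [symmetrized_image]).  As 2 is invertible, averaging over the exchange makes
    it a direct summand of [K[u,v]] ([reynolds]).  Strong F-regularity, in a
    form that does not ask the Frobenius map of [K] to be finite, holds for
    fields ([strongly_F_regular_field]), passes to polynomial rings
    ([strongly_F_regular_poly]) and to direct summands
    ([strongly_F_regular_summand]), and implies that all localizations are
    weakly F-regular ([strongly_F_regular_F_regular]); Hilbert's basis theorem
    provides the generators that the definition of tight closure calls for.

    R is neither F-regular nor F-pure.  The element [z = b^n * t^(m-1)] is not
    in the ideal [(a, d)] ([critical_notin]), but [z^q] is in [(a^q, d^q)] for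
    all large powers [q] of [p] ([critical_frobenius]).  Indeed
    [b^(n*q) = g^q + d^q], and [t^((m-1)*q)] is a multiple of [ta^M] with
    [M] about [(m-1)*q/m], so it suffices to see that [ta^M * g^q] is in
    [(al^h, d^q)] for [h] about [q/2].  A power [(al + ta)^j * g^j] equals
    [c^j * d^j], while [(g + d)^r * g^s] is [b^(n*r) * g^s] and yields powers of
    [al]; these two facts trade [ta] and [g] for [al] and [d]
    ([frobenius_membership]), and there is enough room when
    [n * (M + 1 - h) >= h], which for large [q] follows from
    [m - m/n > 2] ([exponent_bounds]).  So [z] is in the tight closure of
    [(a, d)], and purity of the Frobenius map would force [z] into [(a, d)]
    ([F_pure_contracted_pe]). *)

(** * Ideals and quotients *)

Section IdealLemmas.
Variable R : comPzRingType.
Implicit Types (I : set R) (X : set R).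

Lemma sub_ideal_gen X x : X x -> ideal_gen X x.
Proof. by move=> Xx I [_]; apply. Qed.

Lemma ideal_gen_sub X I : is_ideal I -> X `<=` I -> ideal_gen X `<=` I.
Proof. by move=> idI XI x; apply; split. Qed.

Lemma ideal_sum I (J : Type) (r : seq J) (P : pred J) (F : J -> R) :
  is_ideal I -> (forall j, P j -> I (F j)) -> I (\sum_(j <- r | P j) F j).
Proof. by case=> I0 ID _ IF; apply: big_ind. Qed.

Lemma idealB I x y : is_ideal I -> I x -> I y -> I (x - y).
Proof. by case=> _ ID IM Ix Iy; apply: ID; rewrite // -mulN1r; apply: IM. Qed.

Lemma is_ideal_preim (S : comPzRingType) (f : {rmorphism R -> S}) (J : set S) :
  is_ideal J -> is_ideal (f @^-1` J).
Proof.
case=> J0 JD JM; split; rewrite /preimage /=.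
- by rewrite rmorph0.
- by move=> x y; rewrite rmorphD; apply: JD.
- by move=> a x; rewrite rmorphM; apply: JM.
Qed.

Lemma is_prime_ker (S : idomainType) (f : {rmorphism R -> S}) :
  is_prime [set x | f x = 0].
Proof.
split=> /=; last by move=> x y; rewrite rmorphM => /eqP; rewrite mulf_eq0;
  case/orP => /eqP; [left | right].
  split=> /=; first exact: rmorph0.
    by move=> x y fx fy; rewrite rmorphD fx fy addr0.
  by move=> a x fx; rewrite rmorphM fx mulr0.
by rewrite rmorph1 => /eqP; rewrite oner_eq0.
Qed.

Lemma ideal_gen_seqP (xs : seq R) x :
  ideal_gen [set` xs] x <->
  exists h : nat -> R, x = \sum_(i < size xs) h i * xs`_i.
Proof.
split=> [|[h ->]]; last first.
  apply: ideal_sum => [|i _]; first exact: ideal_gen_ideal.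
  have [_ _ IM] := ideal_gen_ideal [set` xs].
  by apply: IM; apply: sub_ideal_gen => /=; rewrite mem_nth.
pose J := [set x | exists h : nat -> R, x = \sum_(i < size xs) h i * xs`_i].
suff: ideal_gen [set` xs] `<=` J by apply.
apply: ideal_gen_sub => [|y /= yxs].
  split=> [|y z [h ->] [k ->]|a y [h ->]].
  - by exists (fun=> 0); rewrite big1 // => i _; rewrite mul0r.
  - exists (fun i => h i + k i); rewrite -big_split.
    by apply: eq_bigr => i _; rewrite mulrDl.
  - exists (fun i => a * h i); rewrite mulr_sumr.
    by apply: eq_bigr => i _; rewrite mulrA.
have yi : (index y xs < size xs)%N by rewrite index_mem.
exists (fun i => (i == index y xs)%:R); rewrite (bigD1 (Ordinal yi)) //= eqxx.
rewrite mul1r nth_index // big1 ?addr0 // => i; rewrite -val_eqE /= => /negPf ->.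
by rewrite mul0r.
Qed.

End IdealLemmas.

Section RingQuotLift.
Variables (R S : comPzRingType) (X : set R) (f : {rmorphism R -> S}).

Definition quot_lift of (forall x, X x -> f x = 0) := fun u : ring_quot X =>
  f (repr (u : Quotient.quot (ideal_closed X))).

Hypothesis fX : forall x, X x -> f x = 0.

Lemma ideal_gen_ker x : ideal_gen X x -> f x = 0.
Proof.
apply: (@ideal_gen_sub _ _ [set x | f x = 0]) => //.
split=> /=; first exact: rmorph0.
  by move=> y z fy fz; rewrite rmorphD fy fz addr0.
by move=> a y fy; rewrite rmorphM fy mulr0.
Qed.

Lemma quot_liftE x : quot_lift fX (quot_map X x) = f x.
Proof.
apply/eqP; rewrite -subr_eq0 -rmorphB; apply/eqP; apply: ideal_gen_ker.
by apply/quot_map_eq; rewrite /quot_map reprK.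
Qed.

Fact quot_lift_zmod_morphism : zmod_morphism (quot_lift fX).
Proof.
move=> u v; have [x <-] := quot_map_surj u; have [y <-] := quot_map_surj v.
by rewrite -rmorphB !quot_liftE rmorphB.
Qed.

Fact quot_lift_monoid_morphism : monoid_morphism (quot_lift fX).
Proof.
split=> [|u v]; first by rewrite -(rmorph1 (quot_map X)) quot_liftE rmorph1.
have [x <-] := quot_map_surj u; have [y <-] := quot_map_surj v.
by rewrite -rmorphM !quot_liftE rmorphM.
Qed.

HB.instance Definition _ := GRing.isZmodMorphism.Build (ring_quot X) S
  (quot_lift fX) quot_lift_zmod_morphism.
HB.instance Definition _ := GRing.isMonoidMorphism.Build (ring_quot X) S
  (quot_lift fX) quot_lift_monoid_morphism.

End RingQuotLift.

(** * Noetherian rings *)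

Definition noetherian (R : comPzRingType) : Prop :=
  forall I : set R, is_ideal I -> exists xs : seq R, I = ideal_gen [set` xs].

Lemma noetherian_surj (R S : comPzRingType) (f : {rmorphism R -> S}) :
  (forall y, exists x, f x = y) -> noetherian R -> noetherian S.
Proof.
move=> fsurj noR I idI; have [xs Ixs] := noR _ (is_ideal_preim f idI).
exists [seq f x | x <- xs]; apply/seteqP; split=> y.
  have [x <-] := fsurj y => Ifx; have : ideal_gen [set` xs] x by rewrite -Ixs.
  have idJ := is_ideal_preim f (ideal_gen_ideal [set` [seq f x | x <- xs]]).
  apply: (ideal_gen_sub idJ) => z /= zxs; apply: sub_ideal_gen => /=.
  exact: map_f.
apply: (ideal_gen_sub idI) => _ /= /mapP[x xxs ->].
have : (f @^-1` I) x by rewrite Ixs; apply: sub_ideal_gen.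
by [].
Qed.

Lemma noetherian_field (K : fieldType) : noetherian K.
Proof.
move=> I idI; have [I0 ID IM] := idI.
have [[x Ix x0]|I00] := pselect (exists2 x, I x & x != 0).
  exists [:: x]; apply/seteqP; split=> y.
    move=> _; rewrite -[y](divfK x0); have [_ _] := ideal_gen_ideal [set` [:: x]].
    by apply; apply: sub_ideal_gen; rewrite /= inE.
  by apply: (ideal_gen_sub idI) => z /=; rewrite inE => /eqP ->.
exists [::]; apply/seteqP; split=> y; last by apply: (ideal_gen_sub idI).
move=> Iy; have -> : y = 0.
  by apply/eqP; apply: contrapT => /negP y0; apply: I00; exists y.
by have [] := ideal_gen_ideal [set` ([::] : seq K)].
Qed.

(** Hilbert's basis theorem.  The coefficients of [X^d] in the members of [I]
    of degree at most [d] form an increasing sequence of ideals of [A], which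
    is constant from some [D] on because its union is finitely generated; lifts
    of generators of the first [D + 1] of them generate [I], since they allow
    one to lower the degree of any member of [I]. *)
Lemma noetherian_poly (A : comNzRingType) : noetherian A -> noetherian {poly A}.
Proof.
move=> noA I idI; have [I0 ID IM] := idI.
pose L d := [set y : A | exists f : {poly A}, [/\ I f, (size f <= d.+1)%N & y = f`_d]].
have idL d : is_ideal (L d).
  split=> [|_ _ [f [If sf ->]] [g [Ig sg ->]]|c _ [f [If sf ->]]].
  - by exists 0; rewrite coef0 size_poly0.
  - exists (f + g); split; rewrite ?coefD //; first exact: ID.
    by rewrite (leq_trans (size_polyD _ _)) // geq_max sf.
  - exists (c%:P * f); split; rewrite ?coefCM //; first exact: IM.
    by rewrite mul_polyC (leq_trans (size_scale_leq _ _)).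
have mulXn k d f : I f -> (size f <= d.+1)%N ->
    [/\ I ('X^k * f), (size ('X^k * f)%R <= (k + d).+1)%N
      & ('X^k * f)`_(k + d) = f`_d].
  move=> If sf; split; rewrite ?coefXnM; first exact: IM.
    by apply/leq_sizeP => j kj; rewrite coefXnM; case: ltnP => // _;
      apply: (leq_sizeP _ _ sf); lia.
  by rewrite ltnNge leq_addr /= addKn.
have Lmono d e : (d <= e)%N -> L d `<=` L e.
  move=> de _ [f [If sf ->]]; have [? ? ?] := mulXn (e - d)%N _ _ If sf.
  by exists ('X^(e - d) * f); split=> //; rewrite -{2}(subnK de).
have [D LD] : exists D, forall d, L d `<=` L D.
  pose Lu := [set y : A | exists d, L d y].
  have idLu : is_ideal Lu.
    split=> [|x y [d Lx] [e Ly]|c x [d Lx]].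
    - by exists 0%N; have [] := idL 0%N.
    - exists (maxn d e); have [_ LDe _] := idL (maxn d e).
      by apply: LDe; [apply: Lmono Lx | apply: Lmono Ly];
        rewrite ?leq_maxl ?leq_maxr.
    - by exists d; have [_ _ LM] := idL d; apply: LM.
  have [ys Luys] := noA _ idLu.
  have ysLu y : y \in ys -> Lu y.
    by move=> yys; rewrite Luys; apply: sub_ideal_gen.
  have [D ysD] : exists D, forall y, y \in ys -> L D y.
    elim: ys {Luys} ysLu => [|y ys IHys] ysLu; first by exists 0%N.
    have [|D ysD] := IHys; first by move=> z zys; apply: ysLu; rewrite inE zys orbT.
    have [e Le] := ysLu y (mem_head _ _).
    exists (maxn D e) => z; rewrite inE => /predU1P[->|/ysD Lz];
      by [apply: Lmono Le; rewrite leq_maxr | apply: Lmono Lz; rewrite leq_maxl].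
  exists D => d y Ly; have : Lu y by exists d.
  by rewrite Luys; apply: ideal_gen_sub.
have genL d : exists G : seq {poly A},
    (forall g, g \in G -> I g /\ (size g <= d.+1)%N) /\
    L d `<=` ideal_gen [set` [seq (g : {poly A})`_d | g <- G]].
  have [ys Lys] := noA _ (idL d); rewrite Lys.
  have : forall y, y \in ys -> L d y.
    by move=> y yys; rewrite Lys; apply: sub_ideal_gen.
  move=> ysL; suff [G [GI ->]] : exists G : seq {poly A},
      (forall g, g \in G -> I g /\ (size g <= d.+1)%N) /\ ys = [seq (g : {poly A})`_d | g <- G].
    by exists G; split=> // z.
  elim: ys {Lys} ysL => [|y ys IHys] ysL; first by exists [::].
  have [|G [GI ->]] := IHys; first by move=> z zys; apply: ysL; rewrite inE zys orbT.
  have [g [Ig sg ->]] := ysL y (mem_head _ _); exists (g :: G); split=> // h.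
  by rewrite inE => /predU1P[->|/GI].
have [G GP] := choice genL.
pose xs := flatten [seq G d | d <- iota 0 D.+1].
have GJ d g : (d <= D)%N -> g \in G d -> ideal_gen [set` xs] g.
  move=> dD gG; apply: sub_ideal_gen; apply/flattenP; exists (G d) => //.
  by apply: map_f; rewrite mem_iota.
have idJ := ideal_gen_ideal [set` xs]; have [J0 JD JM] := idJ.
exists xs; apply/seteqP; split=> f; last first.
  apply: (ideal_gen_sub idI) => g /flattenP[_ /mapP[d _ ->]].
  by have [GI _] := GP d => /GI[].
have [k] := ubnP (size f); elim: k f => // k IHk f; rewrite ltnS leq_eqVlt.
case/predU1P => [sf|]; last exact: IHk.
case: k IHk sf => [|d] IHk sf; first by move/eqP: sf; rewrite size_poly_eq0 => /eqP ->.
move=> If; pose e := minn d D.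
have [GI GL] := GP e.
have /GL/ideal_gen_seqP[h fd] : L e f`_d.
  rewrite /e /minn; case: ltnP => _; first by exists f; rewrite sf.
  by apply: (LD d); exists f; rewrite sf.
pose r := \sum_(i < size (G e)) (h i)%:P * ('X^(d - e) * (G e)`_i).
have ed : (d - e + e = d)%N by rewrite subnK // geq_minl.
have Gi (i : 'I_(size (G e))) := mem_nth 0 (ltn_ord i).
have Jr : ideal_gen [set` xs] r.
  by apply: ideal_sum => // i _; apply: (JM); apply: (JM); apply: GJ (Gi i); rewrite geq_minr.
have Ir : I r.
  by apply: ideal_sum => // i _; apply: (IM); apply: (IM); case: (GI _ (Gi i)).
rewrite -[f](subrK r); apply: JD => //; apply: IHk; last exact: idealB.
rewrite ltnS; apply/leq_sizeP => j; rewrite leq_eqVlt coefB coef_sum.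
case/predU1P => [<-|dj].
  rewrite fd size_map; apply/eqP; rewrite subr_eq0; apply/eqP.
  apply: eq_bigr => i _; have [Ig sg] := GI _ (Gi i).
  by have [_ _] := mulXn (d - e)%N _ _ Ig sg; rewrite ed coefCM (nth_map 0) // => ->.
have -> : f`_j = 0 by apply/leq_sizeP: dj; rewrite sf.
rewrite big1 ?subr0 // => i _; have [Ig sg] := GI _ (Gi i).
have [_ sXg _] := mulXn (d - e)%N _ _ Ig sg.
by rewrite coefCM; move/leq_sizeP: sXg => ->; rewrite ?mulr0 // ed.
Qed.

(** Adjoining one generator replaces a Noetherian source [A] of a ring map by
    [{poly A}]. *)
Lemma noetherian_cover (K : fieldType) (R : comNzRingType)
    (iota : {rmorphism K -> R}) (xs : seq R) :
  exists (A : comNzRingType) (f : {rmorphism A -> R}),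
    noetherian A /\ (range iota `|` [set` xs]) `<=` range f.
Proof.
elim: xs => [|x xs [A [f [noA xsf]]]].
  exists K, iota; split; first exact: noetherian_field.
  by move=> y [].
have cfx : commr_rmorph f x by move=> y; apply: mulrC.
exists {poly A}, (horner_morph cfx : {rmorphism {poly A} -> R}).
split; first exact: noetherian_poly.
have ff y : range f y -> range (horner_morph cfx) y.
  by case=> z _ <-; exists z%:P; rewrite //= horner_morphC.
move=> y [iy|/=]; first by apply/ff/xsf; left.
rewrite inE => /predU1P[->|yxs]; first by exists 'X; rewrite //= horner_morphX.
by apply/ff/xsf; right.
Qed.

Lemma is_subring_range (R S : comPzRingType) (f : {rmorphism R -> S}) :
  is_subring (range f).
Proof.
split=> [|_ _ [x _ <-] [y _ <-]|_ _ [x _ <-] [y _ <-]].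
- by exists 1; rewrite ?rmorph1.
- by exists (x - y); rewrite ?rmorphB.
- by exists (x * y); rewrite ?rmorphM.
Qed.

Lemma noetherian_fg (K : fieldType) (R : comNzRingType)
    (iota : {rmorphism K -> R}) (xs : seq R) :
  subring_gen (range iota `|` [set` xs]) = setT -> noetherian R.
Proof.
move=> genR; have [A [f [noA xsf]]] := noetherian_cover iota xs.
apply: noetherian_surj noA => y.
have : subring_gen (range iota `|` [set` xs]) y by rewrite genR.
by case/(_ (range f)) => [|x _ <-]; [split; first exact: is_subring_range|exists x].
Qed.

(** * Strong F-regularity *)

(** [psi] is an [R]-linear map from [F^e_* R] to [R].  It is asked for all large
    [e], rather than for one, in order to get past the bound from which on the
    membership in the definition of tight closure holds. *)
Definition strongly_F_regular (p : nat) (R : comPzRingType) : Prop :=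
  forall c : R, c <> 0 -> exists e0, forall e, (e0 <= e)%N ->
    exists psi : R -> R,
      [/\ {morph psi : x y / x - y}, forall s y, psi (s ^+ (p ^ e) * y) = s * psi y
        & psi c = 1].

Section FrobeniusPowers.
Variables (p : nat) (R : comPzRingType) (charRp : has_pchar p R).

Lemma exprDpe e (x y : R) : (x + y) ^+ (p ^ e) = x ^+ (p ^ e) + y ^+ (p ^ e).
Proof.
elim: e x y => // e IHe x y; rewrite expnS !exprM.
by have := frobeniusD charRp x y; rewrite /frobenius => ->; apply: IHe.
Qed.

Lemma expr_sum_pe e (J : Type) (r : seq J) (F : J -> R) :
  (\sum_(j <- r) F j) ^+ (p ^ e) = \sum_(j <- r) F j ^+ (p ^ e).
Proof.
have p0 : (0 < p ^ e)%N by have [/prime_gt0 p0 _] := charRp; rewrite expn_gt0 p0.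
by elim/big_rec2: _ => [|j _ x _ <-]; rewrite ?exprDpe // expr0n gtn_eqF.
Qed.

End FrobeniusPowers.

Lemma morphB_sum (R S : zmodType) (psi : R -> S) (J : Type) (r : seq J) (F : J -> R) :
  {morph psi : x y / x - y} ->
  psi (\sum_(j <- r) F j) = \sum_(j <- r) psi (F j).
Proof.
move=> psiB; have psi0 : psi 0 = 0 by rewrite -{1}(subrr 0) psiB subrr.
have psiN x : psi (- x) = - psi x by rewrite -[in LHS](sub0r x) psiB psi0 sub0r.
elim/big_rec2: _ => // j x y _ <-.
by rewrite -{1}(opprK y) psiB psiN opprK.
Qed.

Lemma tight_closure_incl (p : nat) (R : comPzRingType) (I : set R) :
  has_pchar p R -> noetherian R -> is_ideal I -> I `<=` tight_closure p I.
Proof.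
move=> charRp noR idI x; have [xs Ixs] := noR _ idI; rewrite Ixs.
move=> /ideal_gen_seqP[h ->]; exists 1.
  by case=> P [[_ P1 _] _]; apply: P1.
exists 0%N => e _; exists xs; rewrite // mul1r (expr_sum_pe charRp).
apply: ideal_sum => [|i _]; first exact: ideal_gen_ideal.
rewrite exprMn; have [_ _ IM] := ideal_gen_ideal [set` [seq x ^+ (p ^ e) | x <- xs]].
by apply: IM; apply: sub_ideal_gen => /=; apply: map_f; rewrite mem_nth.
Qed.

Lemma zero_minimal_prime (R : comPzRingType) :
  (1 : R) <> 0 -> (forall x y : R, x * y = 0 -> x = 0 \/ y = 0) ->
  is_minimal_prime [set (0 : R)].
Proof.
move=> R1 Rdom; split.
  split=> //; split=> //= [x y -> ->|a x ->]; by rewrite ?addr0 ?mulr0.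
move=> Q [[Q0 _ _] _ _] Q0s; apply/seteqP; split=> // x ->; exact: Q0.
Qed.

(** A [p^e]-th root linear map [psi] with [psi c = 1] turns
    [c * x^q \in I^[q]] into [x \in I].  In a localization the denominators
    depend on [q], so a single [q] for which [psi] exists is used, and the
    denominator [w] is made a [q]-th power by multiplying with [w^(q-1)]. *)
Lemma strongly_F_regular_F_regular (p : nat) (R : comPzRingType) :
  has_pchar p R -> (forall x y : R, x * y = 0 -> x = 0 \/ y = 0) ->
  noetherian R -> strongly_F_regular p R -> F_regular p R.
Proof.
move=> charRp Rdom noR sfR W S f [W1 WM] [invW fracW kerf] I idI.
have [p_pr p0] := charRp.
have charSp : has_pchar p S by split=> //; rewrite -(rmorph_nat f) p0 rmorph0.
have divW w x : W w -> I (f w * x) -> I x.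
  move=> Ww; have [v fwv] := invW w Ww; have [_ _ IM] := idI.
  by move/(IM v); rewrite mulrA [v * _]mulrC fwv mul1r.
have noS : noetherian S.
  move=> J idJ; have [xs Jxs] := noR _ (is_ideal_preim f idJ).
  exists [seq f x | x <- xs]; apply/seteqP; split=> y.
    have [r [w [Ww yr]]] := fracW y => Jy.
    have : (f @^-1` J) r.
      by rewrite /preimage /= -yr mulrC; have [_ _ JM] := idJ; apply: JM.
    rewrite Jxs => rxs.
    have idG := ideal_gen_ideal [set` [seq f x | x <- xs]].
    have frG : ideal_gen [set` [seq f x | x <- xs]] (f r).
      apply: (ideal_gen_sub (is_ideal_preim f idG)) rxs => z /= zxs.
      by apply: sub_ideal_gen => /=; apply: map_f.
    have [v fwv] := invW w Ww; have [_ _ GM] := idG.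
    have -> : y = v * f r by rewrite -yr mulrCA [v * _]mulrC fwv mulr1.
    exact: GM.
  apply: (ideal_gen_sub idJ) => _ /= /mapP[x xxs ->].
  have : (f @^-1` J) x by rewrite Jxs; apply: sub_ideal_gen.
  by [].
rewrite /tightly_closed; apply/seteqP; split; first exact: tight_closure_incl.
move=> x [c cS [e1 cxI]].
have [[w0 Ww0 w00]|W0] := pselect (exists2 w, W w & w = 0).
  by apply: (divW _ _ Ww0); rewrite w00 rmorph0 mul0r; case: idI.
have f_inj r : f r = 0 -> r = 0.
  case/kerf => w Ww /Rdom[w00|//]; by case: W0; exists w.
have [c1 [w1 [Ww1 cw1]]] := fracW c.
have c1_neq0 : c1 <> 0.
  move=> c10; apply: cS; exists [set 0] => /=; last first.
    have [v fwv] := invW w1 Ww1.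
    by rewrite -[c]mulr1 -fwv mulrA cw1 c10 rmorph0 mul0r.
  apply: zero_minimal_prime => [S1|y z yz0].
    apply: W0; exists 1 => //; apply: f_inj.
    by rewrite rmorph1.
  have [[y1 [wy [Wwy yw]]] [z1 [wz [Wwz zw]]]] := (fracW y, fracW z).
  have zeroW u u1 w : W w -> u * f w = f u1 -> u1 = 0 -> u = 0.
    move=> Ww uw u10; have [v fwv] := invW w Ww.
    by rewrite -[u]mulr1 -fwv mulrA uw u10 rmorph0 mul0r.
  have : y1 * z1 = 0.
    by apply: f_inj; rewrite rmorphM -yw -zw mulrACA yz0 mul0r.
  by case/Rdom => ?; [left; apply: zeroW yw _ | right; apply: zeroW zw _].
have [x1 [w2 [Ww2 xw2]]] := fracW x.
have [e0 /(_ (maxn e0 e1) (leq_maxl _ _))] := sfR c1 c1_neq0.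
set e := maxn e0 e1; set q := (p ^ e)%N => -[psi [psiB psiM psic]].
have q_gt0 : (0 < q)%N by rewrite expn_gt0 prime_gt0.
have WX w k : W w -> W (w ^+ k).
  by move=> Ww; elim: k => [|k IHk]; rewrite ?expr0 // exprS; apply: WM.
pose J := f @^-1` I; have idJ : is_ideal J := is_ideal_preim f idI.
pose Jq := ideal_gen [set y ^+ q | y in J].
have psiJ z : Jq z -> J (psi z).
  have psi0 : psi 0 = 0 by rewrite -{1}(subrr 0) psiB subrr.
  pose D := [set z : R | forall h, J (psi (h * z))].
  suff: Jq `<=` D by move=> sub /sub /(_ 1); rewrite mul1r.
  apply: ideal_gen_sub => [|_ [y Jy <-] h]; last first.
    by rewrite mulrC psiM mulrC; have [_ _ JM] := idJ; apply: JM.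
  have DB u v : D u -> D v -> D (u - v).
    by move=> Du Dv h; rewrite mulrBr psiB; apply: idealB.
  have D0 : D 0 by move=> h; rewrite mulr0 psi0; case: idJ.
  split=> // [u v Du Dv|a u Du h]; last by rewrite mulrA.
  by rewrite -[v]opprK; apply: (DB) => //; rewrite -sub0r; apply: DB.
pose Z := [set z : S | exists w r, [/\ W w, Jq r & z * f w = f r]].
have idJq : is_ideal Jq := ideal_gen_ideal _.
have [J0q JqD JqM] := idJq.
have idZ : is_ideal Z.
  split.
  - by exists 1, 0; rewrite mul0r rmorph0.
  - move=> y z [w [r [Ww Jr yw]]] [w' [r' [Ww' Jr' zw]]].
    exists (w * w'), (w' * r + w * r'); split; [exact: WM| |].
      by apply: JqD; apply: (JqM).
    by rewrite rmorphD !rmorphM -yw -zw; ring.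
  - move=> a z [w [r [Ww Jr zw]]]; have [b [w' [Ww' aw]]] := fracW a.
    exists (w' * w), (b * r); split; [exact: WM|exact: JqM|].
    by rewrite !rmorphM -aw -zw; ring.
have /cxI[xs Ixs cxq] : (e1 <= e)%N by rewrite leq_maxr.
have {cxq} [w [r [Ww Jr cxr]]] : Z (c * x ^+ q).
  apply: (ideal_gen_sub idZ) cxq => _ /= /mapP[y yxs ->].
  have Iy : I y by rewrite Ixs; apply: sub_ideal_gen.
  have [s [v [Wv yv]]] := fracW y; exists (v ^+ q), (s ^+ q); split.
  - exact: WX.
  - apply: sub_ideal_gen; exists s => //; rewrite /J /preimage /= -yv mulrC.
    by have [_ _ IM] := idI; apply: IM.
  - by rewrite !rmorphXn -exprMn yv.
have {cxr} : f (r * (w1 * w2 ^+ q) - w * (c1 * x1 ^+ q)) = 0.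
  rewrite rmorphB [f (r * _)]rmorphM -cxr !rmorphM !rmorphXn -cw1 -xw2 exprMn.
  by ring.
case/f_inj/eqP; rewrite subr_eq0 => /eqP cxr.
have : Jq (c1 * (w * x1) ^+ q).
  have -> : c1 * (w * x1) ^+ q = w ^+ q.-1 * (w1 * w2 ^+ q) * r.
    rewrite -mulrA [_ * r]mulrC cxr exprMn -{1}(prednK q_gt0) exprS.
    by ring.
  exact: JqM.
move/psiJ; rewrite mulrC psiM psic mulr1 /J /preimage /= rmorphM -xw2.
by move/(divW _ _ Ww); rewrite mulrC; apply: divW.
Qed.

(** [psi] is the coordinate along [c] in a decomposition [K = K^q c + A] of
    [K] as a [K^q]-vector space; Zorn's lemma provides the complement [A] as a
    subspace maximal among those avoiding [c]. *)
Lemma strongly_F_regular_field (p : nat) (K : fieldType) :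
  has_pchar p K -> strongly_F_regular p K.
Proof.
move=> charKp c /eqP c0; exists 0%N => e _; set q := (p ^ e)%N.
have q_gt0 : (0 < q)%N by have [/prime_gt0 p0 _] := charKp; rewrite expn_gt0 p0.
have exprBq (x y : K) : (x - y) ^+ q = x ^+ q - y ^+ q.
  by apply/eqP; rewrite eq_sym subr_eq -(exprDpe charKp) subrK.
pose subsp (W : set K) := (forall x y, W x -> W y -> W (x - y)) /\
  (forall z y, W y -> W (z ^+ q * y)).
have [|A [[[AB AM] Ac] Amax]] := @Zorn_bigcup K [set W | subsp W /\ ~ W c].
  move=> F FF totF; split=> [|[W FW Wc]]; last by have [_] := FF _ FW; apply.
  split=> [x y [W FW Wx] [V FV Vy]|z y [W FW Wy]]; last first.
    by exists W => //; have [[_ WM] _] := FF _ FW; apply: WM.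
  have [[[WB _] _] [[VB _] _]] := (FF _ FW, FF _ FV).
  have [WV|VW] := totF _ _ FW FV.
    by exists V => //; apply: VB => //; apply: WV.
  by exists W => //; apply: WB => //; apply: VW.
have A0 : A 0.
  have [[x Ax]|An] := pselect (exists x, A x); first by rewrite -(subrr x); apply: AB.
  exfalso; apply: (Amax [set 0]).
    by rewrite properEneq; split; [apply/eqP => A0; apply: An; exists 0; rewrite A0|
       move=> x Ax; case: An; exists x].
  split; last by move=> /= /eqP; rewrite (negPf c0).
  by split=> [x y /= -> ->|z y /= ->]; rewrite ?subrr ?mulr0.
have decomp y : exists z, A (y - z ^+ q * c).
  have [Ay|Ay] := pselect (A y); first by exists 0; rewrite expr0n gtn_eqF // mul0r subr0.
  pose B := [set w | exists z a, A a /\ w = a + z ^+ q * y].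
  have subB : subsp B.
    split=> [_ _ [z [a [Aa ->]]] [z' [a' [Aa' ->]]]|w _ [z [a [Aa ->]]]].
      by exists (z - z'), (a - a'); split; [apply: AB | rewrite exprBq; ring].
    by exists (w * z), (w ^+ q * a); split; [apply: AM | rewrite exprMn; ring].
  have [[z [a [Aa cE]]]|Bc] := pselect (B c); last first.
    exfalso; apply: (Amax B) => //; rewrite properEneq; split.
      apply/eqP => AeqB; apply: Ay; rewrite AeqB; exists 1, 0.
      by rewrite expr1n mul1r add0r.
    by move=> x Ax; exists 0, x; rewrite expr0n gtn_eqF // mul0r addr0.
  have z0 : z != 0.
    apply/eqP => z0; apply: Ac; rewrite cE z0 expr0n gtn_eqF // mul0r addr0.
    exact: Aa.
  exists z^-1; have -> : y - z^-1 ^+ q * c = 0 - z^-1 ^+ q * a.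
    by rewrite [in LHS]cE mulrDr mulrA -exprMn mulVf // expr1n mul1r; ring.
  by apply: AB => //; apply: AM.
have uniq z z' y : A (y - z ^+ q * c) -> A (y - z' ^+ q * c) -> z = z'.
  move=> Az Az'; apply/eqP; rewrite -subr_eq0; apply/eqP.
  apply: contrapT => /eqP zz'; apply: Ac.
  have -> : c = (z - z')^-1 ^+ q * ((y - z' ^+ q * c) - (y - z ^+ q * c)).
    have -> : y - z' ^+ q * c - (y - z ^+ q * c) = (z - z') ^+ q * c.
      by rewrite exprBq; ring.
    by rewrite mulrA -exprMn mulVf // expr1n mul1r.
  by apply: AM; apply: AB.
have [psi psiP] := choice decomp; exists psi; split=> [x y|s y|].
- apply: (uniq _ _ _ (psiP _)); rewrite exprBq.
  have -> : x - y - (psi x ^+ q - psi y ^+ q) * c =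
     (x - psi x ^+ q * c) - (y - psi y ^+ q * c) by ring.
  exact: AB.
- apply: (uniq _ _ _ (psiP _)); rewrite exprMn -mulrA -mulrBr; exact: AM.
- by apply: (uniq _ _ _ (psiP _)); rewrite expr1n mul1r subrr.
Qed.

(** From [psi] on [L] adapted to the leading coefficient of [c], one gets a
    map on [{poly L}] adapted to [c] by reading off every [q]-th coefficient
    from the degree of [c] on. *)
Lemma strongly_F_regular_poly (p : nat) (L : idomainType) :
  has_pchar p L -> strongly_F_regular p L -> strongly_F_regular p {poly L}.
Proof.
move=> charLp sfL c /eqP c0; pose i0 := (size c).-1.
have ci0 : c`_i0 <> 0 by apply/eqP; rewrite -lead_coefE lead_coef_eq0.
have [e0 psiL] := sfL _ ci0.
have [p_pr p0] := charLp; have p_gt1 := prime_gt1 p_pr.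
exists (maxn e0 i0) => e; rewrite geq_max => /andP[/psiL[psi [psiB psiM psic]] i0e].
set q := (p ^ e)%N in psiM *.
have i0q : (i0 < q)%N by rewrite (leq_ltn_trans i0e) // ltn_expl.
have q_gt0 : (0 < q)%N by rewrite (leq_ltn_trans _ i0q).
have psi0 : psi 0 = 0 by rewrite -{1}(subrr 0) psiB subrr.
have psiS := morphB_sum _ _ psiB.
pose Psi (f : {poly L}) := \poly_(i < size f) psi f`_(q * i + i0).
have PsiE f i : (Psi f)`_i = psi f`_(q * i + i0).
  rewrite coef_poly; case: ltnP => // fi; rewrite [f`_(_)]nth_default //.
  by rewrite (leq_trans fi) // (leq_trans _ (leq_addr _ _)) // leq_pmull.
have charPp : has_pchar p {poly L}.
  by split=> //; rewrite -polyC_natr p0.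
have coefq (s : {poly L}) i : (s ^+ q)`_i = if (q %| i)%N then s`_(i %/ q) ^+ q else 0.
  rewrite -{1}(coefK s) poly_def (expr_sum_pe charPp) coef_sum.
  have Ei (j : 'I_(size s)) : ((s`_j *: 'X^j) ^+ q)`_i =
      if i == (j * q)%N then s`_j ^+ q else 0.
    rewrite exprZn -exprM coefZ coefXn; case: eqP => _; rewrite ?mulr1 ?mulr0 //.
  under eq_bigr => j _ do rewrite Ei.
  case: ifPn => [/dvdnP[k ->]|Nqi].
    rewrite mulnK //; have [sk|ks] := leqP (size s) k.
      rewrite nth_default // expr0n gtn_eqF // big1 // => j _.
      by rewrite eqn_pmul2r // gtn_eqF // (leq_trans (ltn_ord j)).
    rewrite (bigD1 (Ordinal ks)) //= eqxx big1 ?addr0 // => j.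
    by rewrite -val_eqE /= eqn_pmul2r // eq_sym => /negPf ->.
  by rewrite big1 // => j _; case: eqP => // ij; case/negP: Nqi; rewrite ij dvdn_mull.
exists Psi; split=> [f g|s y|].
- by apply/polyP => i; rewrite coefB !PsiE coefB psiB.
- apply/polyP => i; rewrite PsiE !coefM psiS.
  rewrite (eq_bigr (fun j : 'I_(q * i + i0).+1 => if (q %| j)%N then
     s`_(j %/ q) * psi y`_(q * i + i0 - j) else 0)); last first.
    by move=> j _; rewrite coefq; case: ifP => _; rewrite ?psiM // mul0r psi0.
  rewrite -big_mkcond /=.
  rewrite (reindex_onto (fun k : 'I_i.+1 => inord (q * k) : 'I_(q * i + i0).+1)
     (fun j => inord (j %/ q))) /=; last first.
    move=> j qj; have jE := divnK qj; have jlt := ltn_ord j.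
    have ji : (j %/ q <= i)%N by move: jE jlt; set k := (_ %/ _)%N; nia.
    by apply/val_inj; rewrite /= !inordK // ?ltnS ?[(q * _)%N]mulnC ?jE // -ltnS.
  have inordE (k : 'I_i.+1) : (inord (q * k) : 'I_(q * i + i0).+1) = (q * k)%N :> nat.
    by rewrite inordK // ltnS; have := ltn_ord k; nia.
  apply: eq_big => [k|k _].
    by rewrite inordE dvdn_mulr //= mulKn // inord_val eqxx.
  rewrite inordE mulKn // PsiE; congr (_ * psi y`_ _).
  by have := ltn_ord k; nia.
- apply/polyP => i; rewrite PsiE coefC; case: i => [|i]; first by rewrite muln0.
  rewrite nth_default ?psi0 //.
  have qi : (0 < q * i.+1)%N by rewrite muln_gt0 q_gt0.
  by rewrite (leq_trans (leqSpred _)) // -add1n leq_add2r.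
Qed.

(** A direct summand of a strongly F-regular domain is strongly F-regular:
    compose the maps of the domain with the retraction [rho]. *)
Lemma strongly_F_regular_summand (p : nat) (S P : comPzRingType)
    (f : {rmorphism S -> P}) (rho : P -> S) :
  injective f -> {morph rho : x y / x - y} ->
  (forall s y, rho (f s * y) = s * rho y) -> rho 1 = 1 ->
  strongly_F_regular p P -> strongly_F_regular p S.
Proof.
move=> f_inj rhoB rhoM rho1 sfP c c0; have [|e0 psiP] := sfP (f c).
  by rewrite -(rmorph0 f) => /f_inj.
exists e0 => e /psiP[psi [psiB psiM psic]]; exists (rho \o psi \o f); split.
- by move=> x y /=; rewrite rmorphB psiB rhoB.
- by move=> s y /=; rewrite rmorphM rmorphXn psiM rhoM.
- by rewrite /= psic.
Qed.

(** * Frobenius powers of (a, d) *)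

Section FrobeniusMembership.
Variables (R : comPzRingType) (al ta b c d g : R) (n : nat).
Hypothesis minor13 : (al + ta) * g = c * d.
Hypothesis minor23 : b * g = al * d.
Hypothesis bn : b ^+ n = g + d.
Variables (J : set R) (M h N : nat).
Hypothesis idJ : is_ideal J.
Hypothesis Jal : J (al ^+ h).
Hypothesis Jd : J (d ^+ N).
Hypothesis hM : (h <= M)%N.
Hypothesis hn : (h <= n * (M.+1 - h))%N.

(** The case of interest is [l = s = 0], [j = N].  The induction is downwards on
    [l], the case [l = h] being trivial.  For fixed [l] and [j] all values of
    [s] are equivalent, since two consecutive ones differ by an element covered
    by [l.+1].  If [j <= M - l], then [s = j] gives
    [(al + ta)^j * g^j = c^j * d^j], hence a multiple of [d^N].  Otherwise the
    factor [g^r] of [g^j] is replaced by [(g + d)^r] minus terms with a smaller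
    power of [g]; and [(g + d)^r = b^(n*r)] together with the remaining
    [g^(j-r)] produces [(b * g)^(h-l) = (al * d)^(h-l)], hence [al^h]. *)
Lemma frobenius_membership l j s :
  (l <= h)%N -> (h - l <= j)%N -> (j <= N)%N -> (s <= M - l)%N ->
  J (al ^+ l * ta ^+ (M - l - s) * (al + ta) ^+ s * (g ^+ j * d ^+ (N - j))).
Proof.
have [J0 JD JM] := idJ.
have JMr x y : J x -> J (x * y) by rewrite mulrC; apply: JM.
move=> lh; have [k ->] : exists k, l = (h - k)%N by exists (h - l)%N; rewrite subKn.
elim: k {l lh} j s => [|k IHk] j s; first by rewrite subn0 => *; rewrite -!mulrA; apply: JMr.
have [kh|hk] := ltnP k h; last first.
  have -> : (h - k.+1 = h - k)%N by lia.
  exact: IHk.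
set l := (h - k.+1)%N; have lE : (h - k = l.+1)%N by lia.
rewrite lE in IHk.
pose E j s := al ^+ l * ta ^+ (M - l - s) * (al + ta) ^+ s * (g ^+ j * d ^+ (N - j)).
have shift j' s' s'' : (h - l <= j')%N -> (j' <= N)%N -> (s' <= M - l)%N ->
    (s'' <= M - l)%N -> J (E j' s') -> J (E j' s'').
  move=> hj jN; suff {s' s''} E0 s' : (s' <= M - l)%N -> J (E j' s') <-> J (E j' 0%N).
    by move=> /E0 E0' /E0 E0'' /E0' /E0''.
  elim: s' => // s' IHs s'M; rewrite -(IHs (ltnW s'M)).
  have Jstep : J (E j' s'.+1 - E j' s').
    have -> : E j' s'.+1 - E j' s' = al ^+ l.+1 * ta ^+ (M - l.+1 - s') *
       (al + ta) ^+ s' * (g ^+ j' * d ^+ (N - j')).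
      rewrite /E; have -> : (M - l - s' = (M - l.+1 - s').+1)%N by lia.
      have -> : (M - l - s'.+1 = M - l.+1 - s')%N by lia.
      by rewrite !exprS; ring.
    by apply: IHk => //; lia.
  split=> JE.
    by rewrite -[E _ _](subKr (E j' s'.+1)); apply: idealB.
  by rewrite -[E _ _](subrK (E j' s')); apply: JD.
have [B] := ubnP j; elim: B j s => // B IHB j s jB hj jN sM.
have [jM|Mj] := leqP j (M - l).
  apply: (shift j j) => //; rewrite /E mulrA -[_ * _ * _ * g ^+ j]mulrA -exprMn minor13.
  have -> : al ^+ l * ta ^+ (M - l - j) * (c * d) ^+ j * d ^+ (N - j) =
     al ^+ l * ta ^+ (M - l - j) * c ^+ j * d ^+ N.
    by rewrite -[in RHS](subnKC jN) exprD exprMn; ring.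
  exact: JM.
apply: (shift j 0%N) => //; rewrite /E expr0 mulr1.
(* The largest [r] for which the exponents of [g] stay at least [h - l]. *)
pose r := (M.+1 - h)%N; have rj : (r <= j)%N by lia.
have -> : g ^+ j * d ^+ (N - j) = g ^+ (j - r) * d ^+ (N - j) * b ^+ (n * r) -
    \sum_(i < r) (g ^+ (j - r + i) * d ^+ (N - (j - r + i))) *+ 'C(r, i).
  apply/eqP; rewrite eq_sym subr_eq exprM bn [g + d]addrC exprDn big_ord_recr /=.
  rewrite binn mulr1n subnn mul1r mulrDr; apply/eqP.
  rewrite [RHS]addrC; congr (_ + _).
    rewrite mulr_sumr; apply: eq_bigr => i _; rewrite mulrnAr; congr (_ *+ _).
    have -> : (N - (j - r + i) = N - j + (r - i))%N by have := ltn_ord i; lia.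
    by rewrite !exprD; ring.
  have -> : g ^+ j = g ^+ (j - r) * g ^+ r by rewrite -exprD subnK.
  by ring.
rewrite mulrBr; apply: idealB => //; last first.
  rewrite mulr_sumr; apply: ideal_sum => // i _; rewrite -mulr_natr mulrA; apply: JMr.
  have := IHB (j - r + i)%N 0%N; rewrite subn0 expr0 mulr1; apply; have := ltn_ord i; lia.
have [x1 nrE] : exists x1, (n * r = h - l + x1)%N by exists (n * r - (h - l))%N; lia.
have [x2 jrE] : exists x2, (j - r = h - l + x2)%N by exists (j - r - (h - l))%N; lia.
have -> : al ^+ l * ta ^+ (M - l - 0) * (g ^+ (j - r) * d ^+ (N - j) * b ^+ (n * r)) =
    al ^+ h * (ta ^+ (M - l - 0) * d ^+ (h - l) * g ^+ x2 * d ^+ (N - j) * b ^+ x1).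
  have -> : al ^+ h = al ^+ l * al ^+ (h - l) by rewrite -exprD; congr (_ ^+ _); lia.
  rewrite nrE jrE !exprD.
  transitivity (al ^+ l * ta ^+ (M - l - 0) * (b * g) ^+ (h - l) *
     (g ^+ x2 * d ^+ (N - j) * b ^+ x1)); first by rewrite exprMn; ring.
  by rewrite minor23 exprMn; ring.
exact: JMr.
Qed.

End FrobeniusMembership.

(** * Purity of Frobenius *)

Section TensorUnit.
Variables (R : comPzRingType) (M : lmodType R).

Lemma tens0r (N : lmodType R) (x : N) : tens x (0 : M) = 0.
Proof. by apply: (addrI (tens x 0)); rewrite -tensDr !addr0. Qed.

Lemma tens0l (N : lmodType R) (y : M) : tens (0 : N) y = 0.
Proof. by apply: (addrI (tens 0 y)); rewrite -tensDl !addr0. Qed.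

(** The multiplication map [R (x) M -> M] detects whether [r (x) y] is zero. *)
Lemma tens_eq0_scale (r : R^o) (y : M) : tens r y = 0 -> r *: y = 0.
Proof.
pose mu (w : {freeg (R^o * M)%type / int}) : M :=
  fglift (fun xy : R^o * M => (xy.1 : R) *: xy.2 : zmodule M) w.
have muB v w : mu (v - w) = mu v - mu w.
  exact: (@lift_is_additive int _ (zmodule M) (fun xy : R^o * M => (xy.1 : R) *: xy.2)).
have mu_pure x z : mu (pure_sym x z) = (x : R) *: z by rewrite /mu liftU scale1r.
move/tensor_class_eq0 => /(_ [set w | mu w = 0]) /=; rewrite mu_pure; apply; split.
  split=> [|v w /= v0 w0]; first by rewrite /= -(subrr 0) muB subrr.
  by rewrite muB v0 w0 subr0.
move=> w [] => [[x [x' [z ->]]]|[x [z [z' ->]]]|[a [x [z ->]]]] /=.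
- by rewrite !muB !mu_pure scalerDl -addrA -opprD subrr.
- by rewrite !muB !mu_pure scalerDr -addrA -opprD subrr.
- by rewrite !muB !mu_pure scalerA mulrC subrr.
Qed.

End TensorUnit.

(** Purity of the Frobenius map is applied to the module [M = R/(y,z)]: the
    class of [x (x) 1] dies in [F_* R (x) M], where [y] and [z] act through their
    [p]-th powers. *)
Lemma F_pure_contracted (p : nat) (R : comPzRingType) (x y z u v : R) :
  has_pchar p R -> F_pure p R -> x ^+ p = u * y ^+ p + v * z ^+ p ->
  ideal_gen [set` [:: y; z]] x.
Proof.
move=> charRp /(_ charRp); set F := frobenius charRp => pureF xp.
pose M : lmodType R := restrict_scalars (quot_map [set` [:: y; z]]).
pose one : M := (1 : ring_quot [set` [:: y; z]]).
have scale1 (r : R) : r *: one = quot_map [set` [:: y; z]] r by exact: mulr1.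
have scale0 (r : R) : r \in [:: y; z] -> r *: one = 0.
  move=> rX; rewrite scale1 -(rmorph0 (quot_map [set` [:: y; z]])).
  by apply/quot_map_eq; rewrite subr0; apply: sub_ideal_gen.
suff tx0 : tens (x : R^o) one = 0.
  rewrite -[x]subr0; apply/quot_map_eq; rewrite rmorph0 -scale1.
  exact: tens_eq0_scale tx0.
apply: pureF; rewrite -(tens0l _ one) !tensorl_tens raddf0 tens0l.
transitivity (tens (y *: (u : restrict_scalars F) + z *: (v : restrict_scalars F)) one).
  congr (tens _ one); rewrite /= /restrict_hom {1}/F /frobenius xp.
  by rewrite [u * _]mulrC [v * _]mulrC.
by rewrite tensDl !tensZ !scale0 ?tens0r ?addr0 // !inE eqxx ?orbT.
Qed.

Lemma F_pure_contracted_pe (p e : nat) (R : comPzRingType) (x y z u v : R) :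
  has_pchar p R -> F_pure p R -> x ^+ (p ^ e) = u * y ^+ (p ^ e) + v * z ^+ (p ^ e) ->
  ideal_gen [set` [:: y; z]] x.
Proof.
move=> charRp pureF; elim: e u v => [|e IHe] u v.
  rewrite expn0 !expr1 => ->; have [_ GD GM] := ideal_gen_ideal [set` [:: y; z]].
  by apply: GD; apply: GM; apply: sub_ideal_gen; rewrite /= !inE eqxx ?orbT.
rewrite expnSr !exprM => xpe.
have /ideal_gen_seqP[h] := F_pure_contracted charRp pureF xpe.
by rewrite /= !big_ord_recr big_ord0 /= add0r => /IHe.
Qed.

(** * Presentation of the deformation ring *)

Lemma det_2x2 (R : comNzRingType) (M : 'M[R]_2) :
  \det M = M ord0 ord0 * M ord_max ord_max - M ord0 ord_max * M ord_max ord0.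
Proof.
rewrite (expand_det_row _ ord0) !big_ord_recl big_ord0 addr0 /cofactor !det_mx11 !mxE /=.
rewrite expr0 expr1 !mul1r mulN1r mulrN; congr (M _ _ * M _ _ - M _ _ * M _ _);
  exact/val_inj.
Qed.

Section Presentation.
Variables (K : fieldType) (m n : nat).
Local Notation A := ('X_(inord 0) : {mpoly K[5]}).
Local Notation B := ('X_(inord 1) : {mpoly K[5]}).
Local Notation C := ('X_(inord 2) : {mpoly K[5]}).
Local Notation D := ('X_(inord 3) : {mpoly K[5]}).
Local Notation T := ('X_(inord 4) : {mpoly K[5]}).

Definition minor12 : {mpoly K[5]} := (A ^+ 2 + T ^+ m) * A ^+ 2 - B * C.
Definition minor13 : {mpoly K[5]} := (A ^+ 2 + T ^+ m) * (B ^+ n - D) - D * C.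
Definition minor23 : {mpoly K[5]} := B * (B ^+ n - D) - D * A ^+ 2.

Lemma deformation_minorsP (x : {mpoly K[5]}) :
  minors (deformation_matrix K m n) 2 x <->
  [\/ x = minor12, x = minor13 | x = minor23].
Proof.
pose pr (i j : nat) := fun k : 'I_2 => inord (if k == 0%N :> nat then i else j) : 'I_3.
have pr_mono i j : (i < j < 3)%N -> {homo pr i j : k l / (k < l)%N}.
  by move=> ij [[|[|[]]]] // ? [[|[|[]]]] // ? _; rewrite /pr /= !inordK; lia.
split=> [[f [g [fm gm ->]]]|].
  rewrite det_2x2 !mxE.
  have lt01 : ((ord0 : 'I_2) < (ord_max : 'I_2))%N by [].
  have /= := fm _ _ lt01; have /= := gm _ _ lt01.
  case: (f ord0) (f ord_max) => [[|[|[]]]] //= ? [[|[|[]]]] //= ? + _;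
  case: (g ord0) (g ord_max) => [[|[|[|[]]]]] //= ? [[|[|[|[]]]]] //= ? _.
  - exact: Or31.
  - exact: Or32.
  - exact: Or33.
have mk i j : (i < j < 3)%N -> minors (deformation_matrix K m n) 2
    (\det (mxsub id (pr i j) (deformation_matrix K m n))).
  by move=> ij; exists id, (pr i j); split=> //; apply: pr_mono.
case=> ->.
- by have := mk 0%N 1%N isT; rewrite det_2x2 !mxE /= !inordK.
- by have := mk 0%N 2%N isT; rewrite det_2x2 !mxE /= !inordK.
- by have := mk 1%N 2%N isT; rewrite det_2x2 !mxE /= !inordK.
Qed.

Local Notation R := (deformation_ring K m n).
Local Notation scal := (deformation_scalar K m n).
Definition defgen (i : nat) : R := quot_map (minors (deformation_matrix K m n) 2) 'X_(inord i).
Local Notation a := (defgen 0).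
Local Notation b := (defgen 1).
Local Notation c := (defgen 2).
Local Notation d := (defgen 3).
Local Notation t := (defgen 4).

Lemma defrel x y : minors (deformation_matrix K m n) 2 (x - y) ->
  quot_map (minors (deformation_matrix K m n) 2) x = quot_map _ y.
Proof. by move=> xy; apply/quot_map_eq; apply: sub_ideal_gen. Qed.

Lemma defrel12 : (a ^+ 2 + t ^+ m) * a ^+ 2 = b * c.
Proof.
rewrite /defgen -!rmorphXn -rmorphD -!rmorphM; apply: defrel.
by apply/deformation_minorsP/Or31.
Qed.

Lemma defrel13 : (a ^+ 2 + t ^+ m) * (b ^+ n - d) = d * c.
Proof.
rewrite /defgen -!rmorphXn -rmorphD -rmorphB -!rmorphM; apply: defrel.
by apply/deformation_minorsP/Or32.
Qed.

Lemma defrel23 : b * (b ^+ n - d) = d * a ^+ 2.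
Proof.
rewrite /defgen -!rmorphXn -rmorphB -!rmorphM; apply: defrel.
by apply/deformation_minorsP/Or33.
Qed.

Lemma mpoly_gen_ind k (P : {mpoly K[k]} -> Prop) :
  (forall x, P x%:MP) -> (forall i, P 'X_i) ->
  (forall x y, P x -> P y -> P (x + y)) -> (forall x y, P x -> P y -> P (x * y)) ->
  forall x, P x.
Proof.
move=> PC PX PD PM x; rewrite (mpolyE x); apply: (big_ind P) => //.
  by rewrite -mpolyC0.
move=> mu _; rewrite -mul_mpolyC; apply: (PM) => //; rewrite mpolyXE_id.
apply: (big_ind P) => // [|i _]; first by rewrite -mpolyC1.
elim: (mu i) => [|l IHl]; first by rewrite expr0 -mpolyC1.
by rewrite exprS; apply: PM.
Qed.

Lemma defring_ind (P : R -> Prop) :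
  (forall x, P (scal x)) -> P a -> P b -> P c -> P d -> P t ->
  (forall x y, P x -> P y -> P (x + y)) -> (forall x y, P x -> P y -> P (x * y)) ->
  forall x, P x.
Proof.
move=> PK Pa Pb Pc Pd Pt PD PM x; have [f <-] := quot_map_surj x.
elim/mpoly_gen_ind: f => [y|i|y z|y z]; first exact: PK.
- by rewrite -[i]inord_val; case: i => [[|[|[|[|[]]]]]].
- by rewrite rmorphD; apply: PD.
- by rewrite rmorphM; apply: PM.
Qed.

Lemma defring_hom_eq (S : comPzRingType) (f g : {rmorphism R -> S}) :
  (forall x, f (scal x) = g (scal x)) ->
  (forall i, (i < 5)%N -> f (defgen i) = g (defgen i)) -> f =1 g.
Proof.
move=> fgK fg; elim/defring_ind => //; try exact: fg.
  by move=> x y; rewrite !rmorphD => -> ->.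
by move=> x y; rewrite !rmorphM => -> ->.
Qed.

Lemma defring_lift (S : comNzRingType) (iota : {rmorphism K -> S}) (v : nat -> S) :
  (v 0%N ^+ 2 + v 4%N ^+ m) * v 0%N ^+ 2 = v 1%N * v 2%N ->
  (v 0%N ^+ 2 + v 4%N ^+ m) * (v 1%N ^+ n - v 3%N) = v 3%N * v 2%N ->
  v 1%N * (v 1%N ^+ n - v 3%N) = v 3%N * v 0%N ^+ 2 ->
  exists F : {rmorphism R -> S}, (forall x, F (scal x) = iota x) /\
    (forall i, (i < 5)%N -> F (defgen i) = v i).
Proof.
move=> r12 r13 r23; pose f := mmap iota (fun i : 'I_5 => v i) : {mpoly K[5]} -> S.
have fX i : (i < 5)%N -> f 'X_(inord i) = v i.
  by move=> i5; rewrite /f mmapX mmap1U inordK.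
have fX0 x : minors (deformation_matrix K m n) 2 x -> f x = 0.
  by case/deformation_minorsP => ->; rewrite /f rmorphB !rmorphM ?rmorphB ?rmorphD
    ?rmorphXn /= ?[mmap _ _ _]fX // ?r12 ?r13 ?r23 subrr.
exists (quot_lift fX0 : {rmorphism R -> S}); split=> [x|i i5].
  by transitivity (f x%:MP); [exact: (quot_liftE fX0) | rewrite /f mmapC].
by transitivity (f 'X_(inord i)); [exact: (quot_liftE fX0) | exact: fX].
Qed.

End Presentation.

(** * Grading *)

(** The relations are homogeneous for the weights [1, 2, 2, 2n] of [a, b, c, d]
    as soon as [t^m] has weight 2; [Y] plays the role of the [m]-th root of
    [Z^2] that [t] is multiplied with. *)
Lemma homogenize_relations (L : comPzRingType) (m n : nat) (a b c d t Z Y : L) :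
  Y ^+ m = Z ^+ 2 ->
  (a ^+ 2 + t ^+ m) * a ^+ 2 = b * c -> (a ^+ 2 + t ^+ m) * (b ^+ n - d) = d * c ->
  b * (b ^+ n - d) = d * a ^+ 2 ->
  let a' := a * Z in let b' := b * Z ^+ 2 in let c' := c * Z ^+ 2 in
  let d' := d * Z ^+ 2 ^+ n in let t' := t * Y in
  [/\ (a' ^+ 2 + t' ^+ m) * a' ^+ 2 = b' * c',
      (a' ^+ 2 + t' ^+ m) * (b' ^+ n - d') = d' * c'
    & b' * (b' ^+ n - d') = d' * a' ^+ 2].
Proof.
move=> YZ r12 r13 r23 a' b' c' d' t'; rewrite /a' /b' /c' /d' /t' !exprMn YZ; split.
- transitivity ((a ^+ 2 + t ^+ m) * a ^+ 2 * Z ^+ 4); first by ring.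
  by rewrite r12; ring.
- transitivity ((a ^+ 2 + t ^+ m) * (b ^+ n - d) * (Z ^+ 2 * (Z ^+ n * Z ^+ n))); first by ring.
  by rewrite r13; ring.
- transitivity (b * (b ^+ n - d) * (Z ^+ 2 * (Z ^+ n * Z ^+ n))); first by ring.
  by rewrite r23; ring.
Qed.

Arguments deformation_ring : simpl never.

Section DeformationGrading.
Variables (K : fieldType) (m n : nat).
Hypotheses (m_gt0 : (0 < m)%N) (n_gt0 : (0 < n)%N).
Local Notation R := (deformation_ring K m n).
Local Notation X := (minors (deformation_matrix K m n) 2).
Local Notation scal := (deformation_scalar K m n).
Local Notation gen := (defgen K m n).
Local Notation a := (gen 0).
Local Notation b := (gen 1).
Local Notation c := (gen 2).
Local Notation d := (gen 3).
Local Notation t := (gen 4).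
Local Notation gr := (@deformation_grading K m n).

Definition defwt (i : nat) : nat := nth 0%N [:: m; 2 * m; 2 * m; 2 * m * n; 2]%N i.

Lemma defring_augmentation : exists F : {rmorphism R -> K},
  (forall x, F (scal x) = x) /\ (forall i, (i < 5)%N -> F (gen i) = 0).
Proof.
by apply: (@defring_lift K m n K idfun (fun=> 0));
  rewrite ?expr0n ?gtn_eqF //= ?subr0 ?addr0 ?mulr0.
Qed.

Lemma defring_one_neq0 : (1 : R) != 0.
Proof.
have [F _] := defring_augmentation; apply/eqP => /(congr1 F).
by rewrite rmorph1 rmorph0 => /eqP; rewrite oner_eq0.
Qed.

(** Polynomials need a nontrivial coefficient ring, and nontriviality of [R] is a
    consequence of the positivity of [m] and [n]. *)
Definition nzdefring : comNzRingType :=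
  HB.pack R (GRing.PzSemiRing_isNonZero.Build R defring_one_neq0).
Local Notation nzR := nzdefring.
Arguments nzdefring : simpl never.

Lemma grade_map_exists : exists F : {rmorphism R -> {poly nzR}},
  (forall x, F (scal x) = (scal x : nzR)%:P) /\
  (forall i, (i < 5)%N -> F (gen i) = (gen i : nzR)%:P * 'X^(defwt i)).
Proof.
pose iota : {rmorphism K -> {poly nzR}} :=
  (@polyC nzR \o (scal : {rmorphism K -> nzR})).
pose Z : {poly nzR} := 'X^m; pose v i := (gen i : nzR)%:P.
have Xm2 : 'X^(2 * m) = Z ^+ 2 by rewrite mulnC exprM.
have X2m : 'X^2 ^+ m = Z ^+ 2 by rewrite -exprM.
have Xmn : 'X^(2 * m * n) = Z ^+ 2 ^+ n by rewrite exprM Xm2.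
have r12 : (v 0%N ^+ 2 + v 4%N ^+ m) * v 0%N ^+ 2 = v 1%N * v 2%N.
  by have := congr1 (@polyC nzR) (defrel12 K m n); rewrite !(rmorphM, rmorphD, rmorphXn).
have r13 : (v 0%N ^+ 2 + v 4%N ^+ m) * (v 1%N ^+ n - v 3%N) = v 3%N * v 2%N.
  by have := congr1 (@polyC nzR) (defrel13 K m n);
    rewrite !(rmorphM, rmorphB, rmorphD, rmorphXn).
have r23 : v 1%N * (v 1%N ^+ n - v 3%N) = v 3%N * v 0%N ^+ 2.
  by have := congr1 (@polyC nzR) (defrel23 K m n); rewrite !(rmorphM, rmorphB, rmorphXn).
have /= [R12 R13 R23] := homogenize_relations X2m r12 r13 r23.
apply: (@defring_lift K m n _ iota (fun i => v i * 'X^(defwt i))).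
- by rewrite /defwt /= Xm2.
- by rewrite /defwt /= Xm2 Xmn.
- by rewrite /defwt /= Xm2 Xmn.
Qed.

(** The coaction of the multiplicative group that defines the grading: the
    coefficients of [grade_map x] are the homogeneous components of [x]. *)
Definition grade_map : {rmorphism R -> {poly nzR}} := sval (cid grade_map_exists).

Lemma grade_map_scal x : grade_map (scal x) = (scal x : nzR)%:P.
Proof. by rewrite /grade_map; case: cid => F []. Qed.

Lemma grade_map_gen i : (i < 5)%N -> grade_map (gen i) = (gen i : nzR)%:P * 'X^(defwt i).
Proof. by rewrite /grade_map; case: cid => F [? Fgen]; apply: Fgen. Qed.

Lemma gr_subgroup i : is_subgroup (gr i).
Proof.
split=> [|_ _ [f fi <-] [g gi <-]].
  by exists 0; rewrite ?rmorph0 // => mu; rewrite msupp0.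
exists (f - g); rewrite ?rmorphB // => mu.
by move/msuppB_le; rewrite mem_cat => /orP[/fi|/gi].
Qed.

Lemma gr0 i : gr i 0. Proof. by case: (gr_subgroup i). Qed.

Lemma grB i x y : gr i x -> gr i y -> gr i (x - y).
Proof. by case: (gr_subgroup i) => _; apply. Qed.

Lemma grD i x y : gr i x -> gr i y -> gr i (x + y).
Proof.
move=> gx gy; rewrite -[y]opprK -[- y]sub0r.
by apply: (grB gx); apply: grB gy; apply: gr0.
Qed.

Lemma grM i j x y : gr i x -> gr j y -> gr (i + j)%N (x * y).
Proof.
move=> [f fi <-] [g gj <-]; exists (f * g); rewrite ?rmorphM // => mu.
move/msuppM_le/allpairsP => [[mu1 mu2] /= [/fi <- /gj <- ->]].
by rewrite -big_split; apply: eq_bigr => k _; rewrite mnmDE mulnDl.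
Qed.

Lemma gr_sum i (J : Type) (r : seq J) (F : J -> R) :
  (forall j, gr i (F j)) -> gr i (\sum_(j <- r) F j).
Proof. by move=> Fi; apply: big_ind => //; [apply: gr0 | apply: grD]. Qed.

Lemma gr_scal x : gr 0%N (scal x).
Proof.
exists x%:MP => // mu; rewrite msuppC; case: eqP => // _; rewrite inE => /eqP ->.
by rewrite big1 // => i _; rewrite mnm0E.
Qed.

Lemma gr_gen i : (i < 5)%N -> gr (defwt i) (gen i).
Proof.
move=> i5; exists 'X_(inord i) => // mu; rewrite msuppX inE => /eqP ->.
rewrite (bigD1 (inord i)) //= mnm1E eqxx mul1n big1 => [|j ji].
  by rewrite addn0 /deformation_weight inordK.
by rewrite mnm1E eq_sym (negPf ji).
Qed.

(** Together with [gr_grade_map] this says that [gr i] consists of the [x] with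
    [grade_map x = x * 'X^i], which is how directness of the sum of the [gr i]
    is obtained. *)
Lemma grade_map_homog i x : gr i x -> grade_map x = (x : nzR)%:P * 'X^i.
Proof.
case=> f fi <-; rewrite (mpolyE f) !rmorph_sum /= mulr_suml.
rewrite !big_seq; apply: eq_bigr => mu /fi <-; rewrite -mul_mpolyC !rmorphM /=.
rewrite [grade_map _]grade_map_scal -mulrA; congr (_ * _).
rewrite mpolyXE_id !rmorph_prod /= -prodrXr -big_split; apply: eq_bigr => k _ /=.
rewrite !rmorphXn /= mulnC exprM -exprMn; congr (_ ^+ _).
by have := grade_map_gen (ltn_ord k); rewrite /defgen /deformation_weight /defwt inord_val.
Qed.

Lemma coef_grade_map_homog i x k : gr i x ->
  (grade_map x)`_k = if k == i then x else 0.
Proof.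
move=> gx; rewrite (grade_map_homog gx) coefMXn coefC subn_eq0.
by case: (ltngtP k i).
Qed.

Lemma gr_grade_map x k : gr k (grade_map x)`_k.
Proof.
have grade_homog i y : gr i y -> forall j, gr j (grade_map y)`_j.
  by move=> gy j; rewrite (coef_grade_map_homog _ gy); case: eqP => [->|_] //; apply: gr0.
elim/defring_ind: x k => [x||||| |x y Gx Gy k|x y Gx Gy k].
- exact/grade_homog/gr_scal.
- exact: (grade_homog _ _ (gr_gen (isT : 0 < 5)%N)).
- exact: (grade_homog _ _ (gr_gen (isT : 1 < 5)%N)).
- exact: (grade_homog _ _ (gr_gen (isT : 2 < 5)%N)).
- exact: (grade_homog _ _ (gr_gen (isT : 3 < 5)%N)).
- exact: (grade_homog _ _ (gr_gen (isT : 4 < 5)%N)).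
- by rewrite rmorphD coefD; apply: grD.
- rewrite rmorphM coefM; apply: gr_sum => i.
  by rewrite -[k in gr k](subnKC (ltn_ord i : i <= k)%N); apply: grM.
Qed.

Lemma grade_map_sum x : x = \sum_(i < size (grade_map x)) (grade_map x)`_i.
Proof.
suff -> : \sum_(i < size (grade_map x)) (grade_map x)`_i = (grade_map x).[1].
  pose F : {rmorphism R -> nzR} := (horner_eval (1 : nzR) \o grade_map).
  rewrite -[LHS]/(idfun x); apply: (@defring_hom_eq K m n nzR idfun F) => [y|i i5] /=.
    by rewrite /horner_eval grade_map_scal hornerC.
  by rewrite /horner_eval grade_map_gen // hornerM hornerC hornerXn expr1n mulr1.
by rewrite horner_coef; apply: eq_bigr => i _; rewrite expr1n mulr1.
Qed.

Lemma gr_decomp_uniq k (y : nat -> R) : (forall i, gr i (y i)) ->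
  \sum_(i < k) y i = 0 -> forall i, (i < k)%N -> y i = 0.
Proof.
move=> gy /(congr1 grade_map); rewrite rmorph0 rmorph_sum => sum0 i ik.
have <- : (\sum_(j < k) grade_map (y j) : {poly nzR})`_i = 0 :> nzR.
  by rewrite sum0; apply: coef0.
rewrite coef_sum (bigD1 (Ordinal ik)) // (coef_grade_map_homog _ (gy i)) eqxx.
rewrite big1 => [|j]; first by rewrite [RHS]addr0.
rewrite -val_eqE => /= ji; by rewrite (coef_grade_map_homog _ (gy j)) eq_sym (negPf ji).
Qed.

Lemma defring_N_graded : N_graded scal gr.
Proof.
split.
- exact: gr_subgroup.
- exact: grM.
- split=> [x|k y gy]; last exact: gr_decomp_uniq.
  exists (size (grade_map x)), (fun i => (grade_map x)`_i).
  by split; [exact: gr_grade_map | exact: grade_map_sum].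
- split.
    move=> x y xy; have [F [FK _]] := defring_augmentation.
    by rewrite -(FK x) -(FK y) xy.
  apply/seteqP; split=> [_ [f f0 <-]|_ [x _ <-]]; last exact: gr_scal.
  exists f@_0%MM => //; congr (quot_map _ _); apply/mpolyP => mu.
  rewrite mcoeffC; case: eqP => [<-|mu0]; first by rewrite mulr1.
  rewrite mulr0; apply/esym/memN_msupp_eq0/negP => /f0 /eqP.
  rewrite sum_nat_eq0 => /forallP wt0; apply: mu0; apply/mnmP => i; rewrite mnm0E.
  have := wt0 i; rewrite muln_eq0 => /orP[/eqP -> //|].
  by rewrite /deformation_weight; case: i => [[|[|[|[|[]]]]]] //=; rewrite ?muln_eq0; lia.
- exists [seq gen i | i <- iota 0 5]; apply/seteqP; split=> // x _ Y [[Y1 YB YM] XY].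
  have Y0 : Y 0 by rewrite -(subrr 1); apply: YB.
  have YD y z : Y y -> Y z -> Y (y + z).
    by move=> Yy Yz; rewrite -[z]opprK; apply: (YB) => //; rewrite -sub0r; apply: YB.
  have Ygen i : (i < 5)%N -> Y (gen i).
    by move=> i5; apply: XY; right; apply: map_f; rewrite mem_iota.
  apply: defring_ind; [|exact: Ygen|exact: Ygen|exact: Ygen|exact: Ygen|exact: Ygen| |].
  - by move=> z; apply: XY; left; exists z.
  - exact: YD.
  - exact: YM.
Qed.

End DeformationGrading.

(** * A parametrization *)

(** With [x = u * v], [U = u^(2n)] and [V = v^(2n)] these are the coordinates of
    the cone over the double cover described at the top, deformed by [s]: the
    value of [c] is dictated by [(a^2 + ta) * a^2 = b * c], and the powers of
    [U + V] in front of [s] clear its denominator.  The sign and the factor 4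
    in [k] come from [a^2 + b = - 4 * x^2 * U * V * (U + V)^2]. *)
Section ParamIdentities.
Variables (L : comNzRingType) (m n : nat) (x U V k s : L).
Hypotheses (m_gt0 : (0 < m)%N) (xUV : x ^+ (2 * n) = U * V) (k4 : 4%:R * k = (-1) ^+ n).
Let a := x * (V ^+ 2 - U ^+ 2).
Let b := - (x ^+ 2 * (U + V) ^+ 4).
Let c := - (x ^+ 2 * (U - V) ^+ 4) - (U - V) ^+ 2 * (U + V) ^+ (2 * m - 2) * s.
Let d := k * (U + V) ^+ (4 * n + 2).
Let ta := (U + V) ^+ (2 * m) * s.

Let UV2m : (U + V) ^+ (2 * m) = (U + V) ^+ (2 * m - 2) * (U + V) ^+ 2.
Proof. by rewrite -exprD subnK // leq_pmulr. Qed.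

Let bn : b ^+ n = 4%:R * k * (U * V) * (U + V) ^+ (4 * n).
Proof. by rewrite /b exprNn exprMn -!exprM xUV k4; ring. Qed.

Lemma param12 : (a ^+ 2 + ta) * a ^+ 2 = b * c.
Proof. by rewrite /a /b /c /ta UV2m; ring. Qed.

Lemma param13 : (a ^+ 2 + ta) * (b ^+ n - d) = d * c.
Proof. by rewrite bn /a /c /d /ta UV2m exprD; ring. Qed.

Lemma param23 : b * (b ^+ n - d) = d * a ^+ 2.
Proof. by rewrite bn /a /b /d exprD; ring. Qed.

End ParamIdentities.

(** The shape of the expressions to which [gr_reduce] reduces homogeneous
    elements. *)
Section FiveTerms.
Variables (L : comPzRingType) (a t B C D : L).
Definition five_terms x1 x2 p q r := a * x1 + t * x2 + p * B + q * C + r * D.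

Lemma five_termsD x1 x2 p q r y1 y2 p' q' r' :
  five_terms x1 x2 p q r + five_terms y1 y2 p' q' r' =
  five_terms (x1 + y1) (x2 + y2) (p + p') (q + q') (r + r').
Proof. by rewrite /five_terms; ring. Qed.

Lemma five_termsZ e x1 x2 p q r : e * five_terms x1 x2 p q r =
  five_terms (e * x1) (e * x2) (e * p) (e * q) (e * r).
Proof. by rewrite /five_terms; ring. Qed.

Lemma five_terms0 : five_terms 0 0 0 0 0 = 0.
Proof. by rewrite /five_terms; ring. Qed.

Lemma five_terms1 y : five_terms y 0 0 0 0 = a * y.
Proof. by rewrite /five_terms; ring. Qed.

Lemma five_terms2 y : five_terms 0 y 0 0 0 = t * y.
Proof. by rewrite /five_terms; ring. Qed.

Lemma five_terms3 : five_terms 0 0 1 0 0 = B.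
Proof. by rewrite /five_terms; ring. Qed.

Lemma five_terms4 : five_terms 0 0 0 1 0 = C.
Proof. by rewrite /five_terms; ring. Qed.

Lemma five_terms5 : five_terms 0 0 0 0 1 = D.
Proof. by rewrite /five_terms; ring. Qed.

Lemma five_terms_multiple y x : five_terms (t * y) x 0 0 0 = t * (a * y + x).
Proof. by rewrite /five_terms; ring. Qed.
End FiveTerms.

Lemma rmorph_five_terms (L L' : comPzRingType) (f : {rmorphism L -> L'})
    (a t b c d x1 x2 p q r : L) (p' q' r' : L') j l :
  f t = 0 -> f p = p' -> f q = q' -> f r = r' ->
  f (five_terms a t (b ^+ j) (c ^+ j) (d ^+ l) x1 x2 p q r) =
  f a * f x1 + p' * f b ^+ j + q' * f c ^+ j + r' * f d ^+ l.
Proof.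
move=> ft <- <- <-.
by rewrite /five_terms !rmorphD !rmorphM !rmorphXn ft mul0r addr0.
Qed.

Lemma sum_ord5 (F : 'I_5 -> nat) : (\sum_i F i = F (inord 0) + F (inord 1) + F (inord 2)
  + F (inord 3) + F (inord 4))%N.
Proof.
rewrite !big_ord_recr big_ord0 /= add0n; congr (F _ + F _ + F _ + F _ + F _)%N;
  by apply: val_inj; rewrite /= inordK.
Qed.

Lemma prod_ord5 (L : comPzRingType) (F : 'I_5 -> L) : \prod_i F i =
  F (inord 0) * F (inord 1) * F (inord 2) * F (inord 3) * F (inord 4).
Proof.
rewrite !big_ord_recr big_ord0 /= mul1r; congr (F _ * F _ * F _ * F _ * F _);
  by apply: val_inj; rewrite /= inordK.
Qed.

Section Torsion.
Variables (K : fieldType) (m n : nat).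
Hypotheses (m_gt0 : (0 < m)%N) (n_gt0 : (0 < n)%N).
Local Notation R := (deformation_ring K m n).
Local Notation scal := (deformation_scalar K m n).
Local Notation gen := (defgen K m n).
Local Notation a := (gen 0).
Local Notation b := (gen 1).
Local Notation c := (gen 2).
Local Notation d := (gen 3).
Local Notation t := (gen 4).
Local Notation gr := (@deformation_grading K m n).
Local Notation gm := (grade_map K m_gt0 n_gt0).

Lemma grX k i (x : R) : gr i x -> gr (k * i)%N (x ^+ k).
Proof.
move=> gx; elim: k => [|k IHk]; last by rewrite exprS mulSn; apply: grM.
rewrite expr0 mul0n -(rmorph1 (quot_map (minors (deformation_matrix K m n) 2))) -mpolyC1.
exact: gr_scal.
Qed.

Lemma gr_monomial e0 e1 e2 e3 e4 :
  gr (e0 * m + e1 * (2 * m) + e2 * (2 * m) + e3 * (2 * m * n) + e4 * 2)%N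
     (a ^+ e0 * b ^+ e1 * c ^+ e2 * d ^+ e3 * t ^+ e4).
Proof.
have gr_pow i k : (i < 5)%N -> gr (k * defwt m n i) (gen i ^+ k).
  by move=> i5; apply/grX/gr_gen.
exact: (grM (grM (grM (grM (gr_pow 0 e0 isT) (gr_pow 1 e1 isT)) (gr_pow 2 e2 isT))
  (gr_pow 3 e3 isT)) (gr_pow 4 e4 isT)).
Qed.

(* The successor of the predecessor makes these exponents positive also in the
   degrees [W] where no power of [b], [c] or [d] occurs. *)
Let bexp W := (W %/ (2 * m)).-1.+1.
Let dexp W := (W %/ (2 * m * n)).-1.+1.

(** Modulo [a] and [t] the relations read [b * c = d * c = 0] and
    [b * d = b ^+ n.+1], so a monomial free of [a] and [t] reduces to a power
    of [b], of [c] or of [d]. *)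
Lemma gr_reduce W (x : R) : (0 < W)%N -> gr W x -> exists x1 x2 p q r,
  [/\ gr (W - m)%N x1, gr (W - 2)%N x2
    & x = five_terms a t (b ^+ bexp W) (c ^+ bexp W) (d ^+ dexp W)
            x1 x2 (scal p) (scal q) (scal r)].
Proof.
move=> W_gt0; pose V := [set x | exists x1 x2 p q r,
  [/\ gr (W - m)%N x1, gr (W - 2)%N x2
    & x = five_terms a t (b ^+ bexp W) (c ^+ bexp W) (d ^+ dexp W)
            x1 x2 (scal p) (scal q) (scal r)]].
have scal0 : scal 0 = 0 by exact: rmorph0.
have scal1 : scal 1 = 1 by exact: rmorph1.
have VD y z : V y -> V z -> V (y + z).
  move=> [x1 [x2 [p [q [r [g1 g2 ->]]]]]] [y1 [y2 [p' [q' [r' [g1' g2' ->]]]]]].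
  exists (x1 + y1), (x2 + y2), (p + p'), (q + q'), (r + r').
  by split; [exact: grD|exact: grD|rewrite !(rmorphD scal); exact: five_termsD].
have VZ e y : V y -> V (scal e * y).
  move=> [x1 [x2 [p [q [r [g1 g2 ->]]]]]].
  exists (scal e * x1), (scal e * x2), (e * p), (e * q), (e * r).
  split; last by rewrite !(rmorphM scal); exact: five_termsZ.
    exact: (grM (gr_scal m n e) g1).
  exact: (grM (gr_scal m n e) g2).
have Va y : gr (W - m)%N y -> V (a * y).
  move=> gy; exists y, 0, 0, 0, 0; split; [exact: gy|exact: gr0|].
  by rewrite scal0 five_terms1.
have Vt y : gr (W - 2)%N y -> V (t * y).
  move=> gy; exists 0, y, 0, 0, 0; split; [exact: gr0|exact: gy|].
  by rewrite scal0 five_terms2.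
have bexpE j : (0 < j)%N -> W = (j * (2 * m))%N -> bexp W = j.
  by move=> j0 ->; rewrite /bexp mulnK ?muln_gt0 // prednK.
have dexpE j : (0 < j)%N -> W = (j * (2 * m * n))%N -> dexp W = j.
  by move=> j0 ->; rewrite /dexp mulnK ?muln_gt0 ?m_gt0 // prednK.
have Vb j : (0 < j)%N -> W = (j * (2 * m))%N -> V (b ^+ j).
  move=> j0 /(bexpE _ j0) WE; exists 0, 0, 1, 0, 0; split; [exact: gr0|exact: gr0|].
  by rewrite scal0 scal1 WE five_terms3.
have Vc j : (0 < j)%N -> W = (j * (2 * m))%N -> V (c ^+ j).
  move=> j0 /(bexpE _ j0) WE; exists 0, 0, 0, 1, 0; split; [exact: gr0|exact: gr0|].
  by rewrite scal0 scal1 WE five_terms4.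
have Vd j : (0 < j)%N -> W = (j * (2 * m * n))%N -> V (d ^+ j).
  move=> j0 /(dexpE _ j0) WE; exists 0, 0, 0, 0, 1; split; [exact: gr0|exact: gr0|].
  by rewrite scal0 scal1 WE five_terms5.
have eqgr i j y : i = j -> gr i y -> gr j y by move=> ->.
have Vbd i j : (0 < i)%N -> W = (i * (2 * m) + j * (2 * m * n))%N -> V (b ^+ i * d ^+ j).
  elim: j i => [|j IHj] [|i] // _ WE.
    by rewrite mulr1; apply: Vb; rewrite // WE addn0.
  have -> : b ^+ i.+1 * d ^+ j.+1 = b ^+ (i.+1 + n) * d ^+ j +
      scal (-1) * (a * (a ^+ 1 * b ^+ i * c ^+ 0 * d ^+ j.+1 * t ^+ 0)).
    rewrite rmorphN1 !exprS exprD expr0.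
    have -> : b * b ^+ i * (d * d ^+ j) = b ^+ i * d ^+ j * (b ^+ n * b - b * (b ^+ n - d)).
      by ring.
    by rewrite defrel23; ring.
  apply: VD; first by apply: IHj => //; rewrite WE; nia.
  by apply/VZ/Va; apply: eqgr (gr_monomial 1 i 0 j.+1 0); rewrite WE; nia.
have Vmono e0 e1 e2 e3 e4 :
    W = (e0 * m + e1 * (2 * m) + e2 * (2 * m) + e3 * (2 * m * n) + e4 * 2)%N ->
    V (a ^+ e0 * b ^+ e1 * c ^+ e2 * d ^+ e3 * t ^+ e4).
  case: e0 => [|e0] WE; last first.
    rewrite exprS -!mulrA; apply: Va; rewrite !mulrA.
    by apply: eqgr (gr_monomial e0 e1 e2 e3 e4); rewrite WE; nia.
  case: e4 WE => [|e4] WE; last first.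
    rewrite exprSr [_ * t]mulrC mulrCA; apply: Vt.
    by apply: eqgr (gr_monomial 0 e1 e2 e3 e4); rewrite WE; nia.
  rewrite mul1r mulr1; case: e2 WE => [|e2] WE.
    rewrite mulr1; case: e1 WE => [|e1] WE; last by apply: Vbd; rewrite // WE; nia.
    by rewrite mul1r; case: e3 WE => [|e3] WE; [lia | apply: Vd; rewrite // WE; nia].
  case: e1 WE => [|e1] WE; last first.
    have -> : b ^+ e1.+1 * c ^+ e2.+1 * d ^+ e3 =
        a * (a ^+ 3 * b ^+ e1 * c ^+ e2 * d ^+ e3 * t ^+ 0 +
             a ^+ 1 * b ^+ e1 * c ^+ e2 * d ^+ e3 * t ^+ m).
      rewrite [b ^+ _.+1]exprS [c ^+ _.+1]exprS.
      transitivity (b * c * (b ^+ e1 * c ^+ e2 * d ^+ e3)); first by ring.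
      by rewrite -defrel12; ring.
    apply: Va; apply: grD.
      by apply: eqgr (gr_monomial 3 e1 e2 e3 0); rewrite WE; nia.
    by apply: eqgr (gr_monomial 1 e1 e2 e3 m); rewrite WE; nia.
  case: e3 WE => [|e3] WE; first by rewrite mul1r mulr1; apply: Vc; rewrite // WE; nia.
  have tm : t ^+ m = t * t ^+ m.-1 by rewrite -exprS prednK.
  have -> : b ^+ 0 * c ^+ e2.+1 * d ^+ e3.+1 =
      a * (a ^+ 1 * b ^+ n * c ^+ e2 * d ^+ e3 * t ^+ 0 -
           a ^+ 1 * b ^+ 0 * c ^+ e2 * d ^+ e3.+1 * t ^+ 0) +
      t * (a ^+ 0 * b ^+ n * c ^+ e2 * d ^+ e3 * t ^+ m.-1 -
           a ^+ 0 * b ^+ 0 * c ^+ e2 * d ^+ e3.+1 * t ^+ m.-1).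
    rewrite [c ^+ _.+1]exprS !(exprS d).
    transitivity (d * c * (c ^+ e2 * d ^+ e3)); first by ring.
    by rewrite -defrel13 tm; ring.
  apply: VD; [apply: Va | apply: Vt]; apply: grB.
  - by apply: eqgr (gr_monomial 1 n e2 e3 0); rewrite WE; nia.
  - by apply: eqgr (gr_monomial 1 0 e2 e3.+1 0); rewrite WE; nia.
  - by apply: eqgr (gr_monomial 0 n e2 e3 m.-1); rewrite WE; nia.
  - by apply: eqgr (gr_monomial 0 0 e2 e3.+1 m.-1); rewrite WE; nia.
case=> f fW <-; suff : V (quot_map (minors (deformation_matrix K m n) 2) f) by [].
rewrite (mpolyE f) rmorph_sum /= big_seq; apply: big_ind => //.
  by exists 0, 0, 0, 0, 0; split; [exact: gr0|exact: gr0|rewrite scal0 five_terms0].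
move=> mu /fW muW; rewrite -mul_mpolyC rmorphM; apply: VZ.
rewrite mpolyXE_id rmorph_prod prod_ord5 !rmorphXn /=; apply: Vmono.
by rewrite -muW sum_ord5 /deformation_weight !inordK.
Qed.
End Torsion.

Section Injectivity.
Variables (K : fieldType) (m n : nat).
Hypotheses (m_gt0 : (0 < m)%N) (n_gt0 : (0 < n)%N) (K2 : (2%:R : K) != 0).
Local Notation R := (deformation_ring K m n).
Local Notation scal := (deformation_scalar K m n).
Local Notation gen := (defgen K m n).
Local Notation a := (gen 0).
Local Notation b := (gen 1).
Local Notation c := (gen 2).
Local Notation d := (gen 3).
Local Notation t := (gen 4).
Local Notation gr := (@deformation_grading K m n).
Local Notation gm := (grade_map K m_gt0 n_gt0).
Local Notation PP := {poly {poly K}}.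

Definition quarter : K := (-1) ^+ n / 4%:R.

Let K4 : (4%:R : K) != 0. Proof. by rewrite (natrM K 2 2) mulf_neq0. Qed.

Lemma quarterE : 4%:R * quarter = (-1) ^+ n.
Proof. by rewrite /quarter mulrC divfK. Qed.

Lemma quarter_neq0 : quarter != 0.
Proof. by rewrite mulf_neq0 ?invr_neq0 // expf_neq0 // oppr_eq0 oner_neq0. Qed.

(** The parametrization of [param12] at [x = u] and [v = 1]; the homogeneous
    components are kept apart by their degree, so that setting [v = 1] loses
    nothing on each of them. *)
Lemma affine_param_exists : exists F : {rmorphism R -> PP},
  (forall x, F (scal x) = x%:P%:P) /\
  [/\ F a = ('X * (1 - 'X^(2 * n) ^+ 2))%:P,
      F b = (- ('X ^+ 2 * ('X^(2 * n) + 1) ^+ 4))%:P,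
      F c = (- ('X ^+ 2 * ('X^(2 * n) - 1) ^+ 4))%:P -
        (('X^(2 * n) - 1) ^+ 2 * ('X^(2 * n) + 1) ^+ (2 * m - 2))%:P * 'X^m,
      F d = (quarter%:P * ('X^(2 * n) + 1) ^+ (4 * n + 2))%:P
    & F t = (('X^(2 * n) + 1) ^+ 2)%:P * 'X].
Proof.
pose x : PP := 'X%:P; pose U : PP := ('X^(2 * n))%:P.
pose k : PP := quarter%:P%:P; pose s : PP := 'X^m.
have xUV : x ^+ (2 * n) = U * 1 by rewrite mulr1 /x /U -rmorphXn.
have k4 : 4%:R * k = (-1) ^+ n.
  by rewrite /k -!polyC_natr -!rmorphM quarterE !rmorphXn !rmorphN1.
pose v i : PP := nth 0 [:: x * (1 ^+ 2 - U ^+ 2); - (x ^+ 2 * (U + 1) ^+ 4);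
  - (x ^+ 2 * (U - 1) ^+ 4) - (U - 1) ^+ 2 * (U + 1) ^+ (2 * m - 2) * s;
  k * (U + 1) ^+ (4 * n + 2); (U + 1) ^+ 2 * 'X] i.
have v4m : v 4 ^+ m = (U + 1) ^+ (2 * m) * s by rewrite /v /= exprMn -exprM.
have [|||F [FK Fg]] := @defring_lift K m n PP (@polyC _ \o @polyC K) v.
- by rewrite v4m; apply: param12.
- by rewrite v4m; apply: param13.
- exact: param23.
exists F; split; first exact: FK.
split; rewrite Fg // /v /= /x /U /k /s;
  by rewrite ?expr1n !(rmorphM, rmorphB, rmorphD, rmorphN, rmorphXn, rmorph1).
Qed.

Definition affine_param : {rmorphism R -> PP} := sval (cid affine_param_exists).
Local Notation Phi := affine_param.

Lemma affine_param_scal x : Phi (scal x) = x%:P%:P.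
Proof. by rewrite /affine_param; case: cid => F [H ?]; apply: H. Qed.

Lemma affine_paramE :
  [/\ Phi a = ('X * (1 - 'X^(2 * n) ^+ 2))%:P,
      Phi b = (- ('X ^+ 2 * ('X^(2 * n) + 1) ^+ 4))%:P,
      Phi c = (- ('X ^+ 2 * ('X^(2 * n) - 1) ^+ 4))%:P -
        (('X^(2 * n) - 1) ^+ 2 * ('X^(2 * n) + 1) ^+ (2 * m - 2))%:P * 'X^m,
      Phi d = (quarter%:P * ('X^(2 * n) + 1) ^+ (4 * n + 2))%:P
    & Phi t = (('X^(2 * n) + 1) ^+ 2)%:P * 'X].
Proof. by rewrite /affine_param; case: cid => F [? H]; apply: H. Qed.

(** The restriction to the special fibre. *)
Definition affine_param0 : {rmorphism R -> {poly K}} :=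
  (horner_eval (0 : {poly K}) \o affine_param).
Local Notation Phi0 := affine_param0.

Lemma affine_param0_scal x : Phi0 (scal x) = x%:P.
Proof. by rewrite /= affine_param_scal /horner_eval hornerC. Qed.

Lemma affine_param0E :
  [/\ Phi0 a = 'X * (1 - 'X^(2 * n) ^+ 2),
      Phi0 b = - ('X ^+ 2 * ('X^(2 * n) + 1) ^+ 4),
      Phi0 c = - ('X ^+ 2 * ('X^(2 * n) - 1) ^+ 4),
      Phi0 d = quarter%:P * ('X^(2 * n) + 1) ^+ (4 * n + 2)
    & Phi0 t = 0].
Proof.
have [pa pb pc pd pt] := affine_paramE.
rewrite /= pa pb pc pd pt /horner_eval !hornerC; split=> //.
  by rewrite hornerD hornerN hornerC hornerM hornerXn expr0n gtn_eqF //= mulr0 subr0.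
by rewrite hornerM hornerX mulr0.
Qed.

Lemma affine_param0_a_neq0 : Phi0 a != 0.
Proof.
have [-> _ _ _ _] := affine_param0E; rewrite mulf_neq0 ?polyX_eq0 //.
apply/eqP => /(congr1 (fun f => f.[0])) /eqP; rewrite !hornerE -exprM expr0n.
by rewrite gtn_eqF ?muln_gt0 ?n_gt0 // subr0 oner_eq0.
Qed.

(** The three powers are independent modulo [Phi0 a], as one sees on the three
    loci [u = 0], [u = 1] and [u^(2n) = -1] where it vanishes: only [d] does
    not vanish on the first, only [b] on what remains of the second, and only
    [c] on the third. *)
Lemma affine_param0_independent (y : {poly K}) p q r j l :
  Phi0 a * y + p%:P * Phi0 b ^+ j.+1 + q%:P * Phi0 c ^+ j.+1
    + r%:P * Phi0 d ^+ l.+1 = 0 -> [/\ y = 0, p = 0, q = 0 & r = 0].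
Proof.
have := affine_param0_a_neq0; have [-> -> -> -> _] := affine_param0E.
set U := 'X^(2 * n) => pa_neq0 sum0.
have U0 : (0 : K) ^+ (2 * n) = 0 by rewrite expr0n gtn_eqF ?muln_gt0 ?n_gt0.
have hornE := (hornerD, hornerN, horner_exp, hornerM, hornerX, hornerC).
set pa := 'X * _ in pa_neq0 sum0 *; set pb := - ('X ^+ 2 * (U + 1) ^+ 4) in sum0.
set pc := - _ in sum0; set pd := quarter%:P * _ in sum0.
have [pa0 pb0 pc0] : [/\ pa.[0] = 0, pb.[0] = 0 & pc.[0] = 0].
  by split; rewrite /pa /pb /pc !hornE ?U0 ?(exprS (0 : K) 1) !mul0r ?oppr0.
have pd0 : pd.[0] = quarter by rewrite /pd !hornE U0 add0r expr1n mulr1.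
have [pa1 pc1] : pa.[1] = 0 /\ pc.[1] = 0.
  by split; rewrite /pa /pc !hornE ?expr1n ?mul1r subrr ?(exprS (0 : K) 3) ?mul0r ?mulr0 ?oppr0.
have pb1 : pb.[1] != 0.
  rewrite /pb !hornE !expr1n mul1r oppr_eq0 -(natrD K 1 1) expf_eq0 /=.
  exact: K2.
have paE : pa = (U + 1) * ('X * (1 - U)) by rewrite /pa; ring.
have pcE : pc = - ('X ^+ 2 * (U - 1) ^+ 4) by [].
clearbody pa pb pc pd.
have r0 : r = 0.
  have := congr1 (fun f => f.[0]) sum0; rewrite !hornE pa0 pb0 pc0 pd0.
  rewrite (exprS (0 : K) j) !mul0r !mulr0 !add0r => /eqP.
  by rewrite mulf_eq0 expf_eq0 (negPf quarter_neq0) orbF => /eqP.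
move: sum0; rewrite r0 mul0r addr0 => sum0.
have p0 : p = 0.
  have := congr1 (fun f => f.[1]) sum0; rewrite !hornE pa1 pc1.
  rewrite (exprS (0 : K) j) !mul0r !mulr0 add0r addr0 => /eqP.
  by rewrite mulf_eq0 expf_eq0 (negPf pb1) orbF => /eqP.
move: sum0; rewrite p0 mul0r addr0 => sum0.
have q0 : q = 0.
  apply/eqP; apply: contraT => q_neq0.
  have coX : coprimep (U + 1) 'X.
    apply/Bezout_coprimepP; exists (1, - 'X^((2 * n).-1)) => /=.
    rewrite mul1r mulNr -exprSr prednK ?muln_gt0 // -/U addrAC subrr add0r.
    exact: eqpxx.
  have coU : coprimep (U + 1) (U - 1).
    apply/Bezout_coprimepP; exists (1, -1) => /=.
    have -> : 1 * (U + 1) + -1 * (U - 1) = (2%:R : K)%:P by rewrite polyC_natr; ring.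
    by rewrite -[2%:R in X in X %= _]mulr1 polyCM mul_polyC eqp_scale.
  have co : coprimep (U + 1) (pc ^+ j.+1).
    rewrite pcE -scaleN1r; apply: coprimep_expr.
    by rewrite coprimepZr ?oppr_eq0 ?oner_eq0 // coprimepMr !coprimep_expr.
  have : (U + 1) %| q%:P * pc ^+ j.+1.
    have -> : q%:P * pc ^+ j.+1 = (U + 1) * ('X * (U - 1) * y).
      by apply/eqP; rewrite -subr_eq0 -sum0 paE; apply/eqP; ring.
    exact: dvdp_mulr.
  rewrite Gauss_dvdpl // => /dvdp_leq; rewrite polyC_eq0 q_neq0 => /(_ isT).
  rewrite size_polyC q_neq0 size_addl size_polyXn ?size_poly1 //; lia.
move: sum0; rewrite q0 mul0r addr0 => /eqP; rewrite mulf_eq0 (negPf pa_neq0) /= => /eqP.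
by split.
Qed.

Lemma gr0_scal x : gr 0 x -> exists y, x = scal y.
Proof.
have [_ _ _ [_ E] _] := defring_N_graded K m_gt0 n_gt0.
move=> gx; have [y yT xE] : range scal x by rewrite -E.
by exists y; rewrite -xE.
Qed.

(** Induction on the degree: by independence the three powers in the reduction
    of [x] do not occur, and the cofactor of [a] is again in the kernel because
    [a] does not vanish identically. *)
Lemma affine_param0_ker W x : gr W x -> Phi0 x = 0 -> exists y, x = t * y.
Proof.
have [B] := ubnP W; elim: B W x => // B IHB [x _|W x]; last rewrite ltnS.
  case/gr0_scal => y ->; rewrite affine_param0_scal => /eqP; rewrite polyC_eq0 => /eqP ->.
  by exists 0; rewrite mulr0 rmorph0.
move=> WB gx; have [x1 [x2 [p [q [r [g1 g2 xE]]]]]] := gr_reduce m_gt0 n_gt0 (isT : 0 < W.+1)%N gx.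
have [_ _ _ _ Phi0t] := affine_param0E.
rewrite xE (rmorph_five_terms _ _ _ _ _ _ _ _ Phi0t (affine_param0_scal p)
  (affine_param0_scal q) (affine_param0_scal r)).
move=> /affine_param0_independent[x1_0 -> -> ->].
have [|y1 ->] := IHB (W.+1 - m)%N x1 _ g1 x1_0; first by lia.
by exists (a * y1 + x2); rewrite !(rmorph0 scal) five_terms_multiple.
Qed.

Lemma coef_grade_map_t x k :
  (gm (t * x))`_k = if (k < 2)%N then 0 else t * ((gm x)`_(k - 2) : R).
Proof.
rewrite rmorphM grade_map_gen // -mulrA coefCM coefXnM.
by case: ifP => // _; apply: mulr0.
Qed.

Lemma affine_param_t_neq0 : Phi t != 0.
Proof.
have [_ _ _ _ ->] := affine_paramE; rewrite mulf_neq0 ?polyX_eq0 // polyC_eq0.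
apply/eqP => /(congr1 (fun f => f.[0])); rewrite horner_exp hornerD hornerXn hornerC.
rewrite expr0n gtn_eqF ?muln_gt0 ?n_gt0 // add0r expr1n horner0 => /eqP.
by rewrite oner_eq0.
Qed.

(** An element of the kernel is divisible by [t], and the homogeneous component
    of the quotient in degree [W - 2] is in the kernel as well. *)
Lemma affine_param_inj W x : gr W x -> Phi x = 0 -> x = 0.
Proof.
have [B] := ubnP W; elim: B W x => // B IHB W x; rewrite ltnS => WB gx Phix.
have [|y xE] := @affine_param0_ker W x gx; first by rewrite /= Phix /horner_eval horner0.
have := coef_grade_map_homog m_gt0 n_gt0 W gx; rewrite eqxx xE coef_grade_map_t -xE.
case: ltnP => [_ <- //|W2] xE'; rewrite -xE'.
have -> : (gm y)`_(W - 2) = 0; last exact: mulr0.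
apply: (IHB (W - 2)%N); [lia|exact: gr_grade_map|].
move: Phix; rewrite -xE' rmorphM => /eqP.
by rewrite mulf_eq0 (negPf affine_param_t_neq0) => /eqP.
Qed.

Lemma defring_t_nonzerodivisor : nonzerodivisor t.
Proof.
move=> x tx0; rewrite (grade_map_sum m_gt0 n_gt0 x); apply: big1 => k _.
apply: (@affine_param_inj k); first exact: gr_grade_map.
have tx_k : t * ((gm x)`_k : R) = 0.
  have := coef_grade_map_t x k.+2; rewrite tx0 rmorph0 [LHS]coef0 subn2.
  exact: esym.
move: (congr1 Phi tx_k); rewrite rmorph0 rmorphM => /eqP.
by rewrite mulf_eq0 (negPf affine_param_t_neq0) => /eqP.
Qed.

End Injectivity.

(** [Im] is a subring containing 1/2 and the invariants [a], [b], [c], [d] of the twisted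
    exchange; the aim is that it contains all symmetrized monomials of the
    lattice cone.  Those are indexed by the degree [i] and a slope [j], with
    exponents [(2n+1) i + 2n j] and [(2n+1) i - 2n j], so that the cone is given
    by [2n j <= (2n+1) i]. *)
Section DihedralInvariants.
Variables (L : comNzRingType) (u v : L) (n : nat) (half : L) (Im : set L).
Hypotheses (n_gt0 : (0 < n)%N) (half2 : 2%:R * half = 1).
Hypothesis ImB : forall x y, Im x -> Im y -> Im (x - y).
Hypothesis ImM : forall x y, Im x -> Im y -> Im (x * y).
Hypothesis Im_half : Im half.
Let U := u ^+ (2 * n).
Let V := v ^+ (2 * n).
Hypothesis Im_a : Im (u * v * (V ^+ 2 - U ^+ 2)).
Hypothesis Im_b : Im (- ((u * v) ^+ 2 * (U + V) ^+ 4)).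
Hypothesis Im_c : Im (- ((u * v) ^+ 2 * (U - V) ^+ 4)).
Hypothesis Im_d : Im ((U + V) ^+ (4 * n + 2)).

Definition symmetrized (i al be : nat) : L :=
  u ^+ al * v ^+ be + (-1) ^+ i * (u ^+ be * v ^+ al).

Let Sm i j := symmetrized i ((2 * n + 1) * i + 2 * n * j) ((2 * n + 1) * i - 2 * n * j).

Let Im0 : Im 0. Proof. by rewrite -(subrr half); apply: ImB. Qed.
Let ImN x : Im x -> Im (- x). Proof. by move=> Ix; rewrite -sub0r; apply: ImB. Qed.
Let ImD x y : Im x -> Im y -> Im (x + y).
Proof. by move=> Ix Iy; rewrite -[y]opprK; apply: ImB => //; apply: ImN. Qed.
Let Im2 : Im 2%:R.
Proof.
have -> : 2%:R = half + half + half + half.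
  by transitivity (2%:R * (2%:R * half)); [rewrite half2 mulr1 | ring].
exact: (ImD (ImD (ImD Im_half Im_half) Im_half) Im_half).
Qed.
Let Im1 : Im 1. Proof. by rewrite -half2; apply: ImM. Qed.
Let ImX x k : Im x -> Im (x ^+ k).
Proof. by move=> Ix; elim: k => [|k IHk]; rewrite ?expr0 // exprS; apply: ImM. Qed.
Let ImMn x k : Im x -> Im (x *+ k).
Proof. by move=> Ix; elim: k => [|k IHk]; rewrite ?mulr0n // mulrS; apply: ImD. Qed.
Let Im_halve x : Im (2%:R * x) -> Im x.
Proof. by move=> Ix; rewrite -[x]mul1r -half2 mulrAC; apply: ImM. Qed.

Let y2 := (u * v) ^+ (2 * (2 * n + 1)).
Let UV : (u * v) ^+ (2 * n) = U * V. Proof. by rewrite exprMn. Qed.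
Let y2E : y2 = (u * v) ^+ 2 * (U * V) ^+ 2.
Proof. by rewrite /y2 -UV -exprM -exprD; congr (_ ^+ _); lia. Qed.

Let Im_y2 : Im y2.
Proof.
do 4!apply: Im_halve; have -> : 2%:R * (2%:R * (2%:R * (2%:R * y2))) =
    - (- ((u * v) ^+ 2 * (U + V) ^+ 4) + - ((u * v) ^+ 2 * (U - V) ^+ 4) +
       2%:R * (u * v * (V ^+ 2 - U ^+ 2)) ^+ 2) by rewrite y2E; ring.
by apply: ImN; apply: (ImD); [apply: (ImD) | apply: ImM => //; apply: ImX].
Qed.

Let Sm_y2 i j : (2 * n * j <= (2 * n + 1) * i)%N -> y2 * Sm i j = Sm i.+2 j.
Proof.
move=> ij; rewrite /Sm /symmetrized.
have -> : ((2 * n + 1) * i.+2 + 2 * n * j =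
  2 * (2 * n + 1) + ((2 * n + 1) * i + 2 * n * j))%N by nia.
have -> : ((2 * n + 1) * i.+2 - 2 * n * j =
  2 * (2 * n + 1) + ((2 * n + 1) * i - 2 * n * j))%N by nia.
by rewrite /y2 !exprD !exprMn !exprS; ring.
Qed.

Let Sm_rec i j : (2 * n * j.+1 <= (2 * n + 1) * i)%N ->
  (2 * n * j.+2 <= (2 * n + 1) * i.+1)%N ->
  Sm i.+1 j.+2 = Sm i.+1 j - u * v * (V ^+ 2 - U ^+ 2) * Sm i j.+1.
Proof.
move=> ij ij'; rewrite /Sm /symmetrized; set A := (_ + 2 * n * j.+1)%N.
set B := (_ - 2 * n * j.+1)%N.
have -> : ((2 * n + 1) * i.+1 + 2 * n * j.+2 = A + 2 * n * 2 + 1)%N by rewrite /A; nia.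
have -> : ((2 * n + 1) * i.+1 - 2 * n * j.+2 = B + 1)%N by rewrite /B; nia.
have -> : ((2 * n + 1) * i.+1 + 2 * n * j = A + 1)%N by rewrite /A; nia.
have -> : ((2 * n + 1) * i.+1 - 2 * n * j = B + 2 * n * 2 + 1)%N by rewrite /B; nia.
clearbody A B.
by rewrite !exprD !(exprM _ (2 * n)) -/U -/V [(-1) ^+ _]exprS !expr1; ring.
Qed.

(** On the boundary ray the monomials are [U^(2k)] and [V^(2k)].  Their sum is a
    power of [d] up to a constant and to the middle terms of the binomial
    expansion of [(U + V)^(2k)], whose slopes are smaller. *)
Let Sm_boundary l : (0 < l)%N ->
  (forall j, (j < (2 * n + 1) * l)%N -> Im (Sm (2 * n * l) j)) ->
  Im (Sm (2 * n * l) ((2 * n + 1) * l)).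
Proof.
move=> l_gt0 IH; set k := ((2 * n + 1) * l)%N in IH *.
have k_gt0 : (0 < k)%N by rewrite /k; nia.
pose W e := U ^+ e * V ^+ (2 * k - e) + U ^+ (2 * k - e) * V ^+ e.
have sgn : (-1) ^+ (2 * n * l) = 1 :> L by rewrite -mulnA exprM sqrrN expr1n expr1n.
have SmE j : (j <= k)%N -> Sm (2 * n * l) j = W (k + j)%N.
  move=> jk; rewrite /Sm /symmetrized /W sgn mul1r /U /V -!exprM.
  by do 4?[congr (_ + _) | congr (_ * _)]; congr (_ ^+ _); rewrite /k; nia.
have Wsym e : (e <= 2 * k)%N -> W (2 * k - e)%N = W e.
  by move=> ek; rewrite /W subKn // addrC.
have ImW e : (0 < e < 2 * k)%N -> Im (W e).
  move=> /andP[e0 ek]; have [ke|ek'] := leqP k e.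
    have {1}-> : e = (k + (e - k))%N by lia.
    by rewrite -SmE; [apply: IH; lia|lia].
  rewrite -Wsym; last lia.
  have -> : (2 * k - e = k + (k - e))%N by lia.
  by rewrite -SmE; [apply: IH; lia|lia].
rewrite SmE // (_ : k + k = 2 * k)%N; last lia.
have expand : 2%:R * (U + V) ^+ (2 * k) = \sum_(e < (2 * k).+1) W e *+ 'C(2 * k, e).
  rewrite mulr_natl mulr2n {1}[U + V]addrC !exprDn -big_split; apply: eq_bigr => e _.
  rewrite /= -mulrnDl; congr (_ *+ _).
  by rewrite /W [V ^+ _ * U ^+ _]mulrC.
have [K' KE] : exists K', (2 * k = K'.+1)%N by exists (2 * k).-1; lia.
move: expand Wsym ImW; rewrite KE big_ord_recr big_ord_recl /= bin0 binn !mulr1n.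
move=> expand Wsym ImW; move: expand; have -> : W 0%N = W K'.+1 by rewrite -Wsym.
move=> expand; apply: Im_halve.
have -> : 2%:R * W K'.+1 = 2%:R * (U + V) ^+ K'.+1 -
    \sum_(i < K') W (bump 0 i) *+ 'C(K'.+1, bump 0 i) by rewrite expand; ring.
apply: ImB.
  by apply: ImM => //; rewrite -KE (_ : 2 * k = (4 * n + 2) * l)%N ?exprM;
    [apply: ImX | rewrite /k; nia].
apply: (big_ind Im) => // i _.
by apply: ImMn; apply: ImW; rewrite /bump; have := ltn_ord i; lia.
Qed.

(** Multiplication by [y2 = (u v)^(2(2n+1))] raises the degree by 2 and disposes
    of small slopes.  For larger ones the product of [a] with the symmetrized
    monomial of indices [i] and [j + 1] is a difference of those of degree
    [i + 1] and slopes [j] and [j + 2]; this recursion only fails on the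
    boundary ray of the cone. *)
Lemma symmetrized_image i j : (2 * n * j <= (2 * n + 1) * i)%N ->
  Im (symmetrized i ((2 * n + 1) * i + 2 * n * j) ((2 * n + 1) * i - 2 * n * j)).
Proof.
change ((2 * n * j <= (2 * n + 1) * i)%N -> Im (Sm i j)).
have [N] := ubnP i; elim: N i j => // N IHN i j; rewrite ltnS => iN.
have [B] := ubnP j; elim: B j => // B IHB j; rewrite ltnS => jB ij.
have [ij2|ij2] := leqP (2 * n * j) ((2 * n + 1) * (i - 2)).
  case: i iN IHB ij ij2 => [|[|i]] iN IHB ij ij2.
  - have -> : j = 0%N by nia.
    have -> : Sm 0 0 = 2%:R by rewrite /Sm /symmetrized !muln0 expr0; ring.
    exact: Im2.
  - have -> : j = 0%N by nia.
    have -> : Sm 1 0 = 0 by rewrite /Sm /symmetrized !muln0 addn0 subn0 expr1; ring.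
    exact: Im0.
  - rewrite subSS subSS subn0 in ij2; rewrite -Sm_y2 //.
    by apply: ImM => //; apply: IHN; rewrite // -ltnS ltnW.
case: j jB ij ij2 => [|[|j]] jB ij ij2; first by rewrite muln0 in ij2.
  case: i iN IHB ij ij2 => [|[|[|i]]] iN IHB ij ij2; [nia| | |nia].
    have -> : Sm 1 1 = - (u * v * (V ^+ 2 - U ^+ 2)).
      rewrite /Sm /symmetrized !muln1 expr1 (_ : 2 * n + 1 + 2 * n = 2 * n * 2 + 1)%N; last lia.
      by rewrite addKn !exprD !(exprM _ (2 * n)) -/U -/V; ring.
    exact: ImN.
  have -> : Sm 2 1 = half ^+ 3 * (- ((u * v) ^+ 2 * (U - V) ^+ 4)
      - - ((u * v) ^+ 2 * (U + V) ^+ 4)).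
    transitivity (half ^+ 3 * (8%:R * (u * v) ^+ 2 * (U ^+ 3 * V + U * V ^+ 3))); last by ring.
    have -> : half ^+ 3 * (8%:R * (u * v) ^+ 2 * (U ^+ 3 * V + U * V ^+ 3)) =
        (2%:R * half) ^+ 3 * ((u * v) ^+ 2 * (U ^+ 3 * V + U * V ^+ 3)) by ring.
    rewrite half2 expr1n mul1r /Sm /symmetrized sqrrN expr1n mul1r.
    rewrite (_ : (2 * n + 1) * 2 + 2 * n * 1 = 2 * n * 3 + 2)%N; last lia.
    rewrite (_ : (2 * n + 1) * 2 - 2 * n * 1 = 2 * n + 2)%N; last lia.
    by rewrite !(exprD _ _ 2) !(exprM _ (2 * n) 3) -/U -/V; ring.
  by apply: ImM; [apply: ImX | apply: ImB].
case: i iN IHB ij ij2 => [|i] iN IHB ij ij2; first by nia.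
have [ij1|ij1] := leqP (2 * n * j.+1) ((2 * n + 1) * i).
  rewrite Sm_rec //; apply: ImB; first by apply: IHB; nia.
  by apply: ImM => //; apply: IHN.
have ijE : (2 * n * j.+2 = (2 * n + 1) * i.+1)%N by nia.
have /dvdnP[l lE] : (2 * n %| i.+1)%N.
  rewrite -(@Gauss_dvdr _ (2 * n + 1)); last by rewrite addn1 coprimenS.
  by rewrite -ijE dvdn_mulr.
have jE : (j.+2 = (2 * n + 1) * l)%N.
  by apply/eqP; rewrite -(@eqn_pmul2l (2 * n)) ?muln_gt0 ?n_gt0 // ijE lE; apply/eqP; lia.
rewrite lE mulnC jE; apply: Sm_boundary => [|j' j'l]; first by nia.
rewrite mulnC -lE; apply: IHB; rewrite -?jE in j'l *; nia.
Qed.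

End DihedralInvariants.

(** * The special fibre as a ring of invariants *)

Section Reynolds.
Variables (K : fieldType) (n : nat).
Hypotheses (n_gt0 : (0 < n)%N) (K2 : (2%:R : K) != 0).
Local Notation PP := {poly {poly K}}.
Local Notation N := (4 * n + 2)%N.
Implicit Types (f g h : PP) (w : nat).

(** In [{poly {poly K}}] the outer variable is [v] and the inner one [u], so [i]
    and [j] are the exponents of [v] and [u]. *)
Definition in_lattice w (i j : nat) : bool :=
  ((i + j == w %[mod 2 * N]) && (i == j %[mod 4 * n]))%N.

Definition lattice_part w f : PP :=
  \poly_(i < size f) \poly_(j < size f`_i) (if in_lattice w i j then f`_i`_j else 0).

Lemma coef_lattice_part w f i j :
  (lattice_part w f)`_i`_j = if in_lattice w i j then f`_i`_j else 0.
Proof.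
rewrite coef_poly; case: ltnP => fi; last first.
  by rewrite [f`_i]nth_default // !coef0 if_same.
by rewrite coef_poly; case: ltnP => // fij; rewrite [_`_j]nth_default // if_same.
Qed.

Lemma poly2P f g : (forall i j, f`_i`_j = g`_i`_j) -> f = g.
Proof. by move=> fg; apply/polyP => i; apply/polyP => j. Qed.

Lemma lattice_partB w f g : lattice_part w (f - g) = lattice_part w f - lattice_part w g.
Proof.
by apply: poly2P => i j; rewrite !(coefB, coef_lattice_part); case: ifP; rewrite ?subr0.
Qed.

Lemma lattice_partD w f g : lattice_part w (f + g) = lattice_part w f + lattice_part w g.
Proof.
by apply: poly2P => i j; rewrite !(coefD, coef_lattice_part); case: ifP; rewrite ?addr0.
Qed.

(** [h] is homogeneous of weight [(e, 0)] for the grading of [K[u,v]] by the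
    classes of [i + j] modulo [2N] and of [i - j] modulo [4n].  Phrased through
    multiplication, homogeneity of products needs no computation. *)
Definition lattice_homog e h : Prop :=
  forall w f, lattice_part (w + e) (h * f) = h * lattice_part w f.

Lemma lattice_homogM e e' h h' :
  lattice_homog e h -> lattice_homog e' h' -> lattice_homog (e + e') (h * h').
Proof. by move=> hE hE' w f; rewrite -!mulrA [(e + e')%N]addnC addnA hE hE'. Qed.

Lemma lattice_homogD e h h' :
  lattice_homog e h -> lattice_homog e h' -> lattice_homog e (h + h').
Proof. by move=> hE hE' w f; rewrite !mulrDl lattice_partD hE hE'. Qed.

Lemma lattice_homogX e h k : lattice_homog e h -> lattice_homog (k * e) (h ^+ k).
Proof.
move=> hE; elim: k => [|k IHk]; last by rewrite exprS mulSn; apply: lattice_homogM.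
by move=> w f; rewrite addn0 !mul1r.
Qed.

Lemma lattice_homog_const (c : K) : lattice_homog 0 c%:P%:P.
Proof.
move=> w f; apply: poly2P => i j.
by rewrite addn0 !(coefCM, coef_lattice_part); case: ifP; rewrite ?mulr0.
Qed.

Lemma lattice_homog_monomial p q : (p = q %[mod 4 * n])%N ->
  lattice_homog (p + q) (('X^p)%:P * 'X^q).
Proof.
move=> pq w f; apply: poly2P => i j; rewrite coef_lattice_part -!mulrA !coefCM !coefXnM.
case: (ltnP j p) => pj; first by rewrite if_same.
case: (ltnP i q) => qi; first by rewrite !coef0 if_same.
rewrite coef_lattice_part; congr (if _ then _ else _); rewrite /in_lattice.
have jq : (j - p + q = j %[mod 4 * n])%N by rewrite -modnDmr -pq modnDmr subnK.
congr (_ && _); last by rewrite -(eqn_modDr q (i - q)) subnK // jq.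
rewrite -(eqn_modDr (p + q) (i - q + (j - p))).
by have -> : (i - q + (j - p) + (p + q) = i + j)%N by move: qi pj; clear; lia.
Qed.

Lemma lattice_part_periodic w w' f : (w = w' %[mod 2 * N])%N ->
  lattice_part w f = lattice_part w' f.
Proof.
move=> ww'; apply: poly2P => i j; rewrite !coef_lattice_part.
by rewrite /in_lattice ww'.
Qed.

Definition inv2 : K := 2%:R^-1.

(** The average over the exchange of [u] and [v], applied to the part of [f]
    supported on the lattice.  The exchange is twisted by a sign on the monomials
    of weight [N], because it changes the sign of [a], which has that weight;
    [b], [c] and [d] have weight 0 and are symmetric. *)
Definition reynolds f : PP := inv2%:P%:P *
  (lattice_part 0 f + swapXY (lattice_part 0 f)
   + (lattice_part N f - swapXY (lattice_part N f))).

Lemma reynoldsB f g : reynolds (f - g) = reynolds f - reynolds g.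
Proof.
have swapB (x y : PP) : swapXY (x - y) = swapXY x - swapXY y by exact: raddfB.
by rewrite /reynolds !lattice_partB !swapB; ring.
Qed.

Lemma reynoldsD f g : reynolds (f + g) = reynolds f + reynolds g.
Proof.
have r0 : reynolds 0 = 0 by rewrite -{1}(subrr 0) reynoldsB subrr.
have rN : reynolds (- g) = - reynolds g by rewrite -sub0r reynoldsB r0 sub0r.
by rewrite -{1}[g]opprK reynoldsB rN opprK.
Qed.

Lemma reynolds_even h f : lattice_homog 0 h -> swapXY h = h ->
  reynolds (h * f) = h * reynolds f.
Proof.
move=> hE hs; have swapM x : swapXY (h * x) = h * swapXY x by rewrite rmorphM /= hs.
have hE' w : lattice_part w (h * f) = h * lattice_part w f by rewrite -hE addn0.
by rewrite /reynolds !hE' !swapM; ring.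
Qed.

Lemma reynolds_odd h f : lattice_homog N h -> swapXY h = - h ->
  reynolds (h * f) = h * reynolds f.
Proof.
move=> hE hs; have swapM x : swapXY (h * x) = - h * swapXY x by rewrite rmorphM /= hs.
have E0 : lattice_part 0 (h * f) = h * lattice_part N f.
  by rewrite -hE; apply: lattice_part_periodic; rewrite addnn -mul2n modnn mod0n.
have EN : lattice_part N (h * f) = h * lattice_part 0 f by rewrite -hE.
by rewrite /reynolds E0 EN !swapM; ring.
Qed.

Lemma reynolds1 : reynolds 1 = 1.
Proof.
have E0 : lattice_part 0 1 = 1.
  apply: poly2P => i j; rewrite coef_lattice_part !coef1; case: i => [|i] /=; last first.
    by rewrite coef0 if_same.
  by rewrite coef1; case: j => [|j]; rewrite ?if_same // /in_lattice addn0 !eqxx.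
have EN : lattice_part N 1 = 0.
  apply: poly2P => i j; rewrite coef_lattice_part !coef1 !coef0; case: i => [|i] /=; last first.
    by rewrite coef0 if_same.
  rewrite coef1; case: j => [|j]; rewrite ?if_same // /in_lattice.
  have N2 : (N < 2 * N)%N by lia.
  by rewrite addn0 !mod0n modn_small // [0%N == _]eq_sym addn2.
rewrite /reynolds E0 EN rmorph0 rmorph1 subrr addr0.
have -> : 1 + 1 = (2%:R : K)%:P%:P by rewrite !polyC_natr.
by rewrite -!polyCM mulVf.
Qed.
End Reynolds.

(** Here [Z] stands for [z^m]. *)
Lemma homogenize_param (L : comPzRingType) (n : nat) (u Z q : L) :
  let U := u ^+ (2 * n) in let ZN := Z ^+ (4 * n + 2) in
  let U' := (u * Z) ^+ (2 * n) in let V' := Z ^+ (2 * n) in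
  [/\ u * Z * Z * (V' ^+ 2 - U' ^+ 2) = u * (1 - U ^+ 2) * ZN,
      - ((u * Z * Z) ^+ 2 * (U' + V') ^+ 4) = - (u ^+ 2 * (U + 1) ^+ 4) * ZN ^+ 2,
      - ((u * Z * Z) ^+ 2 * (U' - V') ^+ 4) = - (u ^+ 2 * (U - 1) ^+ 4) * ZN ^+ 2
    & q * (U' + V') ^+ (4 * n + 2) = q * (U + 1) ^+ (4 * n + 2) * ZN ^+ (2 * n)].
Proof.
move=> U ZN U' V'; have UE : U' = U * V' by rewrite /U' exprMn.
have ZE : ZN = V' ^+ 2 * Z ^+ 2 by rewrite /ZN /V' -exprM -exprD; congr (_ ^+ _); lia.
split; try by rewrite UE ZE; ring.
rewrite UE; have -> : U * V' + V' = (U + 1) * V' by ring.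
rewrite exprMn mulrA; congr (_ * _).
by rewrite /V' /ZN -!exprM mulnC.
Qed.

Section SpecialFibre.
Variables (K : fieldType) (m n : nat).
Hypotheses (m_gt0 : (0 < m)%N) (n_gt0 : (0 < n)%N) (K2 : (2%:R : K) != 0).
Local Notation R := (deformation_ring K m n).
Local Notation scal := (deformation_scalar K m n).
Local Notation gen := (defgen K m n).
Local Notation a := (gen 0).
Local Notation b := (gen 1).
Local Notation c := (gen 2).
Local Notation d := (gen 3).
Local Notation t := (gen 4).
Local Notation gm := (grade_map K m_gt0 n_gt0).
Local Notation nzR := (nzdefring K m_gt0 n_gt0).
Local Notation PP := {poly {poly K}}.
Local Notation N := (4 * n + 2)%N.
Local Notation quarter := (quarter K n).
Local Notation Phi0 := (affine_param0 n m_gt0 K2).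
Let Phi0n : {rmorphism nzR -> {poly K}} := affine_param0 n m_gt0 K2.
Let u : PP := 'X%:P.
Let v : PP := 'X.
Let U := u ^+ (2 * n).
Let V := v ^+ (2 * n).

Lemma fibre_param_exists : exists F : {rmorphism R -> PP},
  (forall x, F (scal x) = x%:P%:P) /\
  [/\ F a = u * v * (V ^+ 2 - U ^+ 2), F b = - ((u * v) ^+ 2 * (U + V) ^+ 4),
      F c = - ((u * v) ^+ 2 * (U - V) ^+ 4), F d = quarter%:P%:P * (U + V) ^+ N
    & F t = 0].
Proof.
have xUV : (u * v) ^+ (2 * n) = U * V by rewrite exprMn.
have k4 : 4%:R * quarter%:P%:P = (-1) ^+ n :> PP.
  by rewrite -!polyC_natr -!rmorphM quarterE // !rmorphXn !rmorphN1.
pose w i : PP := nth 0 [:: u * v * (V ^+ 2 - U ^+ 2); - ((u * v) ^+ 2 * (U + V) ^+ 4);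
  - ((u * v) ^+ 2 * (U - V) ^+ 4) - (U - V) ^+ 2 * (U + V) ^+ (2 * m - 2) * 0;
  quarter%:P%:P * (U + V) ^+ N; 0] i.
have w4m : w 4 ^+ m = (U + V) ^+ (2 * m) * 0 by rewrite /w /= mulr0 expr0n gtn_eqF.
have [|||F [FK Fg]] := @defring_lift K m n PP (@polyC _ \o @polyC K) w.
- by rewrite w4m; apply: param12.
- by rewrite w4m; apply: param13.
- exact: param23.
exists F; split; first exact: FK.
by split; rewrite Fg // /w /= mulr0 subr0.
Qed.

(** The map that identifies [R/tR] with the image of [reynolds]; its kernel is
    found in [fibre_param_ker] and its image in [reynolds_image]. *)
Definition fibre_param : {rmorphism R -> PP} := sval (cid fibre_param_exists).
Local Notation Pi := fibre_param.

Lemma fibre_param_scal x : Pi (scal x) = x%:P%:P.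
Proof. by rewrite /fibre_param; case: cid => F [H ?]; apply: H. Qed.

Lemma fibre_paramE :
  [/\ Pi a = u * v * (V ^+ 2 - U ^+ 2), Pi b = - ((u * v) ^+ 2 * (U + V) ^+ 4),
      Pi c = - ((u * v) ^+ 2 * (U - V) ^+ 4), Pi d = quarter%:P%:P * (U + V) ^+ N
    & Pi t = 0].
Proof. by rewrite /fibre_param; case: cid => F [? H]; apply: H. Qed.

(** [fibre_param] is the homogenization of [affine_param0]: substituting [u * z^m]
    and [z^m] for [u] and [v] gives [affine_param0] of the homogeneous
    components, with [z^(N k)] in front of the component of degree [k]. *)
Lemma fibre_param_homogenize : exists eta : {rmorphism PP -> PP},
  forall x, eta (Pi x) = map_poly Phi0n (gm x) \Po 'X^N.
Proof.
have cK : commr_rmorph (@polyC _ \o @polyC K : {rmorphism K -> PP}) ('X%:P * 'X^m).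
  by move=> y; apply: mulrC.
pose eta1 : {rmorphism {poly K} -> PP} := horner_morph cK.
have c1 : commr_rmorph eta1 'X^m by move=> y; apply: mulrC.
pose eta : {rmorphism PP -> PP} := horner_morph c1.
exists eta.
have eta_u : eta u = u * 'X^m by rewrite /eta /= horner_morphC /eta1 /= horner_morphX.
have eta_v : eta v = 'X^m by rewrite /eta /= horner_morphX.
have eta_c x : eta x%:P%:P = x%:P%:P.
  by rewrite /eta /= horner_morphC /eta1 /= horner_morphC.
pose xi : {rmorphism R -> PP} := (comp_poly ('X^N : PP) \o (map_poly Phi0n \o gm)).
suff E : (eta \o Pi : {rmorphism R -> PP}) =1 xi by [].
have xi_gen i : (i < 5)%N -> xi (gen i) = (Phi0 (gen i))%:P * 'X^N ^+ defwt m n i.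
  move=> i5; rewrite /xi /= grade_map_gen // rmorphM /= map_polyC map_polyXn.
  by rewrite comp_polyM comp_polyC comp_Xn_poly.
have [Pa Pb Pc Pd Pt] := fibre_paramE.
have [pa pb pc pd pt] := affine_param0E n m_gt0 K2.
have [Ha Hb Hc Hd] := homogenize_param n u 'X^m quarter%:P%:P.
have ZN0 : 'X^N ^+ defwt m n 0 = 'X^m ^+ N :> PP by rewrite -!exprM mulnC.
have ZN1 : 'X^N ^+ defwt m n 1 = 'X^m ^+ N ^+ 2 :> PP.
  by rewrite -!exprM; congr (_ ^+ _); rewrite /defwt /=; lia.
have ZN2 : 'X^N ^+ defwt m n 2 = 'X^m ^+ N ^+ 2 :> PP by [].
have ZN3 : 'X^N ^+ defwt m n 3 = 'X^m ^+ N ^+ (2 * n) :> PP.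
  by rewrite -!exprM; congr (_ ^+ _); rewrite /defwt /=; lia.
apply: defring_hom_eq => [x|[|[|[|[|[|]]]]] // i5].
- rewrite /xi /= fibre_param_scal eta_c grade_map_scal map_polyC /=.
  by rewrite affine_param_scal /horner_eval hornerC comp_polyC.
- rewrite (xi_gen 0%N) //.
  transitivity (eta (u * v * (V ^+ 2 - U ^+ 2))); first by rewrite -Pa.
  rewrite [Phi0 _]pa !(rmorphM eta) !(rmorphB eta) !(rmorphXn eta) /= eta_u eta_v.
  by rewrite ZN0 Ha !(rmorphM, rmorphB, rmorphXn, rmorph1).
- rewrite (xi_gen 1%N) //.
  transitivity (eta (- ((u * v) ^+ 2 * (U + V) ^+ 4))); first by rewrite -Pb.
  rewrite [Phi0 _]pb (rmorphN eta) (rmorphM eta) !(rmorphXn eta) (rmorphM eta).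
  rewrite (rmorphD eta) !(rmorphXn eta) eta_u eta_v.
  by rewrite ZN1 Hb !(rmorphN, rmorphM, rmorphD, rmorphXn, rmorph1).
- rewrite (xi_gen 2%N) //.
  transitivity (eta (- ((u * v) ^+ 2 * (U - V) ^+ 4))); first by rewrite -Pc.
  rewrite [Phi0 _]pc (rmorphN eta) (rmorphM eta) !(rmorphXn eta) (rmorphM eta).
  rewrite (rmorphB eta) !(rmorphXn eta) eta_u eta_v.
  by rewrite ZN2 Hc !(rmorphN, rmorphM, rmorphB, rmorphXn, rmorph1).
- rewrite (xi_gen 3%N) //.
  transitivity (eta (quarter%:P%:P * (U + V) ^+ N)); first by rewrite -Pd.
  rewrite [Phi0 _]pd (rmorphM eta) (rmorphXn eta) (rmorphD eta) !(rmorphXn eta).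
  rewrite eta_u eta_v eta_c.
  by rewrite ZN3 Hd !(rmorphM, rmorphD, rmorphXn, rmorph1).
- rewrite (xi_gen 4%N) // [Phi0 _]pt mul0r.
  by transitivity (eta 0); [rewrite -Pt | rewrite rmorph0].
Qed.
End SpecialFibre.

Lemma swap_param (L : comNzRingType) (s : {rmorphism L -> L}) (u v : L) (k N : nat) :
  s u = v -> s v = u -> let U := u ^+ k in let V := v ^+ k in
  [/\ s (u * v * (V ^+ 2 - U ^+ 2)) = - (u * v * (V ^+ 2 - U ^+ 2)),
      s (- ((u * v) ^+ 2 * (U + V) ^+ 4)) = - ((u * v) ^+ 2 * (U + V) ^+ 4),
      s (- ((u * v) ^+ 2 * (U - V) ^+ 4)) = - ((u * v) ^+ 2 * (U - V) ^+ 4)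
    & s ((U + V) ^+ N) = (U + V) ^+ N].
Proof.
move=> su sv U V.
have sU : s U = V by rewrite /U rmorphXn su.
have sV : s V = U by rewrite /V rmorphXn sv.
have suv : s (u * v) = u * v by rewrite rmorphM su sv mulrC.
clearbody U V; split.
- by rewrite rmorphM suv rmorphB !rmorphXn sU sV; ring.
- by rewrite rmorphN rmorphM !rmorphXn suv rmorphD sU sV [V + U]addrC.
- by rewrite rmorphN rmorphM !rmorphXn suv rmorphB sU sV; ring.
- by rewrite rmorphXn rmorphD sU sV addrC.
Qed.

Section FibreInvariants.
Variables (K : fieldType) (m n : nat).
Hypotheses (m_gt0 : (0 < m)%N) (n_gt0 : (0 < n)%N) (K2 : (2%:R : K) != 0).
Local Notation R := (deformation_ring K m n).
Local Notation scal := (deformation_scalar K m n).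
Local Notation gen := (defgen K m n).
Local Notation a := (gen 0).
Local Notation b := (gen 1).
Local Notation c := (gen 2).
Local Notation d := (gen 3).
Local Notation t := (gen 4).
Local Notation gm := (grade_map K m_gt0 n_gt0).
Local Notation nzR := (nzdefring K m_gt0 n_gt0).
Local Notation PP := {poly {poly K}}.
Local Notation N := (4 * n + 2)%N.
Local Notation quarter := (quarter K n).
Local Notation inv2 := (inv2 K).
Local Notation Pi := (fibre_param n m_gt0 K2).
Let u : PP := 'X%:P.
Let v : PP := 'X.
Let U := u ^+ (2 * n).
Let V := v ^+ (2 * n).

Lemma fibre_param_ker x : Pi x = 0 -> exists y, x = t * y.
Proof.
move=> Pix; have [eta etaE] := fibre_param_homogenize m_gt0 n_gt0 K2.
have comp k : exists y : R, (gm x)`_k = t * y.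
  apply: (@affine_param0_ker K m n m_gt0 n_gt0 K2 k); first exact: gr_grade_map.
  have := congr1 (fun f : PP => f`_(k * N)) (etaE x); rewrite Pix (rmorph0 eta) coef0.
  rewrite coef_comp_poly_Xn ?addn2 // dvdn_mull // mulnK // coef_map /=.
  by move/esym.
have [y yE] := choice comp.
exists (\sum_(k < size (gm x)) y k).
rewrite {1}(grade_map_sum m_gt0 n_gt0 x) mulr_sumr.
by apply: eq_bigr => k _; apply: yE.
Qed.

Let uE p : u ^+ p = ('X^p)%:P. Proof. by rewrite /u -rmorphXn. Qed.
Let swap_u : swapXY u = v. Proof. exact: swapXY_Y. Qed.
Let swap_v : swapXY v = u. Proof. exact: swapXY_X. Qed.
Let swap_c (x : K) : swapXY x%:P%:P = x%:P%:P.
Proof. by rewrite swapXY_polyC map_polyC. Qed.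

Let homog_uv p q : (p = q %[mod 4 * n])%N -> lattice_homog n (p + q) (u ^+ p * v ^+ q).
Proof. by move=> pq; rewrite uE; apply: lattice_homog_monomial. Qed.

Let homog_c e h (x : K) : lattice_homog n e h -> lattice_homog n e (x%:P%:P * h).
Proof. by move=> hE; rewrite -[e]add0n; apply: lattice_homogM hE; apply: lattice_homog_const. Qed.

Let homog_square (x : K) : lattice_homog n (4 * n) (U ^+ 2 + x%:P%:P * (U * V) + V ^+ 2).
Proof.
have E2 : (2 * n * 2 = 4 * n)%N by lia.
apply: lattice_homogD; first apply: lattice_homogD.
- rewrite /U -exprM E2 -[u ^+ _]mulr1 -(expr0 v) -{1}[(4 * n)%N]addn0.
  by apply: homog_uv; rewrite modnn mod0n.
- apply: homog_c; rewrite (_ : (4 * n = 2 * n + 2 * n)%N); last by lia.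
  exact: homog_uv.
- rewrite /V -exprM E2 -[v ^+ _]mul1r -(expr0 u) -{1}[(4 * n)%N]add0n.
  by apply: homog_uv; rewrite modnn mod0n.
Qed.

Let homog_periodic k (h : PP) : lattice_homog n (k * (2 * N)) h -> lattice_homog n 0 h.
Proof.
move=> hE w f; rewrite -hE; apply: lattice_part_periodic.
by rewrite addn0 -modnDmr modnMl addn0.
Qed.

(** It is enough to treat the generators.  [b], [c] and [d] are symmetric of weight
    0 and [a] is antisymmetric of weight [N]; the weights are read off from
    [(U + V)^2] and [(U - V)^2], which are homogeneous while [U + V] is not. *)
Lemma reynolds_linear x f : reynolds n (Pi x * f) = Pi x * reynolds n f.
Proof.
have [Pa Pb Pc Pd Pt] := fibre_paramE n m_gt0 K2.
have sq1 : (U + V) ^+ 2 = U ^+ 2 + 2%:R%:P%:P * (U * V) + V ^+ 2.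
  by rewrite !polyC_natr; ring.
have sq2 : (U - V) ^+ 2 = U ^+ 2 + (- 2%:R)%:P%:P * (U * V) + V ^+ 2.
  by rewrite !polyCN !polyC_natr; ring.
have neg y : - y = (- 1)%:P%:P * y :> PP by rewrite !polyCN mulN1r.
have [swap_a swap_b swap_c' swap_d] := swap_param (2 * n) N swap_u swap_v.
have homog_11 : lattice_homog n (1 + 1) (u * v).
  by have := @homog_uv 1 1 erefl; rewrite !expr1.
have homog_bc (e : K) : lattice_homog n (1 * (2 * N))
    (- ((u * v) ^+ 2 * (U ^+ 2 + e%:P%:P * (U * V) + V ^+ 2) ^+ 2)).
  rewrite neg; apply: homog_c.
  rewrite (_ : 1 * (2 * N) = 2 * (1 + 1) + 2 * (4 * n))%N; last by lia.
  apply: lattice_homogM; apply: lattice_homogX; last exact: homog_square.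
  exact: homog_11.
elim/defring_ind: x f => [x f|f|f|f|f|f|x y Hx Hy f|x y Hx Hy f].
- rewrite fibre_param_scal; apply: reynolds_even; last exact: swap_c.
  exact: lattice_homog_const.
- rewrite Pa; apply: reynolds_odd; last exact: swap_a.
  rewrite [(4 * n + 2)%N]addnC; apply: lattice_homogM; first exact: homog_11.
  have -> : V ^+ 2 - U ^+ 2 = V ^+ 2 + (-1)%:P%:P * U ^+ 2 by rewrite -neg.
  have E2 : (2 * n * 2 = 4 * n)%N by lia.
  apply: lattice_homogD; last apply: homog_c.
    rewrite /V -exprM E2 -[v ^+ _]mul1r -(expr0 u) -{1}[(4 * n)%N]add0n.
    by apply: homog_uv; rewrite modnn mod0n.
  rewrite /U -exprM E2 -[u ^+ _]mulr1 -(expr0 v) -{1}[(4 * n)%N]addn0.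
  by apply: homog_uv; rewrite modnn mod0n.
- rewrite Pb; apply: reynolds_even; last exact: swap_b.
  by rewrite -[4%N]/(2 * 2)%N exprM sq1; apply: (homog_periodic (k := 1)); apply: homog_bc.
- rewrite Pc; apply: reynolds_even; last exact: swap_c'.
  by rewrite -[4%N]/(2 * 2)%N exprM sq2; apply: (homog_periodic (k := 1)); apply: homog_bc.
- rewrite Pd; apply: reynolds_even.
    apply: (homog_periodic (k := n)); apply: homog_c.
    rewrite (_ : N = 2 * (2 * n + 1))%N ?(exprM (U + V) 2) ?sq1; last by lia.
    rewrite (_ : n * (2 * (2 * (2 * n + 1))) = (2 * n + 1) * (4 * n))%N; last by lia.
    by apply: lattice_homogX; apply: homog_square.
  by rewrite (rmorphM swapXY) [X in X * _ = _]swap_c; congr (_ * _); apply: swap_d.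
- rewrite Pt !mul0r /reynolds -(subrr 1) !lattice_partB !subrr.
  by rewrite rmorph0 subrr !addr0 mulr0.
- by rewrite rmorphD !mulrDl reynoldsD Hx Hy.
- by rewrite rmorphM -!mulrA Hx Hy.
Qed.

Lemma lattice_part_monomial w p q : lattice_part n w (u ^+ p * v ^+ q) =
  if in_lattice n w q p then u ^+ p * v ^+ q else 0.
Proof.
apply: poly2P => i j; rewrite coef_lattice_part.
have E k l : (u ^+ p * v ^+ q)`_k`_l = ((k == q) && (l == p))%:R.
  rewrite uE coefCM coefXn; case: eqP => _; last by rewrite mulr0 coef0.
  by rewrite mulr1 coefXn.
have [-> | iq] := eqVneq i q; last first.
  by case: ifP; case: ifP => // _ _; rewrite !(coef0, E, negPf iq).
have [-> | jp] := eqVneq j p; last first.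
  by case: ifP; case: ifP => // _ _; rewrite !(coef0, E, negPf jp, andbF).
by case: ifP; rewrite ?coef0.
Qed.

(* A lattice monomial of degree [i] has the exponents
   [(2n+1) i + 2n j] and [(2n+1) i - 2n j] up to exchange. *)
Let symmetrized_param i p q : (p + q = i * N)%N -> (p = q %[mod 4 * n])%N ->
  exists x, Pi x = symmetrized u v i p q.
Proof.
have [Pa Pb Pc Pd Pt] := fibre_paramE n m_gt0 K2.
pose Im := [set y | exists x, Pi x = y].
have ImB y z : Im y -> Im z -> Im (y - z).
  by move=> [x1 <-] [x2 <-]; exists (x1 - x2); rewrite rmorphB.
have ImM y z : Im y -> Im z -> Im (y * z).
  by move=> [x1 <-] [x2 <-]; exists (x1 * x2); rewrite rmorphM.
have Imc x : Im x%:P%:P by exists (scal x); apply: fibre_param_scal.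
have half2 : 2%:R * inv2%:P%:P = 1 :> PP.
  by rewrite -!polyC_natr -!polyCM mulfV.
have Imd : Im ((U + V) ^+ N).
  have -> : (U + V) ^+ N = quarter^-1%:P%:P * (quarter%:P%:P * (U + V) ^+ N).
    by rewrite mulrA -!polyCM mulVf ?mul1r // quarter_neq0.
  by apply: (ImM) => //; exists d.
have Im_sym := symmetrized_image n_gt0 half2 ImB ImM (Imc inv2)
  (ex_intro _ _ Pa) (ex_intro _ _ Pb) (ex_intro _ _ Pc) Imd.
have aux p' q' : (q' <= p')%N -> (p' + q' = i * N)%N -> (p' = q' %[mod 4 * n])%N ->
    Im (symmetrized u v i p' q').
  move=> qp pqE /eqP; rewrite eqn_mod_dvd // => /dvdnP[j jE].
  have ij : (2 * n * j <= (2 * n + 1) * i)%N by nia.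
  have -> : p' = ((2 * n + 1) * i + 2 * n * j)%N by lia.
  have -> : q' = ((2 * n + 1) * i - 2 * n * j)%N by lia.
  exact: Im_sym.
move=> pqE pq; have [qp|/ltnW qp] := leqP q p; first exact: aux.
have -> : symmetrized u v i p q = ((-1) ^+ i)%:P%:P * symmetrized u v i q p.
  have sE : ((-1) ^+ i)%:P%:P = (-1) ^+ i :> PP by rewrite !(rmorphXn, rmorphN1).
  have ss : (-1) ^+ i * (-1) ^+ i = 1 :> PP by rewrite -exprMn mulrNN mulr1 expr1n.
  have inv_s (s y z : PP) : s * s = 1 -> y + s * z = s * (z + s * y).
    by move=> s1; rewrite mulrDr mulrA s1 mul1r addrC.
  by rewrite /symmetrized sE; apply: inv_s.
by apply: ImM => //; apply: aux; rewrite // addnC.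
Qed.

Let reynolds_monomial_image p q : exists x, Pi x = reynolds n (u ^+ p * v ^+ q).
Proof.
have swapE : swapXY (u ^+ p * v ^+ q) = u ^+ q * v ^+ p.
  rewrite (rmorphM swapXY) (rmorphXn swapXY) (rmorphXn swapXY).
  by rewrite /= swap_u swap_v mulrC.
rewrite /reynolds !lattice_part_monomial.
have [/andP[/dvdnP[i pqE] pq]|no] := boolP ((N %| q + p)%N && (q == p %[mod 4 * n])%N).
  have in0 : in_lattice n 0 q p = ~~ odd i.
    rewrite /in_lattice pq andbT mod0n pqE -/(dvdn _ _) dvdn_pmul2r ?addn2 //.
    by rewrite dvdn2.
  have inN : in_lattice n N q p = odd i.
    have E k : (k * N %% (2 * N) = k %% 2 * N)%N by rewrite muln_modl.
    have E1 := E 1%N; rewrite mul1n in E1.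
    by rewrite /in_lattice pq andbT pqE E E1 -[X in _ == X]mul1n eqn_pmul2r ?addn2 // !modn2; case: odd.
  have [|x xE] := @symmetrized_param i p q _ (esym (eqP pq)); first by rewrite addnC.
  exists (scal inv2 * x); rewrite rmorphM fibre_param_scal xE; congr (_ * _).
  rewrite in0 inN /symmetrized -signr_odd; case: odd => /=; rewrite !rmorph0 swapE.
    by rewrite expr1 mulN1r !add0r.
  by rewrite expr0 mul1r subrr addr0.
have in0 : in_lattice n 0 q p = false.
  apply: contraNF no => /andP[pqN ->]; rewrite andbT.
  by apply: dvdn_trans (dvdn_mull 2 (dvdnn N)) _; rewrite /dvdn (eqP pqN) mod0n.
have inN : in_lattice n N q p = false.
  apply: contraNF no => /andP[/eqP pqN ->]; rewrite andbT.
  have N2 : (N < 2 * N)%N by clear; lia.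
  rewrite (divn_eq (q + p) (2 * N)) pqN modn_small // dvdn_addl ?dvdnn //.
  by rewrite mulnA dvdn_mull.
by exists 0; rewrite in0 inN !rmorph0 subrr !addr0 mulr0.
Qed.

Lemma reynolds_image f : exists x, Pi x = reynolds n f.
Proof.
have -> : f = \sum_(i < size f) \sum_(j < size f`_i) (f`_i`_j)%:P%:P * (u ^+ j * v ^+ i).
  rewrite -{1}[f]coefK poly_def; apply: eq_bigr => i _.
  rewrite -mul_polyC -{1}[f`_i]coefK poly_def rmorph_sum mulr_suml.
  by apply: eq_bigr => j _; rewrite -mul_polyC uE rmorphM -mulrA.
pose Im := [set y | exists x, Pi x = y].
suff : Im (reynolds n (\sum_(i < size f) \sum_(j < size f`_i)
  (f`_i`_j)%:P%:P * (u ^+ j * v ^+ i))) by [].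
have ImD y z : Im y -> Im z -> Im (y + z).
  by move=> [x1 <-] [x2 <-]; exists (x1 + x2); rewrite rmorphD.
have Im0 : Im 0 by exists 0; rewrite rmorph0.
rewrite (morphB_sum _ _ (@reynoldsB K n)); apply: (big_ind Im) => // i _.
rewrite (morphB_sum _ _ (@reynoldsB K n)); apply: (big_ind Im) => // j _.
have [x xE] := reynolds_monomial_image j i; exists (scal f`_i`_j * x).
by rewrite rmorphM xE -reynolds_linear fibre_param_scal.
Qed.

(** Lifting [reynolds f] along [fibre_param] is a retraction of [K[u,v]] onto
    [R/tR]. *)
Lemma special_fibre_F_regular p : p \in [pchar K] -> F_regular p (ring_quot [set t]).
Proof.
move=> charKp; pose S : comPzRingType := ring_quot [set t].
have charK : has_pchar p K by move: charKp => /andP[p_pr /eqP].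
have p_pr := charK.1.
have Pit x : [set t] x -> Pi x = 0 by move=> ->; have [_ _ _ _ ->] := fibre_paramE n m_gt0 K2.
pose phi : {rmorphism S -> PP} := quot_lift Pit.
have phiE x : phi (quot_map [set t] x) = Pi x by exact: quot_liftE.
have phi_inj : injective phi.
  move=> y z /eqP; rewrite -subr_eq0 -rmorphB => /eqP yz.
  apply/eqP; rewrite -subr_eq0; apply/eqP; move: yz.
  have [x <-] := quot_map_surj (y - z); rewrite phiE => /fibre_param_ker[w ->].
  have qt : quot_map [set t] t = 0.
    rewrite -(rmorph0 (quot_map [set t])); apply/quot_map_eq; rewrite subr0.
    exact: sub_ideal_gen.
  transitivity (quot_map [set t] t * quot_map [set t] w); first exact: rmorphM.
  by rewrite qt; apply: mul0r.
have charS : has_pchar p S.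
  split=> //; apply: phi_inj; rewrite rmorph_nat rmorph0 -!polyC_natr.
  by rewrite [p%:R : K]charK.2.
have rho_ex f : exists s : S, phi s = reynolds n f.
  by have [x xE] := reynolds_image f; exists (quot_map _ x); rewrite phiE.
have [rho rhoE] := choice rho_ex.
apply: strongly_F_regular_F_regular => //.
- move=> x y xy0; have /eqP : phi x * phi y = 0 by rewrite -rmorphM xy0 rmorph0.
  by rewrite mulf_eq0 => /orP[] /eqP xy; [left|right]; apply: phi_inj; rewrite xy rmorph0.
- apply: (@noetherian_surj R S (quot_map [set t])); first exact: quot_map_surj.
  have [_ _ _ _ [xs genR]] := defring_N_graded K m_gt0 n_gt0.
  exact: (@noetherian_fg K nzR scal xs genR).
- apply: (strongly_F_regular_summand (f := phi) (rho := rho)) => //.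
  + by move=> x y; apply: phi_inj; rewrite rmorphB !rhoE reynoldsB.
  + move=> s y; apply: phi_inj; rewrite rmorphM !rhoE.
    by have [x <-] := quot_map_surj s; rewrite phiE reynolds_linear.
  + by apply: phi_inj; rewrite rhoE reynolds1 // rmorph1.
  + apply: strongly_F_regular_poly; last apply: strongly_F_regular_poly => //.
      by split=> //; rewrite -polyC_natr charK.2.
    exact: strongly_F_regular_field.
Qed.

End FibreInvariants.

(** * Failure of F-regularity and F-purity *)

Lemma slope_condition (m n : nat) : (0 < n)%N ->
  2 < (m%:R - m%:R / n%:R : rat) -> (2 * n + m < n * m)%N.
Proof.
move=> n_gt0 mn; have n0 : (0 : rat) < n%:R by rewrite Num.Theory.ltr0n.
move: mn; rewrite -(Num.Theory.ltr_pM2r n0) mulrBl divfK ?Num.Theory.lt0r_neq0 //.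
by rewrite Num.Theory.ltrBrDr -!natrM -natrD Num.Theory.ltr_nat [(m * n)%N]mulnC.
Qed.

(** Multiplied by [2m], the second bound reads
    [q * (n m - m - 2n) >= m n + m - 2n] up to rounding. *)
Lemma exponent_bounds (m n q : nat) : (0 < m)%N -> (2 * n + m < n * m)%N ->
  (m * n + m <= q)%N ->
  let M := ((m - 1) * q %/ m)%N in
  (uphalf q <= M)%N /\ (uphalf q <= n * (M.+1 - uphalf q))%N.
Proof.
move=> m_gt0 mn mnq M; set h := uphalf q.
have h2 : (2 * h <= q + 1)%N by rewrite /h; lia.
have h_gt0 : (0 < h)%N by rewrite /h; lia.
have Mub : ((m - 1) * q < m * M + m)%N.
  by rewrite {1}(divn_eq ((m - 1) * q) m) mulnC ltn_add2l ltn_mod.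
clearbody M h.
have key : (h * n.+1 <= n * M.+1)%N.
  rewrite -(@leq_pmul2l (2 * m)) ?muln_gt0 //.
  have e1 : (2 * n * ((m - 1) * q).+1 <= 2 * n * (m * M + m))%N by rewrite leq_mul2l Mub orbT.
  have e2 : ((m * n + m) * (2 * h) <= (m * n + m) * (q + 1))%N by rewrite leq_mul2l h2 orbT.
  have e3 : ((2 * n + m).+1 * q <= n * m * q)%N by rewrite leq_mul2r mn orbT.
  have e4 : (n * ((m - 1) * q) + n * q = n * m * q)%N.
    by rewrite -mulnDr -mulSnr subn1 prednK // mulnA.
  by move: e1 e2 e3 e4 mnq; move: ((m - 1) * q)%N => Z; clear; lia.
have hM : (h <= M)%N by nia.
by split=> //; rewrite mulnBr leq_subRL; nia.
Qed.

Section NotFPure.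
Variables (K : fieldType) (p m n : nat).
Hypotheses (charKp : p \in [pchar K]) (m_gt0 : (0 < m)%N) (n_gt0 : (0 < n)%N).
Hypothesis mn : (2 * n + m < n * m)%N.
Local Notation R := (deformation_ring K m n).
Local Notation gen := (defgen K m n).
Local Notation a := (gen 0).
Local Notation b := (gen 1).
Local Notation c := (gen 2).
Local Notation d := (gen 3).
Local Notation t := (gen 4).

Lemma defring_pchar : has_pchar p R.
Proof.
have [p_pr /eqP p0] := andP charKp; split=> //.
by rewrite -(rmorph_nat (deformation_scalar K m n)) p0 rmorph0.
Qed.

(** Setting [a = c = d = 0] turns the relations into [t^m b^n] and [b^(n+1)], so
    the coefficient of [b^n t^(m-1)] is not affected. *)
Lemma critical_notin : ~ ideal_gen [set` [:: a; d]] (b ^+ n * t ^+ m.-1).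
Proof.
pose X := minors (deformation_matrix K m n) 2.
pose w (i : nat) : {poly {poly K}} := nth 0 [:: 0; 'X; 0; 0; 'X%:P] i.
pose f : {rmorphism {mpoly K[5]} -> {poly {poly K}}} :=
  mmap (@polyC _ \o @polyC K : {rmorphism K -> {poly {poly K}}}) (fun i : 'I_5 => w i).
have fX i : (i < 5)%N -> f 'X_(inord i) = w i.
  by move=> i5; rewrite /f /= mmapX mmap1U inordK.
pose J := [set g : {poly {poly K}} | forall i j, (i <= n)%N -> (j < m)%N -> g`_i`_j = 0].
have idJ : is_ideal J.
  split=> [i j|g h Jg Jh i j i_n jm|h g Jg i j i_n jm]; first by rewrite !coef0.
    by rewrite !coefD Jg // Jh // addr0.
  rewrite coefM coef_sum big1 // => k _; rewrite coefM big1 // => l _.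
  rewrite (Jg (i - k)%N (j - l)%N) ?mulr0 //.
    exact: leq_trans (leq_subr _ _) i_n.
  exact: leq_ltn_trans (leq_subr _ _) jm.
have XJ : ideal_gen X `<=` f @^-1` J.
  apply: ideal_gen_sub; first exact: is_ideal_preim.
  move=> x /deformation_minorsP xE; rewrite /preimage /=.
  have [_ _ JM] := idJ.
  case: xE => ->; rewrite ?/minor12 ?/minor13 ?/minor23 rmorphB.
  - rewrite !(rmorphM, rmorphD, rmorphXn) !fX // /w /= !mulr0 subrr.
    by case: idJ.
  - rewrite !(rmorphM, rmorphB, rmorphD, rmorphXn) !fX // /w /=.
    rewrite !mul0r add0r !subr0 => i j i_n jm.
    by rewrite -rmorphXn /= coefCM coefXn coefXnM jm.
  - rewrite !(rmorphM, rmorphB, rmorphXn) !fX // /w /= !mul0r !subr0 -exprS.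
    by move=> i j i_n jm; rewrite coefXn ltn_eqF ?ltnS // coef0.
move=> /ideal_gen_seqP[h]; rewrite /= !big_ord_recr big_ord0 /= add0r.
have [[h0 <-] [h1 <-]] := (quot_map_surj (h 0%N), quot_map_surj (h 1%N)).
rewrite /defgen -!rmorphXn -!rmorphM -rmorphD => /quot_map_eq /XJ.
rewrite /preimage /= rmorphB rmorphD !rmorphM !rmorphXn !fX // /w /= !mulr0 addr0 subr0.
move/(_ n m.-1 (leqnn _)); rewrite -rmorphXn /= mulrC coefCM coefXn eqxx mulr1 coefXn eqxx.
by rewrite prednK // => /(_ (leqnn _)) /eqP; rewrite oner_eq0.
Qed.

(** [t^((m-1)q)] is a multiple of [(t^m)^M], and [b^(nq) = (b^n - d)^q + d^q]. *)
Lemma critical_frobenius e : (m * n + m <= p ^ e)%N ->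
  ideal_gen [set` [:: a ^+ (p ^ e); d ^+ (p ^ e)]] ((b ^+ n * t ^+ m.-1) ^+ (p ^ e)).
Proof.
set q := (p ^ e)%N => mnq; pose J := ideal_gen [set` [:: a ^+ q; d ^+ q]].
have idJ : is_ideal J := ideal_gen_ideal _; have [_ JD JM] := idJ.
have [hM hn] := exponent_bounds m_gt0 mn mnq.
set M := (_ %/ m)%N in hM hn; set h := uphalf q in hM hn.
have Ja : J ((a ^+ 2) ^+ h).
  have -> : (a ^+ 2) ^+ h = a ^+ (2 * h - q) * a ^+ q.
    by rewrite -exprM -exprD subnK // /h; lia.
  by apply: JM; apply: sub_ideal_gen; rewrite /= inE eqxx.
have Jd : J (d ^+ q) by apply: sub_ideal_gen; rewrite /= !inE eqxx orbT.
have r13 : (a ^+ 2 + t ^+ m) * (b ^+ n - d) = c * d by rewrite defrel13 mulrC.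
have r23 : b * (b ^+ n - d) = a ^+ 2 * d by rewrite defrel23 mulrC.
have bnE : b ^+ n = b ^+ n - d + d by rewrite subrK.
have hq : (h <= q)%N by rewrite /h; lia.
have := @frobenius_membership R (a ^+ 2) (t ^+ m) b c d (b ^+ n - d) n r13 r23 bnE
  J M h q idJ Ja Jd hM hn 0 q 0.
rewrite !subn0 subnn !expr0 mul1r !mulr1 => /(_ isT hq (leqnn _) isT) Jg.
have tM : t ^+ (m.-1 * q) = t ^+ m ^+ M * t ^+ (m.-1 * q - m * M).
  by rewrite -exprM -exprD subnKC // -subn1 mulnC leq_trunc_div.
have bq : (b ^+ n) ^+ q = (b ^+ n - d) ^+ q + d ^+ q.
  by rewrite -(exprDpe defring_pchar) subrK.
rewrite exprMn -(exprM t) tM bq mulrDl; apply: JD; last by rewrite mulrC; apply: JM.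
by rewrite mulrA mulrC [_ * t ^+ m ^+ M]mulrC; apply: JM.
Qed.

Lemma not_F_regular : ~ F_regular p R.
Proof.
move=> Freg; have W1 : multiplicative_set [set (1 : R)].
  by split=> // x y /= -> ->; rewrite mulr1.
have loc : is_localization [set (1 : R)] (idfun : {rmorphism R -> R}).
  split=> [w ->|x|x /= ->]; first by exists 1; rewrite mulr1.
    by exists x, 1; rewrite /= mulr1.
  by exists 1; rewrite //= mulr0.
have idI := ideal_gen_ideal [set` [:: a; d]].
apply: critical_notin; rewrite (Freg _ _ _ W1 loc _ idI).
exists 1; first by case=> P [[_ P1 _] _]; apply: P1.
exists (m * n + m)%N => e e_ge; rewrite mul1r; exists [:: a; d] => //.
apply: critical_frobenius; apply: (leq_trans e_ge).
by rewrite ltnW // ltn_expl // prime_gt1 // (charf_prime charKp).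
Qed.

Lemma not_F_pure : ~ F_pure p R.
Proof.
move=> Fpure; apply: critical_notin.
have mnp : (m * n + m <= p ^ (m * n + m))%N.
  by rewrite ltnW // ltn_expl // prime_gt1 // (charf_prime charKp).
have /ideal_gen_seqP[h] := critical_frobenius mnp.
rewrite /= !big_ord_recr big_ord0 /= add0r.
exact: F_pure_contracted_pe defring_pchar Fpure.
Qed.

End NotFPure.

(** * Krull dimension *)

Section LinearSpan.
Variables (K : fieldType) (R : comPzRingType) (iota : {rmorphism K -> R}).

Definition lin_span (J : finType) (g : J -> R) : set R :=
  [set x | exists c : J -> K, x = \sum_j iota (c j) * g j].

Lemma lin_span_gen (J : finType) (g : J -> R) j : lin_span g (g j).
Proof.
exists (fun i => (i == j)%:R); rewrite (bigD1 j) //= eqxx rmorph1 mul1r big1 ?addr0 //.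
by move=> i /negPf ->; rewrite rmorph0 mul0r.
Qed.

Lemma lin_span0 (J : finType) (g : J -> R) : lin_span g 0.
Proof. by exists (fun=> 0); rewrite big1 // => j _; rewrite rmorph0 mul0r. Qed.

Lemma lin_spanD (J : finType) (g : J -> R) x y :
  lin_span g x -> lin_span g y -> lin_span g (x + y).
Proof.
move=> [c ->] [c' ->]; exists (fun j => c j + c' j); rewrite -big_split.
by apply: eq_bigr => j _; rewrite rmorphD mulrDl.
Qed.

Lemma lin_spanZ (J : finType) (g : J -> R) k x :
  lin_span g x -> lin_span g (iota k * x).
Proof.
move=> [c ->]; exists (fun j => k * c j); rewrite mulr_sumr.
by apply: eq_bigr => j _; rewrite rmorphM mulrA.
Qed.

Lemma lin_span_sum (J : finType) (g : J -> R) (I : Type) (r : seq I) (F : I -> R) :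
  (forall i, lin_span g (F i)) -> lin_span g (\sum_(i <- r) F i).
Proof.
by move=> gF; apply: big_ind => //; [exact: lin_span0 | exact: lin_spanD].
Qed.

Lemma lin_spanM (J J' : finType) (g : J -> R) (g' : J' -> R) y x :
  (forall j, lin_span g' (y * g j)) -> lin_span g x -> lin_span g' (y * x).
Proof.
move=> gg' [c ->]; rewrite mulr_sumr; apply: lin_span_sum => j.
by rewrite mulrCA; apply: lin_spanZ.
Qed.

Lemma lin_span_dependent (I J : finType) (f : I -> R) (g : J -> R) :
  (#|J| < #|I|)%N -> (forall i, lin_span g (f i)) ->
  exists2 c : I -> K, \sum_i iota (c i) * f i = 0 & exists i, c i != 0.
Proof.
move=> JI /choice[G GE].
pose A := \matrix_(i < #|I|, j < #|J|) G (enum_val i) (enum_val j).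
have : kermx A != 0.
  rewrite -mxrank_eq0 mxrank_ker subn_eq0 -ltnNge.
  exact: leq_ltn_trans (rank_leq_col A) JI.
case/rowV0Pn => w /sub_kermxP wA /rV0Pn[i0 wi0].
exists (fun i => w 0 (enum_rank i)); last by exists (enum_val i0); rewrite enum_valK.
transitivity (\sum_j iota (\sum_i w 0 (enum_rank i) * G i j) * g j).
  rewrite (eq_bigr (fun i => \sum_j iota (w 0 (enum_rank i) * G i j) * g j)).
    rewrite exchange_big; apply: eq_bigr => j _.
    by rewrite rmorph_sum mulr_suml.
  by move=> i _; rewrite GE mulr_sumr; apply: eq_bigr => j _; rewrite rmorphM mulrA.
apply: big1 => j _; rewrite (_ : \sum_i _ = 0) ?rmorph0 ?mul0r //.
have wj : \sum_i w 0 i * A i (enum_rank j) = 0.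
  by have := congr1 (fun B : 'rV_#|J| => B 0 (enum_rank j)) wA; rewrite !mxE.
rewrite -[RHS]wj (reindex (enum_val : 'I_#|I| -> I)) /=; last exact/onW_bij/enum_val_bij.
by apply: eq_bigr => i _; rewrite !mxE enum_valK enum_rankK.
Qed.

End LinearSpan.

Section KrullDimension.
Variables (K : fieldType) (R : comPzRingType) (iota : {rmorphism K -> R}).

Fixpoint multi_index (N d : nat) : finType :=
  if d is d'.+1 then ('I_N * multi_index N d')%type else unit.

Lemma card_multi_index N d : #|multi_index N d| = (N ^ d)%N.
Proof.
by elim: d => [|d IHd]; rewrite ?card_unit //= card_prod card_ord IHd expnS.
Qed.

Fixpoint chain_monomial N d (x : nat -> R) : multi_index N d -> R :=
  if d is d'.+1 return multi_index N d -> R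
  then fun s => x 0%N ^+ s.1 * chain_monomial (fun i => x i.+1) s.2 else fun=> 1.

(** If [x i] lies in [P i.+1] but not in [P i], the monomials in the [x i] are
    linearly independent: the lexicographically least term of a relation could
    be divided by powers of the [x i] to yield a nonzero constant in a prime. *)
Lemma chain_independent N d (P : nat -> set R) (x : nat -> R) :
  (forall i, (i <= d)%N -> is_prime (P i)) ->
  (forall i, (i < d)%N -> P i `<=` P i.+1 /\ P i.+1 (x i) /\ ~ P i (x i)) ->
  forall c : multi_index N d -> K,
  P 0%N (\sum_s iota (c s) * chain_monomial x s) -> forall s, c s = 0.
Proof.
elim: d P x => [|d IHd] P x Pprime Px c.
  rewrite /= (bigD1 tt) //= big1 => [|[] //]; rewrite addr0 mulr1 => Pc [].
  apply/eqP; apply: contraT => c0; have [[_ _ PM] P1 _] := Pprime 0%N isT.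
  by case: P1; rewrite -(rmorph1 iota) -(mulVf c0) rmorphM; apply: PM.
have [[_ _ PM0] _ Pm0] := Pprime 0%N isT.
have [[P10 PD1 PM1] _ _] := Pprime 1%N isT.
have [P01 [P1x P0x]] := Px 0%N isT.
pose g (k : nat) := if insub k is Some k' then
  \sum_s iota (c (k' : 'I_N, s)) * chain_monomial (fun i => x i.+1) s else 0.
have gE (k : 'I_N) : g k = \sum_s iota (c (k, s)) * chain_monomial (fun i => x i.+1) s.
  by rewrite /g valK.
have IHg (k : 'I_N) : P 1%N (g k) -> forall s, c (k, s) = 0.
  rewrite gE; apply: (IHd (fun i => P i.+1) (fun i => x i.+1)) => i id;
  by [apply: Pprime | apply: Px].
have -> : \sum_s iota (c s) * chain_monomial x s = \sum_(k < N) x 0%N ^+ k * g k.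
  transitivity (\sum_(k < N) \sum_(s : multi_index N d)
    iota (c (k, s)) * (x 0%N ^+ k * chain_monomial (fun i => x i.+1) s)).
    by rewrite pair_bigA; apply: eq_bigr => -[k s] _.
  by apply: eq_bigr => k _; rewrite gE mulr_sumr; apply: eq_bigr => s _; rewrite mulrCA.
move=> sumP; suff gP k : (k < N)%N -> P 1%N (g k).
  by case=> k s; apply: (IHg k); apply: gP.
have [B] := ubnP k; elim: B k => // B IHB k; rewrite ltnS => kB kN.
have g0 (j : 'I_N) : (j < k)%N -> g j = 0.
  move=> jk; have Pgj := IHB j (leq_trans jk kB) (ltn_ord j).
  by rewrite gE big1 // => s _; rewrite (IHg _ Pgj) rmorph0 mul0r.
pose rest := \sum_(j < N | (k < j)%N) x 0%N ^+ (j - k).-1 * g j.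
have sumE : \sum_(j < N) x 0%N ^+ j * g j = x 0%N ^+ k * (g k + x 0%N * rest).
  rewrite (bigID (fun j : 'I_N => (j < k)%N)) /= big1 ?add0r; last first.
    by move=> j jk; rewrite g0 // mulr0.
  rewrite (bigD1 (Ordinal kN)) ?ltnn //= mulrDr; congr (_ + _).
  rewrite !mulr_sumr; apply: eq_big => [j|j /andP[jk kj]].
    by rewrite -leqNgt -val_eqE /= ltn_neqAle andbC eq_sym.
  have {}kj : (k < j)%N by rewrite ltn_neqAle leqNgt jk andbT eq_sym.
  by rewrite !mulrA -exprSr -exprD; congr (_ ^+ _ * _); lia.
have Pxl l : ~ P 0%N (x 0%N ^+ l).
  have [_ P0n _] := Pprime 0%N isT.
  by elim: l => [|l IHl]; rewrite ?expr0 // exprS => /Pm0[].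
have : P 0%N (g k + x 0%N * rest).
  by move: sumP; rewrite sumE => /Pm0[/Pxl|].
move/P01 => Pg; rewrite -[g k](addrK (x 0%N * rest)).
by apply: PD1 => //; rewrite -mulNr -mulrC; apply: (PM1); rewrite -mulN1r; apply: PM1.
Qed.

(** A chain with [d + 2] members would make the [N^(d+1)] monomials of
    [chain_monomial] independent inside a space of dimension [O(N^d)]. *)
Lemma krull_dim_le d C (fil : nat -> set R) :
  (forall x, exists w, fil w x) -> (forall w w', (w <= w')%N -> fil w `<=` fil w') ->
  fil 0%N 1 -> (forall w w' x y, fil w x -> fil w' y -> fil (w + w')%N (x * y)) ->
  (forall w, exists (J : finType) (g : J -> R),
     (#|J| <= C * w.+1 ^ d)%N /\ fil w `<=` lin_span iota g) ->
  forall k (P : nat -> set R), prime_chain k P -> (k <= d)%N.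
Proof.
move=> fil_ex fil_mono fil1 filM fil_dim k P [Pprime Plt].
rewrite leqNgt; apply/negP => dk.
have x_ex i : exists y, (i < k)%N -> P i.+1 y /\ ~ P i y.
  have [ik|] := boolP (i < k)%N; last by exists 0.
  have [sPP nPP] := Plt i ik; apply: contrapT => noy; apply: nPP => y Py.
  by apply: contrapT => nPy; apply: noy; exists y.
have [x xP] := choice x_ex.
have [w wP] : exists w, forall i, (i <= d)%N -> fil w (x i).
  elim: (d) => [|e [w wP]].
    by have [w wx] := fil_ex (x 0%N); exists w => i; rewrite leqn0 => /eqP ->.
  have [w' w'x] := fil_ex (x e.+1); exists (maxn w w') => i.
  rewrite leq_eqVlt => /predU1P[->|ie]; first exact: fil_mono (leq_maxr w w') _ w'x.
  exact: fil_mono (leq_maxl w w') _ (wP i ie).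
have filX v y l : fil v y -> fil (l * v)%N (y ^+ l).
  by move=> fy; elim: l => [|l IHl]; rewrite ?mul0n ?expr0 // mulSn exprS; apply: filM.
have fil_mon N e (y : nat -> R) (s : multi_index N e) :
    (forall i, (i < e)%N -> fil w (y i)) -> fil (e * (N * w))%N (chain_monomial y s).
  elim: e y s => [|e IHe] y s yw; first by rewrite mul0n.
  rewrite mulSn; apply: filM; last by apply: IHe => i ie; apply: yw.
  apply: fil_mono (filX w (y 0%N) s.1 (yw 0%N isT)).
  by rewrite leq_mul2r ltnW ?orbT // ltn_ord.
pose N := (C * (d.+1 * w).+1 ^ d).+1.
have [J [g [cardJ Jspan]]] := fil_dim (d.+1 * (N * w))%N.
have [||c sum0 [s cs]] := @lin_span_dependent K R iota (multi_index N d.+1) J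
    (chain_monomial x) g.
- rewrite card_multi_index (leq_ltn_trans cardJ) //.
  have le : ((d.+1 * (N * w)).+1 <= (d.+1 * w).+1 * N)%N.
    have -> : (d.+1 * (N * w) = d.+1 * w * N)%N by rewrite -mulnA [(w * N)%N]mulnC.
    by rewrite [X in (_ <= X)%N]mulSn -add1n leq_add2r.
  apply: (@leq_ltn_trans (C * ((d.+1 * w).+1 * N) ^ d)).
    rewrite leq_mul2l; apply/orP; right.
    by case: (posnP d) => [->|d_gt0]; rewrite ?expn0 // leq_exp2r.
  by rewrite expnMn mulnA expnS ltn_pmul2r ?expn_gt0.
- by move=> s; apply: Jspan; apply: fil_mon => i id; apply: wP.
case/negP: cs; apply/eqP; apply: (@chain_independent N d.+1 P x _ _ c).
- by move=> i id; apply: Pprime; apply: leq_trans dk.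
- move=> i id; have ik := leq_trans id dk; have [sPP _] := Plt i ik.
  by split=> //; apply: xP.
- rewrite sum0; by have [[]] := Pprime 0%N isT.
Qed.

End KrullDimension.

Section DeformationDimension.
Variables (K : fieldType) (m n : nat).
Hypotheses (m_gt0 : (0 < m)%N) (n_gt0 : (0 < n)%N) (K2 : (2%:R : K) != 0).
Local Notation R := (deformation_ring K m n).
Local Notation scal := (deformation_scalar K m n).
Local Notation gen := (defgen K m n).
Local Notation a := (gen 0).
Local Notation b := (gen 1).
Local Notation c := (gen 2).
Local Notation d := (gen 3).
Local Notation t := (gen 4).
Local Notation gr := (@deformation_grading K m n).
Local Notation gm := (grade_map K m_gt0 n_gt0).
Local Notation nzR := (nzdefring K m_gt0 n_gt0).

(** The triples of exponents are bounded by [w] only to make the family finite;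
    the indices 0, 1, 2 of ['I_3] stand for [b], [c] and [d]. *)
Definition normal_monomial w (s : 'I_3 * ('I_w.+1 * 'I_w.+1 * 'I_w.+1)) : R :=
  a ^+ s.2.1.1 * t ^+ s.2.1.2 * gen s.1.+1 ^+ s.2.2.

Lemma normal_monomial_span w z i k j : (z < 3)%N -> (i <= w)%N -> (k <= w)%N -> (j <= w)%N ->
  lin_span scal (@normal_monomial w) (a ^+ i * t ^+ k * gen z.+1 ^+ j).
Proof.
move=> z3 iw kw jw.
have -> : a ^+ i * t ^+ k * gen z.+1 ^+ j =
    @normal_monomial w (inord z, (inord i, inord k, inord j)).
  by rewrite /normal_monomial /= !inordK.
exact: lin_span_gen.
Qed.

Lemma normal_monomial_spanS v w x : (v < w)%N -> lin_span scal (@normal_monomial v) x ->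
  lin_span scal (@normal_monomial w) (a * x) /\ lin_span scal (@normal_monomial w) (t * x).
Proof.
have le_w (i : 'I_v.+1) : (v < w)%N -> (i < w)%N by apply: leq_trans; apply: ltn_ord.
move=> vw vx; split; apply: lin_spanM vx => -[z [[i k] j]]; rewrite /normal_monomial /=.
  rewrite !mulrA -exprS.
  by apply: normal_monomial_span; rewrite ?(ltn_ord z) ?(ltnW (le_w _ vw)) ?le_w.
rewrite mulrA mulrCA -exprS.
by apply: normal_monomial_span; rewrite ?(ltn_ord z) ?(ltnW (le_w _ vw)) ?le_w.
Qed.

Lemma gr_normal_monomial_span W x : gr W x -> lin_span scal (@normal_monomial W) x.
Proof.
have [B] := ubnP W; elim: B W x => // B IHB [|W] x; rewrite ltnS => WB gx.
  have [y ->] := gr0_scal m_gt0 n_gt0 gx; rewrite -[scal y]mulr1; apply: lin_spanZ.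
  have := @normal_monomial_span 0 0 0 0 0 isT isT isT isT.
  by rewrite !expr0 !mul1r.
have [x1 [x2 [p [q [r [g1 g2 ->]]]]]] := gr_reduce m_gt0 n_gt0 (isT : 0 < W.+1)%N gx.
have exp_le k : (0 < k)%N -> ((W.+1 %/ k).-1.+1 <= W.+1)%N.
  by move=> k_gt0; have := leq_div W.+1 k; case: (_ %/ _)%N.
have power z j : (z < 3)%N -> (j <= W.+1)%N ->
    lin_span scal (@normal_monomial W.+1) (gen z.+1 ^+ j).
  move=> z3 jW; have := @normal_monomial_span W.+1 z 0 0 j z3 isT isT jW.
  by rewrite !expr0 !mul1r.
rewrite /five_terms; do 4?apply: lin_spanD.
- by have [] := normal_monomial_spanS (_ : W.+1 - m < W.+1)%N (IHB _ _ _ g1); [lia|lia|].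
- by have [] := normal_monomial_spanS (_ : W.+1 - 2 < W.+1)%N (IHB _ _ _ g2); [lia|lia|].
- by apply: lin_spanZ; apply: (power 0%N); rewrite ?exp_le ?muln_gt0.
- by apply: lin_spanZ; apply: (power 1%N); rewrite ?exp_le ?muln_gt0.
- by apply: lin_spanZ; apply: (power 2%N); rewrite ?exp_le ?muln_gt0 ?m_gt0.
Qed.

Lemma normal_monomial_span_le v w x : (v <= w)%N ->
  lin_span scal (@normal_monomial v) x -> lin_span scal (@normal_monomial w) x.
Proof.
move=> vw vx; rewrite -[x]mul1r; apply: lin_spanM vx => -[z [[i k] j]].
have le_w (l : 'I_v.+1) : (l <= w)%N by apply: leq_trans vw; rewrite -ltnS.
by rewrite mul1r; apply: normal_monomial_span.
Qed.

Lemma defring_krull_dim_le k (P : nat -> set R) : prime_chain k P -> (k <= 3)%N.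
Proof.
pose fil w := [set x : R | (size (gm x) <= w.+1)%N].
apply: (@krull_dim_le K R scal 3 3 fil).
- by move=> x; exists (size (gm x)); rewrite /fil /= leqnSn.
- by move=> w w' ww' x /leq_trans; apply.
- by rewrite /fil /= (rmorph1 gm); apply: eq_leq; apply: size_poly1.
- move=> w w' x y xw yw; rewrite /fil /= rmorphM.
  apply: (leq_trans (size_polyMleq _ _)); rewrite -[(w + w').+1]/((w.+1 + w').+1.-1).
  by rewrite -!subn1 -addnS leq_sub2r // leq_add.
- move=> w; exists ('I_3 * ('I_w.+1 * 'I_w.+1 * 'I_w.+1))%type, (@normal_monomial w).
  split; first by rewrite !card_prod !card_ord !expnS expn0 muln1 -!mulnA.
  move=> x xw; rewrite (grade_map_sum m_gt0 n_gt0 x); apply: lin_span_sum => i.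
  apply: (@normal_monomial_span_le i); first by rewrite -ltnS (leq_trans (ltn_ord i)).
  by apply: gr_normal_monomial_span; apply: gr_grade_map.
Qed.

Let Phi : {rmorphism nzR -> {poly {poly K}}} := affine_param n m_gt0 K2.

(** [affine_param] homogenized by a third variable [z], which records the degree.
    Setting [u], [t1] and [z] to zero one after the other enlarges the kernel by
    [a], [t] and [d]. *)
Let param : {rmorphism R -> {poly {poly {poly K}}}} := (map_poly Phi \o gm).
Let ev_t : {rmorphism {poly {poly K}} -> {poly K}} := map_poly (horner_eval (0 : K)).
Let ev_u : {rmorphism {poly {poly {poly K}}} -> {poly {poly K}}} := map_poly ev_t.
Let param1 : {rmorphism R -> {poly {poly K}}} := (ev_u \o param).
Let param2 : {rmorphism R -> {poly K}} := (ev_t \o param1).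
Let param3 : {rmorphism R -> K} := (horner_eval (0 : K) \o param2).

Let param_gen i : (i < 5)%N -> param (gen i) = (Phi (gen i))%:P * 'X^(defwt m n i).
Proof. by move=> i5; rewrite /= grade_map_gen // rmorphM /= map_polyC map_polyXn. Qed.

Let param1E x : param1 x = ev_u (param x). Proof. by []. Qed.
Let param2E x : param2 x = ev_t (param1 x). Proof. by []. Qed.
Let param3E x : param3 x = (param2 x).[0]. Proof. by []. Qed.

Let ev_uCX (f : {poly {poly K}}) k : ev_u (f%:P * 'X^k) = (ev_t f)%:P * 'X^k.
Proof. by rewrite rmorphM /= map_polyC map_polyXn. Qed.

Let ev_tCX (f : {poly K}) k : ev_t (f%:P * 'X^k) = (f.[0])%:P * 'X^k.
Proof. by rewrite rmorphM /= map_polyC map_polyXn. Qed.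

Let ev_tC (f : {poly K}) : ev_t f%:P = (f.[0])%:P.
Proof. by rewrite /= map_polyC. Qed.

Let param1_gen i : (i < 5)%N ->
  param1 (gen i) = (ev_t (Phi (gen i)))%:P * 'X^(defwt m n i).
Proof. by move=> i5; rewrite param1E param_gen // ev_uCX. Qed.

Lemma defring_prime_chain : exists P : nat -> set R, prime_chain 3 P.
Proof.
have [pa pb pc pd pt] := affine_paramE n m_gt0 K2.
have U0 : ('X^(2 * n) + 1 : {poly K}).[0] = 1.
  by rewrite hornerD hornerXn hornerC expr0n gtn_eqF ?muln_gt0 ?n_gt0 // add0r.
have ev_a : ev_t (Phi a) = 0.
  by rewrite [Phi a]pa ev_tC hornerM hornerX mul0r.
have ev_t' : ev_t (Phi t) = 'X.
  rewrite [Phi t]pt; transitivity (((('X^(2 * n) + 1) ^+ 2).[0])%:P * 'X^1 : {poly K}).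
    exact: (ev_tCX _ 1).
  by rewrite horner_exp U0 expr1n mul1r.
have ev_d : ev_t (Phi d) = (quarter K n)%:P.
  by rewrite [Phi d]pd ev_tC hornerM hornerC horner_exp U0 expr1n mulr1.
have Xn_neq0 (L : nzRingType) k : 'X^k != 0 :> {poly L} by rewrite monic_neq0 ?monicXn.
have a0 : param a <> 0.
  rewrite (param_gen (isT : 0 < 5)%N) => /eqP.
  rewrite mulf_eq0 polyC_eq0 (negPf (Xn_neq0 _ _)) orbF => /eqP Pa0.
  have := affine_param0_a_neq0 m_gt0 n_gt0 K2.
  by rewrite /= [affine_param _ _ _ _]Pa0 /horner_eval horner0 eqxx.
have a1 : param1 a = 0 by rewrite (param1_gen (isT : 0 < 5)%N) ev_a mul0r.
have t1 : param1 t = 'X%:P * 'X^2 by rewrite (param1_gen (isT : 4 < 5)%N) ev_t'.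
have t1_neq0 : param1 t <> 0.
  by rewrite t1 => /eqP; rewrite mulf_eq0 polyC_eq0 polyX_eq0 (negPf (Xn_neq0 _ _)).
have t2 : param2 t = 0 by rewrite param2E t1 ev_tCX hornerX mul0r.
have d2 : param2 d = (quarter K n)%:P * 'X^(2 * m * n).
  by rewrite param2E (param1_gen (isT : 3 < 5)%N) ev_d ev_tCX hornerC.
have d2_neq0 : param2 d <> 0.
  rewrite d2 => /eqP; rewrite mulf_eq0 polyC_eq0 (negPf (quarter_neq0 n K2)).
  by rewrite (negPf (Xn_neq0 _ _)).
have d3 : param3 d = 0.
  rewrite param3E d2 hornerM hornerXn expr0n gtn_eqF ?mulr0 //.
  by rewrite !muln_gt0 m_gt0 n_gt0.
exists (fun i => nth setT [:: [set x | param x = 0]; [set x | param1 x = 0];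
  [set x | param2 x = 0]; [set x | param3 x = 0]] i).
split=> -[|[|[|[|]]]] // _; try exact: is_prime_ker.
- split=> [x x0|sub]; first by rewrite -[_ x]/(param1 x = 0) param1E [param x]x0 rmorph0.
  by apply: a0; apply: sub.
- split=> [x x0|sub]; last by apply: t1_neq0; apply: sub.
  by rewrite -[_ x]/(param2 x = 0) param2E [param1 x]x0 rmorph0.
- split=> [x x0|sub]; last by apply: d2_neq0; apply: sub.
  by rewrite -[_ x]/(param3 x = 0) param3E [param2 x]x0 horner0.
Qed.

Lemma defring_krull_dim : has_krull_dim R 3.
Proof. by split; [exact: defring_prime_chain | exact: defring_krull_dim_le]. Qed.

End DeformationDimension.

(** * Failure of deformation of F-regularity *)

Lemma deformation_properties (K : fieldType) (p m n : nat) :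
  p \in [pchar K] -> (2 < p)%N -> (0 < m)%N -> (0 < n)%N -> (2 * n + m < n * m)%N ->
  let R := deformation_ring K m n in
  let t := deformation_t K m n in
  let gr := @deformation_grading K m n in
  [/\ N_graded (deformation_scalar K m n) gr,
      has_krull_dim R 3
    & [/\ homogeneous gr t, irrelevant_ideal gr t & nonzerodivisor t]]
  /\ [/\ F_regular p (ring_quot [set t]), ~ F_regular p R & ~ F_pure p R].
Proof.
move=> charKp p_gt2 m_gt0 n_gt0 mn R t gr.
have K2 : (2%:R : K) != 0.
  rewrite -(dvdn_pcharf charKp); apply/negP => /dvdn_leq => /(_ isT).
  by rewrite leqNgt p_gt2.
have gr_t : gr 2 t by exact: (@gr_gen K m n 4).
split; split.
- exact: defring_N_graded.
- exact: defring_krull_dim.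
- split; [by exists 2| |exact: defring_t_nonzerodivisor].
  exists 2, (fun i => if i == 1%N then t else 0); split=> [i|].
    by case: eqP => [->|_] //; apply: gr0.
  by rewrite !big_ord_recr big_ord0 /= !add0r.
- exact: special_fibre_F_regular.
- exact: not_F_regular.
- exact: not_F_pure.
Qed.

Theorem theorem1p1 (K : fieldType) (p : nat) (charKp : p \in [pchar K])
    (p_gt2 : (2 < p)%N) :
  (exists (R : comPzRingType) (iota : {rmorphism K -> R}) (gr : nat -> set R),
     [/\ N_graded iota gr,
         has_krull_dim R 3,
         ~ F_pure p R
       & exists t : R,
           [/\ homogeneous gr t, irrelevant_ideal gr t, nonzerodivisor t
             & F_regular p (ring_quot [set t])]])
  /\
  (forall m n : nat, (0 < m)%N -> (0 < n)%N ->
     2 < (m%:R - m%:R / n%:R : rat) ->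
     let R := deformation_ring K m n in
     let t := deformation_t K m n in
     let gr := @deformation_grading K m n in
     [/\ N_graded (deformation_scalar K m n) gr,
         has_krull_dim R 3
       & [/\ homogeneous gr t, irrelevant_ideal gr t & nonzerodivisor t]]
     /\
     [/\ F_regular p (ring_quot [set t]),
         ~ F_regular p R
       & coprime p m -> ~ F_pure p R]).
Proof.
split=> [|m n m_gt0 n_gt0 /(slope_condition n_gt0) mn R t gr].
  (* The smallest admissible [m] for [n = 2]. *)
  have [] := @deformation_properties K p 5 2 charKp p_gt2 isT isT isT.
  move=> [Ngr dim3 [t_homog t_irr t_nzd]] [Freg _ nFpure].
  exists (deformation_ring K 5 2), (deformation_scalar K 5 2), (@deformation_grading K 5 2).
  by split=> //; exists (deformation_t K 5 2).
have [grR [Freg nFreg nFpure]] := deformation_properties charKp p_gt2 m_gt0 n_gt0 mn.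
by split; [exact: grR | split=> // _].
Qed.
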